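(* Let $\mathcal W$ be a finite set of arms. Let $(Y_t(w))_{w\in\mathcal W}$, $t=1,2,\dots$, be independent and identically distributed vectors of real-valued potential outcomes, each $Y_t(w)$ having nonzero variance and $\mathbb E|Y_t(w)|^{2+\delta}<\infty$ for some $\delta>0$ and all $w$. At each time $t$ an arm $W_t$ is drawn and $Y_t=Y_t(W_t)$ is observed; $H^{t-1}=\{(W_s,Y_s)\}_{s<t}$. The assignment probabilities $e_t(w)=\mathbb P[W_t=w\mid H^{t-1}]$ are known, strictly positive, and the conditional law of $W_t$ given $H^{t-1}$ and all potential outcomes $(Y_s(\cdot))_{s\ge t}$ depends only on $H^{t-1}$. Fix $w\in\mathcal W$ and let $Q(w)=\mathbb E[Y_t(w)]$. Let $\hat m_t(w)$ be $H^{t-1}$-measurable, uniformly bounded, and converge almost surely to some constant $m_\infty(w)$. Define the AIPW scores $$\hat\Gamma_t(w)=\frac{\mathbb 1\{W_t=w\}}{e_t(w)}Y_t+\Big(1-\frac{\mathbb 1\{W_t=w\}}{e_t(w)}\Big)\hat m_t(w).$$ Let $h_t(w)\ge 0$ be $H^{t-1}$-measurable weights (possibly depending on $T$) satisfying: (i) $\big(\sum_{t=1}^T h_t(w)\big)^2\big/\mathbb E\big[\sum_{t=1}^T h_t^2(w)/e_t(w)\big]\to\infty$ in probability as $T\to\infty$; (ii) for some $p>1$, $\sum_{t=1}^T \frac{h_t^2(w)}{e_t(w)}\Big/\mathbb E\Big[\sum_{t=1}^T\frac{h_t^2(w)}{e_t(w)}\Big]\to 1$ in $L_p$ as $T\to\infty$;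 (iii) for some $\delta>0$, $\sum_{t=1}^T \frac{h_t^{2+\delta}(w)}{e_t^{1+\delta}(w)}\Big/\mathbb E\Big[\sum_{t=1}^T\frac{h_t^2(w)}{e_t(w)}\Big]^{1+\delta/2}\to 0$ in probability as $T\to\infty$. Suppose moreover that either $\hat m_t(w)\to Q(w)$ almost surely as $t\to\infty$, or $e_t(w)\to e_\infty(w)$ almost surely for some $e_\infty(w)\in[0,1]$. Then the adaptively-weighted estimator $$\hat Q_T^h(w)=\frac{\sum_{t=1}^T h_t(w)\hat\Gamma_t(w)}{\sum_{t=1}^T h_t(w)}$$ is consistent for $Q(w)$, and $$\frac{\hat Q^h_T(w)-Q(w)}{\hat V^h_T(w)^{1/2}}\xrightarrow{d}\mathcal N(0,1),\qquad \hat V^h_T(w)=\frac{\sum_{t=1}^T h_t^2(w)\big(\hat\Gamma_t(w)-\hat Q^h_T(w)\big)^2}{\big(\sum_{t=1}^T h_t(w)\big)^2}.$$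
   Context: ''$H^{t-1}$-measurable'' (history-adapted) means a function of the history of arms and outcomes up to time $t-1$. *)

(* Defs.v *)
From HB Require Import structures.
From mathcomp Require Import all_boot all_order all_algebra.
From mathcomp Require Import all_classical all_reals all_analysis.
Set Implicit Arguments.
Unset Strict Implicit.
Unset Printing Implicit Defensive.
Import Order.TTheory GRing.Theory Num.Theory.
Import numFieldNormedType.Exports.
Local Open Scope classical_set_scope.
Local Open Scope ring_scope.

Section bandit_defs.
Context {R : realType} {d : measure_display} {T : measurableType d}.
Context {W : finType}.

(* Arms are drawn from time 0 on: [Wt t] is the arm at time t, [Y t a] the
   potential outcome of arm a at time t. *)

Definition hist_gen (Wt : nat -> T -> W) (Y : nat -> W -> T -> R) (t : nat)
  : set_system T :=
  [set A | exists2 s, (s < t)%N &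
     ((exists a : W, A = Wt s @^-1` [set a]) \/
      (exists2 B : set R, measurable B &
          A = (fun x => Y s (Wt s x) x) @^-1` B))].

Definition hist_sigma Wt Y t : set_system T := <<s hist_gen Wt Y t >>.

Definition future_gen (Y : nat -> W -> T -> R) (t : nat) : set_system T :=
  [set A | exists s, exists a : W, (t <= s)%N /\
     exists2 B : set R, measurable B & A = Y s a @^-1` B].

Definition vec_gen (Y : nat -> W -> T -> R) (t : nat) : set_system T :=
  [set A | exists a : W, exists2 B : set R, measurable B & A = Y t a @^-1` B].

Definition meas_wrt (G : set_system T) (f : T -> R) :=
  forall B : set R, measurable B -> G (f @^-1` B).

Definition is_cond_prob (P : probability T R) (G : set_system T) (Z : set T)
  (f : T -> R) :=
  meas_wrt G f /\
  forall A, G A -> P (A `&` Z) = (\int[P]_(x in A) (f x)%:E)%E.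

Definition iid_vectors (P : probability T R) (Y : nat -> W -> T -> R) :=
  (forall (S : seq nat), uniq S -> forall A : nat -> set T,
      (forall s, s \in S -> <<s vec_gen Y s >> (A s)) ->
      P (\bigcap_(s in [set` S]) A s) = (\prod_(s <- S) P (A s))%E) /\
  (forall (t : nat) (B : W -> set R), (forall a, measurable (B a)) ->
      P (\bigcap_(a in [set: W]) (Y t a @^-1` B a)) =
      P (\bigcap_(a in [set: W]) (Y 0%N a @^-1` B a))).

Definition aipw (Wt : nat -> T -> W) (Y : nat -> W -> T -> R)
  (e : nat -> W -> T -> R) (mh : nat -> T -> R) (w : W) (t : nat) (x : T) : R :=
  let ind := ((Wt t x == w)%:R : R) in
  ind / e t w x * Y t (Wt t x) x + (1 - ind / e t w x) * mh t x.

(* Adaptively weighted estimator Q^h_T(w); h T t = h_t(w) for horizon T,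
   summed over the T times t = 0, ..., T-1. *)
Definition Qhat Wt Y e mh w (h : nat -> nat -> T -> R) (TT : nat) (x : T) : R :=
  (\sum_(t < TT) h TT t x * aipw Wt Y e mh w t x) / (\sum_(t < TT) h TT t x).

Definition Vhat Wt Y e mh w (h : nat -> nat -> T -> R) (TT : nat) (x : T) : R :=
  (\sum_(t < TT) h TT t x ^+ 2 * (aipw Wt Y e mh w t x - Qhat Wt Y e mh w h TT x) ^+ 2)
  / (\sum_(t < TT) h TT t x) ^+ 2.

Definition Sh2e (e : nat -> W -> T -> R) (w : W) (h : nat -> nat -> T -> R)
  (TT : nat) (x : T) : R :=
  \sum_(t < TT) h TT t x ^+ 2 / e t w x.

Definition Dh (P : probability T R) e w h (TT : nat) : R :=
  fine ('E_P[Sh2e e w h TT])%E.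

End bandit_defs.

(* Main.v *)
(* Put D = E[sum h_t^2 / e_t] and let x_t = h_t (Gamma_t - Q) / sqrt D.  Since W_t is
   independent of Y_t given the history, the x_t are martingale differences with
   conditional variances (h_t^2 / (e_t D)) (sigma^2 + (1 - e_t) (Q - m_t)^2), and (ii),
   (iii) and the convergence alternative make their sum tend in probability to the constant
   v = sigma^2 + lim (1 - e_t) (Q - m_t)^2: each single weight is negligible by (iii), so
   only the tail of the convergent sequence counts.
   The array is stopped predictably so that the conditional variances and the
   Lyapunov sum are bounded.  A telescoping comparison of cos (a S + b), and of
   exp (- a sum x_t^2), with the exponential compensator then gives
   E cos (a S + b) -> exp (- a^2 v / 2) cos b and sum x_t^2 -> v in probability.  The first
   fact is turned into convergence of distribution functions by polynomials in
   cos (a x + b) approximating a step on a large interval; the second one, together with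
   consistency, which follows from tightness of S and (i), identifies the limit of
   D^-1 sum h_t^2 (Gamma_t - Qhat)^2, and Slutsky's lemma concludes. *)
Require Import Defs.
From HB Require Import structures.
From mathcomp Require Import all_boot all_order all_algebra.
From mathcomp Require Import all_classical all_reals all_analysis.
From mathcomp Require Import measurable_realfun.
From mathcomp Require Import zify ring lra.
Import Order.TTheory GRing.Theory Num.Theory.
Import numFieldNormedType.Exports.
Local Open Scope classical_set_scope.
Local Open Scope ring_scope.
Set Implicit Arguments.
Unset Strict Implicit.
Unset Printing Implicit Defensive.

(** * Integrals and events of high probability *)

(** The weights may change with the horizon and [1 / e_t] is unbounded, so the scores form a
    triangular array controlled only in probability; stopping supplies the deterministic bounds that
    integration needs. No conditional expectation is ever formed: mean zero and conditional variance
    are tested against bounded history-measurable multipliers. These identities come from one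
    product formula, which asks for integrability of the multiplier times [e_t] only and so admits
    inverse propensities. The conditional variance is random, hence it is compensated inside the
    integral; the exponential weight is removed at the end, where it is nearly constant with high
    probability. The phase [b] lets real cosines do the work of complex exponentials, and products
    of such cosines are again sums of them. One exponent [q] in [2, 3] serves the moments, (iii) and
    all Taylor remainders. Both convergence alternatives enter through one constant [kappa], the
    almost sure limit of [(1 - e_t) (Q - m_t) ^ 2]. *)

Section level_sets.
Context {d : measure_display} {T : measurableType d} {R : realType}.
Implicit Types (f : T -> R) (a : R).

Lemma measurable_le_set f a : measurable_fun setT f -> measurable [set x | f x <= a].
Proof.
move=> mf; rewrite -[X in measurable X]setTI.
by apply: (measurable_fun_le (g := cst a)).
Qed.

Lemma measurable_ge_set f a : measurable_fun setT f -> measurable [set x | a <= f x].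
Proof.
move=> mf; rewrite -[X in measurable X]setTI.
by apply: (measurable_fun_le (f := cst a)).
Qed.

Lemma measurable_gt_set f a : measurable_fun setT f -> measurable [set x | a < f x].
Proof.
move=> mf; rewrite (_ : [set x | _] = ~` [set x | f x <= a]).
  by apply: measurableC; exact: measurable_le_set.
by apply/seteqP; split => x /=; rewrite ltNge => /negP.
Qed.

End level_sets.

Section integrals.
Context {d : measure_display} {T : measurableType d} {R : realType}.
Variable P : probability T R.
Implicit Types f g : T -> R.

Definition intg f := P.-integrable setT (EFin \o f).

Lemma intg_mfun f : intg f -> measurable_fun setT f.
Proof. by move=> /integrableP[/measurable_EFinP]. Qed.

Lemma intg_bnd f (M : R) : measurable_fun setT f -> (forall x, `|f x| <= M) ->
  intg f.
Proof.
move=> mf fM; apply: measurable_bounded_integrable => //.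
  by rewrite -ge0_fin_numE ?fin_num_measure.
by exists M; split; [exact: num_real|move=> N MN x _ /=; exact: le_trans (ltW MN)].
Qed.

Lemma intg_cst (c : R) : intg (fun=> c).
Proof. by apply: (intg_bnd (M := `|c|)). Qed.

Lemma intgD f g : intg f -> intg g -> intg (fun x => f x + g x).
Proof.
move=> If Ig; have := integrableD measurableT If Ig.
by apply: eq_integrable => // x _ /=; rewrite EFinD.
Qed.

Lemma intgB f g : intg f -> intg g -> intg (fun x => f x - g x).
Proof.
move=> If Ig; have := integrableB measurableT If Ig.
by apply: eq_integrable => // x _ /=; rewrite EFinB.
Qed.

Lemma intgZ (c : R) f : intg f -> intg (fun x => c * f x).
Proof.
move=> If; have := integrableZl measurableT c If.
by apply: eq_integrable => // x _ /=; rewrite EFinM.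
Qed.

Lemma intg_le f g : measurable_fun setT f -> intg g ->
  (forall x, `|f x| <= `|g x|) -> intg f.
Proof.
move=> mf Ig fg; apply: le_integrable Ig => //; first exact/measurable_EFinP.
by move=> x _; rewrite /= lee_fin.
Qed.

Lemma intgM_bnd f g (M : R) : measurable_fun setT f -> (forall x, `|f x| <= M) ->
  intg g -> intg (fun x => f x * g x).
Proof.
move=> mf fM Ig; apply: (@intg_le _ (fun x => M * g x)).
- by apply: measurable_funM => //; exact: intg_mfun.
- exact: intgZ.
- move=> x; rewrite !normrM ler_wpM2r//; apply: (le_trans (fM x)).
  exact: ler_norm.
Qed.

Lemma intg_abs f : intg f -> intg (fun x => `|f x|).
Proof.
move=> If; apply: (intg_le _ If) => [|x]; last by rewrite normr_id.
by apply: measurableT_comp => //; exact: intg_mfun.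
Qed.

Lemma intg_sum (n : nat) (F : nat -> T -> R) : (forall k, (k < n)%N -> intg (F k)) ->
  intg (fun x => \sum_(k < n) F k x).
Proof.
elim: n => [_|n IH Fk].
  by under eq_fun do rewrite big_ord0; exact: intg_cst.
under eq_fun do rewrite big_ord_recr /=.
by apply: intgD; [apply: IH => k kn; apply: Fk; exact: ltnW|exact: Fk].
Qed.

Notation "'E[' f ]" := (\int[P]_x f x).

Lemma EZ (c : R) f : intg f -> \int[P]_x (c * f x) = c * E[f].
Proof. by move=> If; rewrite RintegralZl. Qed.

Lemma ED f g : intg f -> intg g -> \int[P]_x (f x + g x) = E[f] + E[g].
Proof. by move=> If Ig; rewrite RintegralD. Qed.

Lemma EB f g : intg f -> intg g -> \int[P]_x (f x - g x) = E[f] - E[g].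
Proof. by move=> If Ig; rewrite RintegralB. Qed.

Lemma Ecst (c : R) : \int[P]_x c = c.
Proof.
rewrite Rintegral_cst// (_ : fine _ = 1) ?mulr1//.
exact: (congr1 fine (probability_setT P)).
Qed.

Lemma Ele f g : intg f -> intg g -> (forall x, f x <= g x) -> E[f] <= E[g].
Proof. by move=> If Ig fg; apply: le_Rintegral. Qed.

Lemma Eabs f : intg f -> `|E[f]| <= \int[P]_x `|f x|.
Proof. by move=> If; exact: le_normr_Rintegral. Qed.

Lemma Esum (n : nat) (F : nat -> T -> R) : (forall k, (k < n)%N -> intg (F k)) ->
  \int[P]_x (\sum_(k < n) F k x) = \sum_(k < n) E[F k].
Proof.
elim: n => [_|n IH Fk].
  rewrite big_ord0; under eq_Rintegral do rewrite big_ord0.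
  by rewrite Ecst.
rewrite big_ord_recr /= -IH; last by move=> k kn; apply: Fk; exact: ltnW.
rewrite -ED; first by apply: eq_Rintegral => x _; rewrite big_ord_recr.
  by apply: intg_sum => k kn; apply: Fk; exact: ltnW.
exact: Fk.
Qed.

Lemma Edist f g h : intg f -> intg g -> intg h ->
  (forall x, `|f x - g x| <= h x) -> `|E[f] - E[g]| <= E[h].
Proof.
move=> If Ig Ih fgh; rewrite -EB//; apply: le_trans (Eabs (intgB If Ig)) _.
by apply: Ele => //; exact/intg_abs/intgB.
Qed.

Lemma intg_ge0 f : measurable_fun setT f -> (forall x, 0 <= f x) ->
  (\int[P]_x (f x)%:E < +oo)%E -> intg f.
Proof.
move=> mf f0 fy; apply/integrableP; split; first exact/measurable_EFinP.
by under eq_integral => x _ do rewrite /= ger0_norm//.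
Qed.

Lemma intgE f : intg f -> (\int[P]_x (f x)%:E)%E = (E[f])%:E.
Proof. by move=> If; rewrite fineK//; exact: integrable_fin_num. Qed.

Lemma indic_mfun (A : set T) : measurable A -> measurable_fun setT (\1_A : T -> R).
Proof. by move=> mA; exact: measurable_indic. Qed.

Lemma indic_bnd (A : set T) x : `|\1_A x : R| <= 1.
Proof. by rewrite indicE; case: (_ \in _); rewrite ?normr1 ?normr0. Qed.

Lemma Eindic (A : set T) : measurable A -> \int[P]_x (\1_A x : R) = fine (P A).
Proof.
by move=> mA; congr fine; rewrite integral_indic ?setIT.
Qed.

Lemma intg_indic (A : set T) : measurable A -> intg (\1_A : T -> R).
Proof. by move=> mA; apply: (intg_bnd (indic_mfun mA)) (indic_bnd A). Qed.

Lemma markov_ge0 f (a : R) : intg f -> (forall x, 0 <= f x) -> 0 < a ->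
  (P [set x | (a <= f x)%R] <= (E[f] / a)%:E)%E.
Proof.
move=> If f0 a0.
have mA : measurable [set x | a <= f x].
  by apply: measurable_ge_set; exact: intg_mfun.
rewrite -[leLHS]fineK ?fin_num_measure// lee_fin ler_pdivlMr// mulrC -Eindic//.
rewrite -EZ; last exact: intg_indic.
apply: Ele => //; first exact/intgZ/intg_indic.
by move=> x; rewrite indicE; case: (boolP (x \in _)) => [/set_mem|_] /=;
  rewrite ?mulr1 ?mulr0.
Qed.

(** The integral is split at [B]: the uniform bound [M] is paid only on the complement, whose
    probability is at most [eps]. This turns agreement with high probability into closeness of
    expectations. *)
Lemma Edist_whp f g (B : set T) (eps M : R) : intg f -> intg g ->
  measurable B -> 0 <= eps ->
  (forall x, `|f x - g x| <= M) -> (forall x, B x -> `|f x - g x| <= eps) ->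
  (P (~` B) <= eps%:E)%E -> `|E[f] - E[g]| <= (1 + M) * eps.
Proof.
move=> If Ig mB e0 fgM fgB PB.
have M0 : 0 <= M by have := fgM point; apply: le_trans.
have mC : measurable (~` B) by exact: measurableC.
apply: (@le_trans _ _ (\int[P]_x (eps + M * \1_(~` B) x))).
  apply: Edist => //; first by apply: intgD; [exact: intg_cst|exact/intgZ/intg_indic].
  move=> x; rewrite indicE; case: (boolP (x \in _)) => [/set_mem xB|].
    by rewrite mulr1; apply: (le_trans (fgM x)); rewrite lerDr.
  rewrite notin_setE => xB; rewrite mulr0 addr0; apply: fgB.
  exact: contrapT.
rewrite ED ?EZ ?Ecst ?Eindic//; [|exact: intg_indic|exact: intg_cst|exact/intgZ/intg_indic].
rewrite mulrDl mul1r lerD2l ler_wpM2l// -lee_fin fineK// fin_num_measure//.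
Qed.

End integrals.
Arguments intg_bnd {d T R P f M}.
Arguments intg_cst {d T R P} c.
Arguments intg_indic {d T R P A}.

(** * Events of inner probability tending to one *)

Section whp.
Context {d : measure_display} {T : measurableType d} {R : realType}.
Variable P : probability T R.
Implicit Types A B : nat -> set T.

(* Inner probability tending to 1: no measurability is required of [A n]. *)
Definition whp A := forall eps : R, 0 < eps -> \forall n \near \oo,
  exists B : set T, [/\ measurable B, B `<=` A n & (P (~` B) <= eps%:E)%E].

Lemma whpS A B : whp A -> (\forall n \near \oo, A n `<=` B n) -> whp B.
Proof.
move=> wA AB eps e0; near=> n.
have [C [mC CA PC]] : exists C : set T,
  [/\ measurable C, C `<=` A n & (P (~` C) <= eps%:E)%E] by near: n; exact: (wA _ e0).
exists C; split => //; apply: subset_trans CA _.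
by near: n.
Unshelve. all: by end_near. Qed.

Lemma whpI A B : whp A -> whp B -> whp (fun n => A n `&` B n).
Proof.
move=> wA wB eps e0; have e20 : 0 < eps / 2 by rewrite divr_gt0.
near=> n.
have [C [mC CA PC]] : exists C : set T,
  [/\ measurable C, C `<=` A n & (P (~` C) <= (eps / 2)%:E)%E].
  by near: n; exact: (wA _ e20).
have [D [mD DB PD]] : exists C : set T,
  [/\ measurable C, C `<=` B n & (P (~` C) <= (eps / 2)%:E)%E].
  by near: n; exact: (wB _ e20).
exists (C `&` D); split; [exact: measurableI| exact: setISS|].
rewrite setCI (splitr eps) EFinD; apply: le_trans (leeD PC PD).
by apply: measureU2 => //; exact: measurableC.
Unshelve. all: by end_near. Qed.

(** Lets a deterministic condition that holds eventually, such as positivity of the normalizer, be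
    intersected with random events. *)
Lemma whp_near A : (\forall n \near \oo, A n = setT) -> whp A.
Proof.
move=> nA eps e0; near=> n; exists setT; split => //.
  have -> // : A n = setT by near: n.
by rewrite setCT measure0 lee_fin ltW.
Unshelve. all: by end_near. Qed.

Lemma whp_cvg0 A : (forall n, measurable (A n)) -> P (A n) @[n --> \oo] --> 0%E ->
  whp (fun n => ~` A n).
Proof.
move=> mA /fine_cvgP[_ /cvgrPdist_le PA] eps e0; near=> n.
exists (~` A n); split => //; first exact: measurableC.
rewrite setCK -[leLHS]fineK ?fin_num_measure// lee_fin.
have : `|0 - fine (P (A n))| <= eps by near: n; exact: PA.
by rewrite sub0r normrN; apply: le_trans; exact: ler_norm.
Unshelve. all: by end_near. Qed.

Lemma whp_cvg1 A : (forall n, measurable (A n)) -> P (A n) @[n --> \oo] --> 1%E ->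
  whp A.
Proof.
move=> mA PA; have : whp (fun n => ~` ~` A n).
  apply: whp_cvg0 => [n|]; first exact: measurableC.
  under eq_fun do rewrite probability_setC//.
  rewrite -(@subee _ 1%E)//.
  apply: (@cvgeB _ _ _ _ (fun=> 1%E)) => //.
  exact: cvg_cst.
by move/whpS; apply; apply: nearW => n; rewrite setCK.
Qed.

Lemma cvg0_whp A : (forall n, measurable (A n)) -> whp (fun n => ~` A n) ->
  P (A n) @[n --> \oo] --> 0%E.
Proof.
move=> mA wA; apply/fine_cvgP; split.
  by apply: nearW => n; exact: fin_num_measure.
apply/cvgrPdist_le => eps e0; near=> n; rewrite sub0r normrN.
have [C [mC CA PC]] : exists C : set T,
  [/\ measurable C, C `<=` ~` A n & (P (~` C) <= eps%:E)%E] by near: n; exact: (wA _ e0).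
rewrite ger0_norm ?fine_ge0// -lee_fin fineK ?fin_num_measure//.
apply: le_trans PC; apply: le_measure; rewrite ?inE//; first exact: measurableC.
exact: subsetCr.
Unshelve. all: by end_near. Qed.

End whp.

(** * Elementary inequalities and Taylor remainders *)

Section scalar.
Context {R : realType}.
Implicit Types x y z a q : R.

(** Taylor remainders are cubic for small increments and quadratic for large ones; as [q] lies
    between 2 and 3, the power [q] dominates the cube below 1 and the square above 1. *)
Lemma pow_interp (K q r z : R) : 2 <= q <= 3 -> 0 <= r -> 0 <= K ->
  (r <= 1 -> z <= K * r ^+ 3) -> (1 <= r -> z <= K * r ^+ 2) -> z <= K * r `^ q.
Proof.
move=> /andP[q2 q3] r0 K0 z1 z2; have [r1|/ltW r1] := leP r 1.
  apply: (le_trans (z1 r1)); rewrite ler_wpM2l// -powR_mulrn//.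
  move: r0; rewrite le_eqVlt => /predU1P[<-|r0].
    by rewrite powR0// powR_ge0.
  by apply: ger_powR => //; rewrite r0.
by apply: (le_trans (z2 r1)); rewrite ler_wpM2l// -powR_mulrn//; exact: ler_powR.
Qed.

(** Each trigonometric bound below applies this to a remainder whose derivative was bounded just
    before; every round gains one power, and constants are not optimized. *)
Lemma mvt_center (f df : R -> R) y : (forall x, is_derive x 1 f (df x)) ->
  exists2 c, `|c| <= `|y| & f y - f 0 = df c * y.
Proof.
move=> fdf; have cf a b : {within `[a, b], continuous f}.
  apply: continuous_subspaceT => x; apply/differentiable_continuous.
  by apply/derivable1_diffP; case: (fdf x).
have [y0|y0] := leP 0 y.
  have [c + fE] := MVT_segment y0 (fun x _ => fdf x) (cf _ _).
  rewrite in_itv/= => /andP[c0 cy]; exists c; last by rewrite fE subr0.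
  by rewrite !ger0_norm.
have [c + fE] := MVT_segment (ltW y0) (fun x _ => fdf x) (cf _ _).
rewrite in_itv/= => /andP[yc c0]; exists c; last by rewrite -opprB fE; ring.
by rewrite (ler0_norm c0) (ltr0_norm y0) lerN2.
Qed.

Lemma norm_sin_le y : `|sin y| <= `|y|.
Proof.
have [c _] := @mvt_center sin cos y (@is_derive_sin R); rewrite sin0 subr0 => ->.
by rewrite normrM ler_piMl// cos_max.
Qed.

Lemma cos1_le y : `|cos y - 1| <= `|y| ^+ 2.
Proof.
have [c cy] := @mvt_center cos (fun x => - sin x) y (@is_derive_cos R).
rewrite cos0 => ->; rewrite mulNr normrN normrM expr2 ler_wpM2r//.
exact: le_trans (norm_sin_le c) cy.
Qed.

Lemma sin1_le y : `|sin y - y| <= `|y| ^+ 3.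
Proof.
have D (x : R) : is_derive x 1 (fun x => sin x - x) (cos x - 1) by exact: is_deriveB.
have [c cy] := mvt_center y D.
rewrite sin0 !subr0 => ->; rewrite normrM exprSr ler_wpM2r//.
by apply: le_trans (cos1_le c) _; rewrite ler_pXn2r// nnegrE.
Qed.

Lemma cos2_le y : `|cos y - 1 + y ^+ 2 / 2| <= `|y| ^+ 4.
Proof.
have D (x : R) : is_derive x 1 (fun x => cos x - 1 + x ^+ 2 / 2) (- sin x + x).
  have -> : (fun x : R => cos x - 1 + x ^+ 2 / 2) =
    (@cos R) - cst 1 + (2^-1) \*: (id ^+ 2).
    by apply/funext => z; congr (_ + _); exact: mulrC.
  apply: is_derive_eq.
  by rewrite /GRing.scale/= subr0 mulr1 -mulr_natr; field.
have [c cy] := mvt_center y D.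
rewrite cos0 subrr add0r expr0n/= mul0r subr0 => ->; rewrite normrM exprSr ler_wpM2r//.
rewrite addrC -opprB normrN.
by apply: le_trans (sin1_le c) _; rewrite ler_pXn2r// nnegrE.
Qed.

(** Addition formulas reduce the claim to the remainders of [cos] and [sin] at 0. For large [|y|]
    each is at most [2 * |y| ^+ 2], for small [|y|] at most [|y| ^+ 3], hence the factor 4. *)
Lemma cos_taylor q (t y : R) : 2 <= q <= 3 ->
  `|cos (t + y) - (cos t * (1 - y ^+ 2 / 2) - sin t * y)| <= 4 * `|y| `^ q.
Proof.
move=> q23; have n0 := normr_ge0 y.
have -> : cos (t + y) - (cos t * (1 - y ^+ 2 / 2) - sin t * y) =
  cos t * (cos y - 1 + y ^+ 2 / 2) - sin t * (sin y - y) by rewrite cosD; ring.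
apply: (@le_trans _ _ (`|cos y - 1 + y ^+ 2 / 2| + `|sin y - y|)).
  apply: le_trans (ler_normB _ _) _.
  by rewrite !normrM lerD// ler_piMl// ?cos_max ?sin_max.
have C2 : `|cos y - 1 + y ^+ 2 / 2| <= 2 * `|y| ^+ 2.
  apply: le_trans (ler_normD _ _) _; rewrite normrM normrX.
  rewrite (@ger0_norm _ 2^-1)//.
  by have := cos1_le y; have := sqr_ge0 `|y|; lra.
apply: pow_interp => // y1.
  have h4 : `|y| ^+ 4 <= `|y| ^+ 3 by rewrite exprS ler_piMl// exprn_ge0.
  have := cos2_le y; have := sin1_le y; have : 0 <= `|y| ^+ 3 by rewrite exprn_ge0.
  by lra.
have : `|sin y - y| <= 2 * `|y| ^+ 2.
  apply: le_trans (ler_normB _ _) _.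
  have h2 : `|y| <= `|y| ^+ 2 by rewrite expr2 ler_peMl.
  by have := norm_sin_le y; lra.
by lra.
Qed.

(** Both bounds follow from [1 + u <= expR u], taken at [- y] and, after inversion, at [y]. *)
Lemma expRN_le y : 0 <= y -> 0 <= expR (- y) - 1 + y <= y /\
  expR (- y) - 1 + y <= y ^+ 2.
Proof.
move=> y0; have h1 := expR_ge1Dx (- y).
have y1 : 0 < 1 + y by lra.
have h2 : expR (- y) <= (1 + y)^-1 by rewrite expRN lef_pV2 ?posrE ?expR_gt0// expR_ge1Dx.
have h3 : expR (- y) <= 1 by rewrite expR_le1; lra.
split; first by lra.
have : (1 + y)^-1 <= 1 - y + y ^+ 2.
  rewrite -[leLHS]mul1r ler_pdivrMr//.
  have : 0 <= y ^+ 3 by rewrite exprn_ge0.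
  by rewrite (_ : (1 - y + y ^+ 2) * (1 + y) = 1 + y ^+ 3); [lra|ring].
by lra.
Qed.

(** With [u = a * y ^+ 2] the remainder is at most [u] and at most [u ^+ 2]; the first serves for
    [|y| >= 1], the second for [|y| <= 1], whence the two summands of the constant. *)
Lemma expRN_taylor q (a y : R) : 2 <= q <= 3 -> 0 <= a ->
  `|expR (- (a * y ^+ 2)) - (1 - a * y ^+ 2)| <= (a + a ^+ 2) * `|y| `^ q.
Proof.
move=> q23 a0; rewrite -(real_normK (num_real y)); set r := `|y|.
have r0 : 0 <= r by exact: normr_ge0.
have ar : 0 <= a * r ^+ 2 by rewrite mulr_ge0// sqr_ge0.
have [/andP[h1 h2] h3] := expRN_le ar.
rewrite (_ : _ - _ = expR (- (a * r ^+ 2)) - 1 + a * r ^+ 2); last by ring.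
rewrite ger0_norm//.
apply: pow_interp => //; first by rewrite addr_ge0// sqr_ge0.
  move=> r1; apply: (le_trans h3); rewrite exprMn mulrDl -exprM.
  have : r ^+ 4 <= r ^+ 3 by rewrite exprS ler_piMl// exprn_ge0.
  have : 0 <= r ^+ 3 by rewrite exprn_ge0.
  move=> p1 p2; have := mulr_ge0 a0 p1.
  by have := ler_wpM2l (sqr_ge0 a) p2; rewrite /=; lra.
move=> r1; apply: (le_trans h2).
rewrite mulrDl lerDl mulr_ge0// ?sqr_ge0//.
Qed.

(** Second-order error of undoing a factor [1 - y] by [expR y]; with [y = c * v k] it is charged to
    the square of the conditional variance. *)
Lemma expR_compensate y : 0 <= y -> `|expR y * (1 - y) - 1| <= y ^+ 2 * expR y.
Proof.
move=> y0; have [/andP[h1 h2] h3] := expRN_le y0.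
have e0 := expR_gt0 y.
have eN : expR y * expR (- y) = 1 by rewrite -expRD subrr expR0.
have := ler_wpM2l (ltW e0) h3; have := ler_wpM2l (ltW e0) h1.
rewrite mulr0 !mulrDr eN => p1 p2.
rewrite ler0_norm; lra.
Qed.

(** The second derivative of [1 / (1 + u ^ 2)] is at least -2, which explains the coefficient of
    [y ^+ 2]; the proof is direct algebra. *)
Lemma invr1Dsq_taylor (s y : R) :
  (1 + (s + y) ^+ 2)^-1 >= (1 + s ^+ 2)^-1 - 2 * s / (1 + s ^+ 2) ^+ 2 * y - y ^+ 2.
Proof.
have s1 : 1 <= 1 + s ^+ 2 by rewrite lerDl sqr_ge0.
have sy1 : 1 <= 1 + (s + y) ^+ 2 by rewrite lerDl sqr_ge0.
have s0 : 0 < 1 + s ^+ 2 by exact: lt_le_trans s1.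
have sy0 : 0 < 1 + (s + y) ^+ 2 by exact: lt_le_trans sy1.
rewrite -subr_ge0.
have -> : (1 + (s + y) ^+ 2)^-1 - ((1 + s ^+ 2)^-1 - 2 * s / (1 + s ^+ 2) ^+ 2 * y - y ^+ 2)
  = y ^+ 2 * ((1 + s ^+ 2) ^+ 2 * (1 + (s + y) ^+ 2) + 3 * s ^+ 2 - 1 + 2 * s * y)
    / ((1 + s ^+ 2) ^+ 2 * (1 + (s + y) ^+ 2)).
  by field; rewrite !gt_eqF.
apply: divr_ge0; last by rewrite mulr_ge0// ?sqr_ge0// ltW.
apply: mulr_ge0; first exact: sqr_ge0.
(* Replacing the factor [(1 + s ^+ 2) ^+ 2] by 1 leaves exactly the square [(2 * s + y) ^+ 2]. *)
have h : 1 <= (1 + s ^+ 2) ^+ 2 by rewrite expr_ge1// ltW.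
have h2 : (1 + (s + y) ^+ 2) <= (1 + s ^+ 2) ^+ 2 * (1 + (s + y) ^+ 2).
  by rewrite ler_peMl// ltW.
have := sqr_ge0 (s + (s + y)); have := sqr_ge0 s.
by rewrite !sqrrD !expr2; rewrite !sqrrD !expr2 in h2; nra.
Qed.

End scalar.

(** * Martingale arrays with bounded conditional variance *)

Section adapted.
Context {d : measure_display} {T : measurableType d} {R : realType}.
Implicit Types (G : set_system T) (f g : T -> R).

(** The generated sigma-algebra is viewed as a measurable type, so that closure under sums, products
    and composition is inherited; [adp_wrt] is the bridge to [meas_wrt]. *)
Definition adp G f := measurable_fun setT (f : g_sigma_algebraType G -> R).

Lemma adp_wrt G f : adp G f <-> meas_wrt <<s G>> f.
Proof.
split=> [mf B mB|mf _ B mB]; last by rewrite setTI; exact: (mf _ mB).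
by rewrite -[X in <<s G>> X]setTI; exact: (mf measurableT).
Qed.

Lemma adp_sub G G' f : <<s G>> `<=` <<s G'>> -> adp G f -> adp G' f.
Proof. by move=> GG' /adp_wrt mf; apply/adp_wrt => B mB; exact: GG' (mf _ mB). Qed.

Lemma adp_mfun G f : G `<=` d.-measurable -> adp G f -> measurable_fun setT f.
Proof.
move=> Gm /adp_wrt mf _ B mB; rewrite setTI.
have : <<s G>> `<=` d.-measurable.
  by apply: smallest_sub => //; exact: sigma_algebra_measurable.
by move/(_ _ (mf _ mB)).
Qed.

Lemma adp_cst G (c : R) : adp G (fun=> c).
Proof. exact: measurable_cst. Qed.

Lemma adpD G f g : adp G f -> adp G g -> adp G (fun x => f x + g x).
Proof. exact: measurable_funD. Qed.

Lemma adpB G f g : adp G f -> adp G g -> adp G (fun x => f x - g x).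
Proof. exact: measurable_funB. Qed.

Lemma adpM G f g : adp G f -> adp G g -> adp G (fun x => f x * g x).
Proof. exact: measurable_funM. Qed.

Lemma adpX G f n : adp G f -> adp G (fun x => f x ^+ n).
Proof. exact: measurable_funX. Qed.

Lemma adp_comp G f (phi : R -> R) : measurable_fun setT phi -> adp G f ->
  adp G (fun x => phi (f x)).
Proof. by move=> mphi mf; exact: measurableT_comp. Qed.

Lemma adp_sum G n (F : nat -> T -> R) : (forall k, (k < n)%N -> adp G (F k)) ->
  adp G (fun x => \sum_(k < n) F k x).
Proof.
elim: n => [_|n IH FG].
  by under eq_fun do rewrite big_ord0; exact: adp_cst.
under eq_fun do rewrite big_ord_recr /=.
by apply: adpD; [apply: IH => k kn; apply: FG; exact: ltnW|exact: FG].
Qed.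

Lemma adp_powR G f q : adp G f -> adp G (fun x => f x `^ q).
Proof. by apply: adp_comp (@measurable_powR R q). Qed.

Lemma mfun_inv : measurable_fun setT (@GRing.inv R).
Proof.
(* Inversion is discontinuous at 0, so it is glued from the power -1 on the two half-lines; at 0
   both conventions give 0. *)
have : measurable_fun setT (fun x : R => x `^ (-1) * (\1_`[0, +oo[ x) - (- x) `^ (-1) * (\1_`]-oo, 0[ x)).
  apply: measurable_funB; apply: measurable_funM.
  - exact: (@measurable_powR R (-1)).
  - exact: measurable_indic.
  - by apply: (measurableT_comp (@measurable_powR R (-1))); exact: measurable_funN.
  - exact: measurable_indic.
apply: eq_measurable_fun => x _; rewrite !indicE !mem_setE !in_itv/= !andbT.
have [x0|x0] := leP 0 x.
  by rewrite powR_inv1//= mulr1 mulr0 subr0.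
by rewrite /= mulr1 mulr0 sub0r powR_inv1 ?oppr_ge0 ?(ltW x0)// invrN opprK.
Qed.

Lemma adpV G f : adp G f -> adp G (fun x => (f x)^-1).
Proof. exact: adp_comp mfun_inv. Qed.

End adapted.

(** * Telescoping along a martingale array *)

Section martingale_array.
Context {d : measure_display} {T : measurableType d} {R : realType}.
Variable P : probability T R.
Variables (n : nat) (G : nat -> set_system T) (x v l : nat -> T -> R).
Variables (q C K Kv : R).
Hypothesis Gm : forall k, G k `<=` d.-measurable.
Hypothesis Gmono : forall k, <<s G k>> `<=` <<s G k.+1>>.
Hypothesis adx : forall k, adp (G k.+1) (x k).
Hypothesis adv : forall k, adp (G k) (v k).
Hypothesis v0 : forall k t, 0 <= v k t.
Hypothesis vC : forall t, \sum_(k < n) v k t <= C.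
Hypothesis q23 : 2 <= q <= 3.
Hypothesis Ix2 : forall k, intg P (fun t => x k t ^+ 2).
Hypothesis Ixq : forall k, intg P (fun t => `|x k t| `^ q).
Hypothesis Il : forall k, intg P (l k).
Hypothesis Ex1 : forall k (g : T -> R) (M : R), adp (G k) g -> (forall t, `|g t| <= M) ->
  \int[P]_t (g t * x k t) = 0.
Hypothesis Ex2 : forall k (g : T -> R) (M : R), adp (G k) g -> (forall t, `|g t| <= M) ->
  \int[P]_t (g t * x k t ^+ 2) = \int[P]_t (g t * v k t).
Hypothesis Exq : forall k, \int[P]_t (`|x k t| `^ q) <= K * \int[P]_t l k t.
Hypothesis vl : forall k t, v k t ^+ 2 <= Kv * l k t.

Lemma Gmono_le i j : (i <= j)%N -> <<s G i>> `<=` <<s G j>>.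
Proof.
elim: j => [|j IH]; first by rewrite leqn0 => /eqP ->.
rewrite leq_eqVlt => /predU1P[->//|ij]; exact: subset_trans (IH ij) (@Gmono j).
Qed.

Let adm k (f : T -> R) : adp (G k) f -> measurable_fun setT f.
Proof. exact: adp_mfun (@Gm k). Qed.

Lemma mx k : measurable_fun setT (x k).
Proof. exact: adm (@adx k). Qed.

Lemma Ix k : intg P (x k).
Proof.
apply: (@intg_le _ _ _ _ _ (fun t => 1 + x k t ^+ 2)); first exact: mx.
  by apply: intgD => //; exact: intg_cst.
move=> t; rewrite [leRHS]ger0_norm ?addr_ge0 ?sqr_ge0//.
rewrite -(real_normK (num_real (x k t))).
by have := sqr_ge0 (`|x k t| - 1); rewrite sqrrB; have := normr_ge0 (x k t); lra.
Qed.

Lemma ad_psum k (phi : R -> R) : measurable_fun setT phi ->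
  adp (G k) (fun t => \sum_(j < k) phi (x j t)).
Proof.
move=> mphi; apply: (adp_sum (F := fun j t => phi (x j t))) => j jk.
apply: adp_comp => //; exact: adp_sub (Gmono_le jk) (@adx j).
Qed.

Section telescope.
Variables (c b Kr : R) (X B : nat -> T -> R).
Hypothesis c0 : 0 <= c.
Hypothesis Kr0 : 0 <= Kr.
Hypothesis adX : forall k, adp (G k) (X k).
Hypothesis adB : forall k, adp (G k) (B k).
Hypothesis X1 : forall k t, `|X k t| <= 1.
Hypothesis Bb : forall k t, `|B k t| <= b.
Hypothesis XS : forall k t,
  `|X k.+1 t - (X k t * (1 - c * x k t ^+ 2) + B k t * x k t)| <= Kr * `|x k t| `^ q.

(* The weight [W] compensates the factor [1 - c v_k] by which a step multiplies the
   conditional mean of [X k], so only Lyapunov errors accumulate. *)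
Let W k t := expR (c * \sum_(j < k) v j t).

Let W0 k t : 0 <= W k t. Proof. exact: expR_ge0. Qed.

Let vk_C k t : (k <= n)%N -> \sum_(j < k) v j t <= C.
Proof.
move=> kn; apply: le_trans (vC t).
rewrite -!(big_mkord xpredT (fun j => v j t)) (big_cat_nat _ kn)//=.
by rewrite lerDl sumr_ge0.
Qed.

Let W_le k t : (k <= n)%N -> `|W k t| <= expR (c * C).
Proof.
by move=> kn; rewrite ger0_norm// ler_expR ler_wpM2l// vk_C.
Qed.

(** Predictability is the point: [W k.+1] uses conditional variances up to index [k] only, so it is
    an admissible multiplier for the increment [x k]. *)
Let adW k : adp (G k) (W k.+1).
Proof.
apply: (adp_comp (phi := expR)); first exact: measurable_expR.
apply: adpM; first exact: adp_cst.
apply: (adp_sum (F := v)) => j jk; exact: adp_sub (Gmono_le _) (@adv j).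
Qed.

Let mW k : measurable_fun setT (W k).
Proof.
case: k => [|k]; last exact: adm (@adW k).
rewrite (_ : W 0 = fun=> 1)//.
by apply/funext => t; rewrite /W big_ord0 mulr0 expR0.
Qed.

Let mX k : measurable_fun setT (X k).
Proof. exact: adm (@adX k). Qed.

Let IWX i k : (i <= n)%N -> intg P (fun t => W i t * X k t).
Proof.
move=> ki; apply: (intg_bnd (M := expR (c * C) * 1)).
  exact: measurable_funM.
by move=> t; rewrite normrM ler_pM// W_le.
Qed.

Let IWf i f : (i <= n)%N -> intg P f -> intg P (fun t => W i t * f t).
Proof. by move=> ki If; apply: intgM_bnd If; [exact: mW|move=> t; exact: W_le]. Qed.

Let Iv k : (k < n)%N -> intg P (v k).
Proof.
move=> kn; apply: (intg_bnd (M := C)); first exact: adm (@adv k).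
move=> t; rewrite ger0_norm//.
by apply: le_trans (vk_C t kn); rewrite big_ord_recr/= lerDr sumr_ge0.
Qed.

Let E1 := expR (c * C).

(** Two errors per step: replacing [X k.+1] by its second-order expansion [Z] costs a [q]-th moment,
    and cancelling [1 - c * v k] against the growth of [W] costs the square of [v k]. Both are
    charged to [l k]. *)
Let step k : (k < n)%N ->
  `|\int[P]_t (W k.+1 t * X k.+1 t) - \int[P]_t (W k t * X k t)| <=
  (E1 * Kr * K + E1 * (c ^+ 2 * Kv * E1)) * \int[P]_t l k t.
Proof.
move=> kn; have E10 : 0 <= E1 by exact: expR_ge0.
have kn' := ltnW kn.
have IX (f : T -> R) : intg P f -> intg P (fun t => X k t * f t).
  by move=> If; apply: intgM_bnd If; [exact: mX|exact: X1].
pose Z t := X k t * (1 - c * x k t ^+ 2) + B k t * x k t.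
have I1x : intg P (fun t => 1 - c * x k t ^+ 2).
  by apply: intgB; [exact: intg_cst|exact: intgZ].
have I1v : intg P (fun t => 1 - c * v k t).
  by apply: intgB; [exact: intg_cst|exact/intgZ/Iv].
have IBx : intg P (fun t => B k t * x k t).
  by apply: intgM_bnd (Ix k); [exact: adm (@adB k)|exact: Bb].
have IZ : intg P Z by apply: intgD => //; exact: IX.
have IWXk := IWX k kn; have IWXk' := IWX k kn'.
have IWXx : intg P (fun t => W k.+1 t * X k t * x k t ^+ 2).
  under eq_fun do rewrite -mulrA.
  by apply: IWf => //; exact: IX.
have IWXv : intg P (fun t => W k.+1 t * X k t * v k t).
  under eq_fun do rewrite -mulrA.
  by apply: IWf => //; apply: IX; exact: Iv.
have WXM t : `|W k.+1 t * X k t| <= E1 * 1 by rewrite normrM ler_pM// W_le.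
have WBM t : `|W k.+1 t * B k t| <= E1 * b by rewrite normrM ler_pM// W_le.
(* [Ex1] removes the linear term and [Ex2] turns [x k ^+ 2] into [v k]; the multipliers, [W k.+1]
   times [B k] or [X k], are bounded and known at time [k]. *)
have EZ1 : \int[P]_t (W k.+1 t * Z t) = \int[P]_t (W k.+1 t * X k t * (1 - c * v k t)).
  transitivity (\int[P]_t (W k.+1 t * X k t - c * (W k.+1 t * X k t * x k t ^+ 2)
      + W k.+1 t * B k t * x k t)).
    by apply: eq_Rintegral => t _; rewrite /Z; ring.
  rewrite ED; first last.
  - under eq_fun do rewrite -mulrA.
    exact: IWf.
  - by apply: intgB => //; exact: intgZ.
  rewrite (Ex1 (M := E1 * b))//; last by apply: adpM.
  rewrite addr0 EB//; last exact: intgZ.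
  rewrite EZ// (Ex2 (M := E1 * 1))//; last by apply: adpM.
  rewrite -EZ// -EB//; last exact: intgZ.
  by apply: eq_Rintegral => t _; ring.
have A1 : `|\int[P]_t (W k.+1 t * X k.+1 t) - \int[P]_t (W k.+1 t * Z t)| <=
    E1 * Kr * K * \int[P]_t l k t.
  apply: (@le_trans _ _ (\int[P]_t (E1 * Kr * `|x k t| `^ q))).
    apply: Edist; [exact: IWX|exact: IWf|exact: intgZ|].
    move=> t; rewrite -mulrBr normrM -mulrA ler_pM//; exact: W_le.
  by rewrite EZ// -[in leRHS]mulrA ler_wpM2l// mulr_ge0.
have A2 : `|\int[P]_t (W k.+1 t * Z t) - \int[P]_t (W k t * X k t)| <=
    E1 * (c ^+ 2 * Kv * E1) * \int[P]_t l k t.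
  rewrite EZ1 -EZ//; apply: Edist => //.
  - under eq_fun do rewrite -mulrA.
    by apply: IWf => //; exact: IX.
  - exact: intgZ.
  move=> t; have cv0 : 0 <= c * v k t by rewrite mulr_ge0.
  rewrite (_ : _ - _ = W k t * (X k t * (expR (c * v k t) * (1 - c * v k t) - 1))); last first.
    have -> : W k.+1 t = W k t * expR (c * v k t).
      by rewrite /W big_ord_recr/= mulrDr expRD.
    by ring.
  rewrite normrM -mulrA ler_pM//; first exact: W_le.
  rewrite normrM -[leRHS]mul1r ler_pM//.
  apply: le_trans (expR_compensate cv0) _.
  have ve : expR (c * v k t) <= E1.
    rewrite ler_expR ler_wpM2l//; apply: le_trans (vk_C t kn).
    by rewrite big_ord_recr/= lerDr sumr_ge0.
  rewrite (_ : _ * E1 * l k t = c ^+ 2 * (Kv * l k t) * E1); last by ring.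
  by apply: ler_pM => //; rewrite ?sqr_ge0 ?expR_ge0// exprMn ler_wpM2l ?sqr_ge0.
rewrite mulrDl; apply: le_trans (lerD A1 A2).
exact: ler_distD.
Qed.

Lemma telescope : `|\int[P]_t (expR (c * \sum_(j < n) v j t) * X n t) - \int[P]_t X 0%N t| <=
  (E1 * Kr * K + E1 * (c ^+ 2 * Kv * E1)) * \sum_(k < n) \int[P]_t l k t.
Proof.
suff H m : (m <= n)%N -> `|\int[P]_t (W m t * X m t) - \int[P]_t X 0%N t| <=
  (E1 * Kr * K + E1 * (c ^+ 2 * Kv * E1)) * \sum_(k < m) \int[P]_t l k t by exact: H.
elim: m => [_|m IH mn].
  rewrite big_ord0 mulr0 (_ : \int[P]_t (W 0 t * X 0 t) = \int[P]_t X 0 t) ?subrr ?normr0//.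
  by apply: eq_Rintegral => t _; rewrite /W big_ord0 mulr0 expR0 mul1r.
rewrite big_ord_recr/= mulrDr [leRHS]addrC.
apply: le_trans (lerD (step mn) (IH (ltnW mn))).
exact: ler_distD.
Qed.

End telescope.

(** Telescoping with [X k = cos (a S_k + b)]: [c = a ^+ 2 / 2] is the quadratic Taylor coefficient
    and [B k = - a sin (a S_k + b)] the linear one. *)
Lemma charf_bound (a b : R) :
  `|\int[P]_t (expR (a ^+ 2 / 2 * \sum_(j < n) v j t) * cos (a * (\sum_(j < n) x j t) + b)) - cos b| <=
  (expR (a ^+ 2 / 2 * C) * (4 * `|a| `^ q) * K + expR (a ^+ 2 / 2 * C) *
    ((a ^+ 2 / 2) ^+ 2 * Kv * expR (a ^+ 2 / 2 * C))) * \sum_(k < n) \int[P]_t l k t.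
Proof.
pose S k t := a * (\sum_(j < k) x j t) + b.
have mS k : adp (G k) (S k).
  apply: adpD; last exact: adp_cst.
  apply: adpM; first exact: adp_cst.
  by apply: (@ad_psum _ id).
have mcos : measurable_fun setT (@cos R).
  by apply: continuous_measurable_fun; exact: continuous_cos.
have msin : measurable_fun setT (@sin R).
  by apply: continuous_measurable_fun; exact: continuous_sin.
have := @telescope (a ^+ 2 / 2) `|a| (4 * `|a| `^ q) (fun k t => cos (S k t))
  (fun k t => - (a * sin (S k t))).
rewrite /S (_ : \int[P]_t cos (a * (\sum_(j < 0) x j t) + b) = cos b); last first.
  by under eq_Rintegral do rewrite big_ord0 mulr0 add0r; rewrite Ecst.
apply.
- by rewrite divr_ge0// sqr_ge0.
- by rewrite mulr_ge0// powR_ge0.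
- by move=> k; apply: adp_comp.
- move=> k; have -> : (fun t => - (a * sin (S k t))) = (fun t => (- a) * sin (S k t)).
    by apply/funext => t; rewrite mulNr.
  by apply: adpM; [exact: adp_cst|exact: adp_comp].
- by move=> k t; exact: cos_max.
- by move=> k t; rewrite normrN normrM ler_piMr// sin_max.
move=> k t; rewrite big_ord_recr/= mulrDr.
rewrite (_ : _ + b = a * (\sum_(j < k) x j t) + b + a * x k t); last by ring.
have := @cos_taylor R q (a * (\sum_(j < k) x j t) + b) (a * x k t) q23.
rewrite normrM powRM// mulrA; congr (`|_ - _| <= _); by field.
Qed.

(** Telescoping with [B k = 0]: the expansion of [expR (- (a * x k ^+ 2))] has no linear term. *)
Lemma laplace_bound (a : R) : 0 <= a ->
  `|\int[P]_t (expR (a * \sum_(j < n) v j t) * expR (- (a * (\sum_(j < n) x j t ^+ 2)))) - 1| <=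
  (expR (a * C) * (a + a ^+ 2) * K + expR (a * C) *
    (a ^+ 2 * Kv * expR (a * C))) * \sum_(k < n) \int[P]_t l k t.
Proof.
move=> a0; pose S k t := - (a * \sum_(j < k) x j t ^+ 2).
have mS k : adp (G k) (S k).
  rewrite /S; have -> : (fun t => - (a * \sum_(j < k) x j t ^+ 2)) =
    (fun t => (- a) * \sum_(j < k) x j t ^+ 2) by apply/funext => t; rewrite mulNr.
  apply: adpM; first exact: adp_cst.
  by apply: (@ad_psum _ (fun y => y ^+ 2)); exact: measurable_funX.
have := @telescope a 0 (a + a ^+ 2) (fun k t => expR (S k t)) (fun k t => 0).
rewrite /S (_ : \int[P]_t expR (- (a * \sum_(j < 0) x j t ^+ 2)) = 1); last first.
  by under eq_Rintegral do rewrite big_ord0 mulr0 oppr0 expR0; rewrite Ecst.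
apply => //.
- by rewrite addr_ge0// sqr_ge0.
- by move=> k; apply: adp_comp => //; exact: measurable_expR.
- by move=> k; exact: adp_cst.
- move=> k t; rewrite ger0_norm ?expR_ge0// expR_le1 oppr_le0 mulr_ge0//.
  by rewrite sumr_ge0// => i _; exact: sqr_ge0.
- by move=> k t; rewrite normr0.
move=> k t; rewrite big_ord_recr/= mulrDr opprD expRD mul0r addr0 -mulrBr normrM.
rewrite -[leRHS]mul1r ler_pM//; last exact: expRN_taylor.
rewrite ger0_norm ?expR_ge0// expR_le1 oppr_le0 mulr_ge0//.
by rewrite sumr_ge0// => i _; exact: sqr_ge0.
Qed.

(* Chebyshev with the bounded function [1 / (1 + u ^ 2)] in place of [u ^ 2], because
   [Ex1] and [Ex2] only allow bounded multipliers. *)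
Lemma partial_sum_tail (L : R) : 0 < L ->
  (P [set t | (L <= `|\sum_(j < n) x j t|)%R] <= (2 * C / L ^+ 2)%:E)%E.
Proof.
move=> L0; pose S k t := \sum_(j < k) x j t.
pose X k t := (1 + (L^-1 * S k t) ^+ 2)^-1.
have mS k : adp (G k) (S k) by exact: (@ad_psum _ id).
have D1 y : 1 <= 1 + y ^+ 2 :> R by rewrite lerDl sqr_ge0.
have D0 y : 0 < 1 + y ^+ 2 :> R by exact: lt_le_trans (D1 y).
have adLS k : adp (G k) (fun t => L^-1 * S k t).
  by apply: adpM => //; exact: adp_cst.
have adD k : adp (G k) (fun t => 1 + (L^-1 * S k t) ^+ 2).
  by apply: adpD; [exact: adp_cst|exact: adpX].
have adX k : adp (G k) (X k) by exact: adpV.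
have X01 k t : 0 <= X k t <= 1.
  by rewrite /X invr_ge0 (ltW (D0 _))/= invf_le1.
have IX k : intg P (X k).
  apply: (intg_bnd (M := 1)); first exact: adm (@adX k).
  by move=> t; rewrite ger0_norm; case/andP: (X01 k t).
pose B k t := 2 * (L^-1 * S k t) / (1 + (L^-1 * S k t) ^+ 2) ^+ 2 * L^-1.
have adB k : adp (G k) (B k).
  apply: adpM; last exact: adp_cst.
  apply: adpM; last by apply: adpV; exact: adpX.
  by apply: adpM => //; exact: adp_cst.
have Bb k t : `|B k t| <= L^-1.
  rewrite /B normrM [X in _ * X]ger0_norm ?invr_ge0 ?(ltW L0)//.
  rewrite ler_piMl ?invr_ge0 ?(ltW L0)//.
  set y := L^-1 * S k t.
  rewrite normrM [X in _ * X]ger0_norm ?invr_ge0 ?sqr_ge0//.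
  rewrite ler_pdivrMr ?exprn_gt0// mul1r.
  apply: (@le_trans _ _ (1 + y ^+ 2)); last by rewrite [leRHS]expr2 ler_peMr// ltW.
  rewrite normrM ger0_norm// -(real_normK (num_real y)).
  by have := sqr_ge0 (1 - `|y|); rewrite sqrrB; lra.
have stepX k t : X k t - B k t * x k t - L^-1 ^+ 2 * x k t ^+ 2 <= X k.+1 t.
  rewrite /X /S big_ord_recr/= mulrDr.
  have := invr1Dsq_taylor (L^-1 * S k t) (L^-1 * x k t).
  apply: le_trans; rewrite /B /S le_eqVlt; apply/orP; left; apply/eqP.
  by ring.
have Iv k : (k < n)%N -> intg P (v k).
  move=> kn; apply: (intg_bnd (M := C)); first exact: adm (@adv k).
  move=> t; rewrite ger0_norm//; apply: le_trans (vC t).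
  by rewrite (bigD1 (Ordinal kn))//= lerDl sumr_ge0.
have Ev : \sum_(k < n) \int[P]_t v k t <= C.
  rewrite -Esum// -[leRHS](Ecst P); apply: Ele => //; first exact: intg_sum.
  exact: intg_cst.
(* Each step lowers the mean of [X] by at most [L^-1 ^+ 2] times the mean of [v]; the linear term
   integrates to 0 because [B k] is bounded. *)
have EX k : (k <= n)%N ->
    1 - L^-1 ^+ 2 * \sum_(j < k) \int[P]_t v j t <= \int[P]_t X k t.
  elim: k => [_|k IH kn].
    rewrite big_ord0 mulr0 subr0 -[leLHS](Ecst P) /X /S.
    apply: Ele; [exact: intg_cst|exact: IX|].
    by move=> t; rewrite big_ord0 mulr0 expr0n/= addr0 invr1.
  rewrite big_ord_recr/= mulrDr opprD addrA.
  have <- : \int[P]_t (1 * x k t ^+ 2) = \int[P]_t v k t.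
    rewrite (Ex2 (M := 1))//; last 2 first.
    - exact: adp_cst.
    - by rewrite normr1.
    by apply: eq_Rintegral => t _; rewrite mul1r.
  under eq_Rintegral do rewrite mul1r.
  have IBx : intg P (fun t => B k t * x k t).
    by apply: intgM_bnd (Ix k) => //; exact: adm (@adB k).
  apply: (@le_trans _ _ (\int[P]_t (X k t - B k t * x k t - L^-1 ^+ 2 * x k t ^+ 2))).
    rewrite EB; [|exact: intgB|exact: intgZ].
    by rewrite EB// EZ// (Ex1 (g := B k) (M := L^-1))// subr0 lerD2r IH// ltnW.
  apply: Ele => //; apply: intgB; [exact: intgB|exact: intgZ].
have L2 : 0 < L ^+ 2 by rewrite exprn_gt0.
have XC : 1 - C / L ^+ 2 <= \int[P]_t X n t.
  apply: le_trans (EX n (leqnn n)); rewrite lerD2l lerN2 [leRHS]mulrC.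
  by rewrite exprVn ler_wpM2l// invr_ge0 ltW.
have I1X : intg P (fun t => 1 - X n t) by apply: intgB => //; exact: intg_cst.
(* [L <= |S n|] means [1 + (S n / L) ^+ 2 >= 2], that is [X n <= 1 / 2]; this threshold gives the
   factor 2 in Markov's inequality. *)
have -> : [set t | L <= `|\sum_(j < n) x j t| ] = [set t | 2^-1 <= 1 - X n t].
  apply/seteqP; split => t /=.
    move=> LS; rewrite lerBrDl -lerBrDr (_ : 1 - 2^-1 = 2^-1); last by field.
    rewrite lef_pV2 ?posrE// exprMn exprVn -/(S n t) [X in _ + X]mulrC.
    have : 1 <= S n t ^+ 2 / L ^+ 2; last by lra.
    rewrite ler_pdivlMr// mul1r -[leRHS](real_normK (num_real _)).
    by rewrite ler_pXn2r// nnegrE ltW.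
  rewrite lerBrDl -lerBrDr (_ : 1 - 2^-1 = 2^-1); last by field.
  rewrite lef_pV2 ?posrE// exprMn exprVn [X in _ + X]mulrC => h.
  have : 1 <= S n t ^+ 2 / L ^+ 2 by lra.
  rewrite ler_pdivlMr// mul1r -[leRHS](real_normK (num_real _)).
  by rewrite ler_pXn2r// nnegrE ltW.
apply: le_trans (markov_ge0 _ _ _) _ => //.
- by move=> t; rewrite subr_ge0; case/andP: (X01 n t).
- by rewrite lee_fin invrK EB ?Ecst//; [lra|exact: intg_cst].
Qed.

End martingale_array.

(** * Transfer of integrals between weighted measures *)

Section weighted_pushforward.
Local Open Scope ereal_scope.
Context d1 d2 (X : measurableType d1) (Y : measurableType d2) (R : realType).
Variables (mu : {measure set X -> \bar R}) (phi : X -> Y) (K : X -> R).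
Hypotheses (mphi : measurable_fun setT phi) (mK : measurable_fun setT K).
Hypothesis K0 : forall x, (0 <= K x)%R.

Import HBNNSimple.

(** The simple approximations are taken on the target space, so the right-hand side sees [mu], [phi]
    and [K] only through weighted measures of preimages. *)
Lemma weighted_integral_lim (g : Y -> R) (mg : measurable_fun setT (EFin \o g)) :
  (forall y, (0 <= g y)%R) ->
  \int[mu]_x (g (phi x) * K x)%:E =
  limn (fun n => \sum_(k \in range (nnsfun_approx measurableT mg n))
    k%:E * \int[mu]_(x in phi @^-1` (nnsfun_approx measurableT mg n @^-1` [set k])) (K x)%:E).
Proof.
move=> g0; pose h := nnsfun_approx measurableT mg; rewrite -/h.
have mhphi n : measurable_fun setT (h n \o phi) by exact: measurableT_comp.
have -> : \int[mu]_x (g (phi x) * K x)%:E =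
    limn (fun n => \int[mu]_x (h n (phi x) * K x)%:E).
  rewrite -monotone_convergence//; last 3 first.
  - by move=> n; apply/measurable_EFinP; apply: measurable_funM => //; exact: mhphi.
  - by move=> n x _; rewrite lee_fin mulr_ge0.
  - move=> x _ m n mn; rewrite lee_fin ler_wpM2r//.
    exact/lefP/nd_nnsfun_approx.
  apply: eq_integral => x _; apply/esym/cvg_lim => //.
  under eq_fun do rewrite EFinM.
  rewrite EFinM; apply: cvgeZr => //.
  by apply: cvg_nnsfun_approx => // y _; rewrite lee_fin.
congr (limn _); apply/funext => n.
have mA k : measurable (phi @^-1` (h n @^-1` [set k])).
  by rewrite -[X in measurable X]setTI; exact: mphi.
transitivity (\int[mu]_x (\sum_(k \in range (h n))
    (k * \1_(h n @^-1` [set k]) (phi x))%:E * (K x)%:E)).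
  apply: eq_integral => x _.
  rewrite -ge0_mule_fsuml => [|y]; last exact: nnfun_muleindic_ge0.
  by rewrite fsumEFin // -(fimfunE _ (phi x)) EFinM.
rewrite ge0_integral_fsum//; last 2 first.
- move=> k; apply: emeasurable_funM; last exact/measurable_EFinP.
  apply/measurable_EFinP/measurable_funM => //.
  exact: (measurable_indic (mA k)).
- move=> k x _; apply: mule_ge0; last by rewrite lee_fin.
  exact: nnfun_muleindic_ge0.
apply: eq_fsbigr => r rhn.
have r0 : (0 <= r)%R by move: rhn; rewrite inE => -[t _ <-].
rewrite [in RHS]integral_mkcond/= -ge0_integralZl//.
- apply: eq_integral => x _; rewrite patchE indicE.
  rewrite -[RHS]/(r%:E * (if x \in phi @^-1` (h n @^-1` [set r]) then (K x)%:E else 0)).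
  rewrite (_ : (phi x \in _) = (x \in phi @^-1` (h n @^-1` [set r])))//.
  by case: ifP => _; rewrite ?mulr1 ?mulr0 ?mule0 ?mul0e.
- by apply/(measurable_restrictT _ (mA r)); apply/measurable_funTS/measurable_EFinP.
- by move=> x _; rewrite patchE; case: ifP => // _; rewrite lee_fin.
Qed.

End weighted_pushforward.

Section weighted_transfer.
Import HBNNSimple.

(** Reduces equality of integrals to equality on sets. It serves for the normal density, for
    identically distributed outcomes, for independence and for the product formula. *)
Lemma weighted_transfer d1 d2 d3 (X1 : measurableType d1) (X2 : measurableType d2)
    (Y : measurableType d3) (R : realType)
    (mu1 : {measure set X1 -> \bar R}) (mu2 : {measure set X2 -> \bar R})
    (f1 : X1 -> Y) (f2 : X2 -> Y) (K1 : X1 -> R) (K2 : X2 -> R) (g : Y -> R) :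
  measurable_fun setT f1 -> measurable_fun setT f2 ->
  measurable_fun setT K1 -> measurable_fun setT K2 ->
  (forall x, 0 <= K1 x) -> (forall x, 0 <= K2 x) ->
  (forall A, measurable A ->
    (\int[mu1]_(x in f1 @^-1` A) (K1 x)%:E = \int[mu2]_(x in f2 @^-1` A) (K2 x)%:E)%E) ->
  measurable_fun setT g -> (forall y, 0 <= g y) ->
  (\int[mu1]_x (g (f1 x) * K1 x)%:E = \int[mu2]_x (g (f2 x) * K2 x)%:E)%E.
Proof.
move=> mf1 mf2 mK1 mK2 K10 K20 H mg g0.
have mg' : measurable_fun setT (EFin \o g) by exact/measurable_EFinP.
rewrite (weighted_integral_lim mu1 mf1 mK1 K10 mg' g0).
rewrite (weighted_integral_lim mu2 mf2 mK2 K20 mg' g0).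
congr (limn _); apply/funext => n; apply: eq_fsbigr => k _; congr (_ * _)%E.
exact: H.
Qed.

End weighted_transfer.

(** * The characteristic function of the normal law *)

Definition std_normal (R : realType) : probability (measurableTypeR R) R :=
  normal_prob 0 1.

Section gaussian.
Context {R : realType}.
Local Notation N := (std_normal R).
Local Notation mu := (@lebesgue_measure R).
Local Notation phi := (@normal_pdf R 0 1).
Implicit Types f : R -> R.

Lemma std_pdfE z : phi z = normal_peak 1 * expR (- (z ^+ 2 / 2)).
Proof.
rewrite normal_pdfE ?oner_eq0// /normal_fun subr0 expr1n mulNr.
by congr (_ * expR (- (_ / _))); rewrite -mulr_natr mul1r.
Qed.

Lemma std_peak_gt0 : 0 < normal_peak (1 : R).
Proof. by rewrite normal_peak_gt0// oner_eq0. Qed.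

Lemma normal_ge0_integral f : measurable_fun setT f -> (forall z, 0 <= f z) ->
  (\int[N]_z (f z)%:E = \int[mu]_z (f z * phi z)%:E)%E.
Proof.
move=> mf f0.
transitivity (\int[N]_z (f z * cst 1 z)%:E)%E.
  by apply: eq_integral => z _; rewrite /= mulr1.
apply: (@weighted_transfer _ _ _ (measurableTypeR R) (measurableTypeR R)
  (measurableTypeR R) R N mu id id (cst 1) phi f) => //.
- exact: measurable_normal_pdf.
- by move=> x; exact: normal_pdf_ge0.
by move=> A mA; rewrite (eq_integral (cst 1%E))// integral_cst// mul1e.
Qed.

Lemma normal_Rint f : intg N f ->
  mu.-integrable setT (fun z => (f z * phi z)%:E) /\
  \int[N]_z f z = \int[mu]_z (f z * phi z).
Proof.
move=> If; have mf := intg_mfun If.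
have mpos (g : R -> R) : measurable_fun setT g -> measurable_fun setT (fun z => Num.max (g z) 0).
  by move=> mg; apply: (measurable_maxr mg); exact: measurable_cst.
have Ipos (g : R -> R) : intg N g -> intg N (fun z => Num.max (g z) 0).
  move=> Ig; apply: (intg_le _ Ig) => [|z]; first by apply: mpos; exact: intg_mfun Ig.
  by rewrite /Num.max; case: ifPn => _; rewrite ?normr0.
have pos0 (g : R -> R) z : 0 <= Num.max (g z) 0 by rewrite le_max lexx orbT.
have IposL (g : R -> R) : intg N g ->
    mu.-integrable setT (fun z => (Num.max (g z) 0 * phi z)%:E) /\
    \int[N]_z Num.max (g z) 0 = \int[mu]_z (Num.max (g z) 0 * phi z).
  move=> Ig; have E := normal_ge0_integral (mpos _ (intg_mfun Ig)) (pos0 g).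
  split; last by rewrite /Rintegral E.
  apply/integrableP; split.
    apply/measurable_EFinP/measurable_funM; first by apply: mpos; exact: intg_mfun Ig.
    exact: measurable_normal_pdf.
  under eq_integral => z _ do rewrite /= ger0_norm ?mulr_ge0 ?normal_pdf_ge0 ?pos0//.
  rewrite -E (intgE (Ipos _ Ig)); exact: ltry.
have [I1 E1] := IposL _ If.
have IN : intg N (fun z => - f z).
  by have := intgZ (-1) If; under eq_fun do rewrite mulN1r.
have [I2 E2] := IposL _ IN.
have fE z : f z = Num.max (f z) 0 - Num.max (- f z) 0.
  have [h|h] := leP 0 (f z).
    by rewrite max_r ?oppr_le0// subr0.
  by rewrite max_l ?oppr_ge0 ?(ltW h)// sub0r opprK.
split.
  have := integrableB measurableT I1 I2; apply: eq_integrable => // z _.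
  by rewrite -EFinB -mulrBl -fE.
transitivity (\int[N]_z (Num.max (f z) 0 - Num.max (- f z) 0)).
  by apply: eq_Rintegral => z _; exact: fE.
rewrite EB; [|exact: Ipos|exact: (Ipos _ IN)].
rewrite E1 E2 -RintegralB//.
by apply: eq_Rintegral => z _; rewrite -mulrBl -fE.
Qed.

Lemma intg_normal_id : intg N (fun z => z).
Proof.
suff : intg N (fun z => `|z|) by move=> I; apply: (intg_le _ I) => // z; rewrite normr_id.
have mnorm : measurable_fun setT (fun z : R => `|z|) by exact: measurableT_comp.
apply: intg_ge0 => //.
have E := normal_ge0_integral mnorm (fun z => normr_ge0 z).
apply: (eq_ind_r (fun u => (u < +oo)%E) _ E).
have p1 := std_peak_gt0.
have p2 : 0 < normal_peak (2 : R) by rewrite normal_peak_gt0.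
(* [|z| phi z] is dominated by [C] times the normal density with standard deviation 2, since
   [|z| <= 2 * expR (3 / 8 * z ^+ 2)]. *)
pose C : R := 2 * normal_peak 1 / normal_peak 2.
have C0 : 0 <= C by rewrite /C divr_ge0 ?mulr_ge0 ?(ltW p1) ?(ltW p2).
apply: (@le_lt_trans _ _ (\int[mu]_z (C%:E * (normal_pdf 0 2 z)%:E))%E); last first.
  rewrite ge0_integralZl//; last 2 first.
  - by apply/measurable_EFinP; exact: measurable_normal_pdf.
  - by move=> z _; rewrite lee_fin normal_pdf_ge0.
  by rewrite integral_normal_pdf mule1 ltry.
apply: ge0_le_integral => //.
- by move=> z _; rewrite lee_fin mulr_ge0 ?normal_pdf_ge0.
- apply/measurable_EFinP/measurable_funM; first exact: measurableT_comp.
  exact: measurable_normal_pdf.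
- by apply/measurable_EFinP/measurable_funM => //; exact: measurable_normal_pdf.
move=> z _; rewrite lee_fin std_pdfE normal_pdfE// /normal_fun subr0.
rewrite (_ : C * _ = normal_peak 1 * (2 * expR (- z ^+ 2 / (2 ^+ 2 *+ 2)))); last first.
  by rewrite /C; field; rewrite gt_eqF.
rewrite mulrCA ler_pM2l//.
rewrite (_ : - (z ^+ 2 / 2) = - (3 / 8 * z ^+ 2) + - z ^+ 2 / (2 ^+ 2 *+ 2)); last first.
  by rewrite -mulr_natr; field.
rewrite expRD mulrA ler_wpM2r ?expR_ge0// expRN ler_pdivrMr ?expR_gt0//.
have := expR_ge1Dx (3 / 8 * z ^+ 2).
rewrite -(real_normK (num_real z)).
by have := sqr_ge0 (`|z| - 2 / 3); rewrite sqrrB; have := sqr_ge0 `|z|; lra.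
Qed.

Lemma std_pdf_le z : phi z <= normal_peak 1 / (1 + z ^+ 2 / 2).
Proof.
have h : 0 < 1 + z ^+ 2 / 2 by rewrite ltr_pwDl// divr_ge0// sqr_ge0.
rewrite std_pdfE ler_pM2l ?std_peak_gt0// expRN lef_pV2 ?posrE ?expR_gt0//.
exact: expR_ge1Dx.
Qed.

Variables (a b : R).

Let k z := a * cos (a * z + b) - z * sin (a * z + b).
Let F z := sin (a * z + b) * phi z.

Let dlin (z : R) : is_derive z 1 (fun z : R => a * z + b) a.
Proof.
have -> : (fun z => a * z + b) = a \*: (id : R -> R) + cst b by [].
by apply: is_derive_eq; rewrite addr0 /GRing.scale/= mulr1.
Qed.

Let dphi (z : R) : is_derive z 1 phi (- z * phi z).
Proof.
rewrite (_ : phi = normal_peak 1 \*: (expR \o (- (2^-1 \*: (id ^+ 2))))); last first.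
  apply/funext => y; rewrite std_pdfE.
  by congr (_ * expR (- _)); rewrite mulrC.
apply: is_derive_eq.
rewrite /GRing.scale/= mulr1 expr1.
rewrite (_ : expR _ = expR (- (z ^+ 2 / 2))) ?std_pdfE; last first.
  by congr (expR (- _)); rewrite mulrC.
rewrite -[X in _ = _ * X]/(normal_peak 1 * expR (- (z ^+ 2 / 2))).
by field.
Qed.

Let dF (z : R) : is_derive z 1 F (k z * phi z).
Proof.
have ds : is_derive z 1 (sin \o (fun z => a * z + b)) (cos (a * z + b) * a).
  exact: is_derive1_comp.
have -> : F = (sin \o (fun z => a * z + b)) * phi by [].
apply: (is_derive_eq (is_deriveM ds (dphi z))).
by rewrite /GRing.scale/= /k; ring.
Qed.

Let ccos : continuous (fun z => cos (a * z + b)).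
Proof.
move=> z; apply: continuous_comp; last exact: continuous_cos.
by apply/differentiable_continuous/derivable1_diffP; case: (dlin z).
Qed.

Let csin : continuous (fun z => sin (a * z + b)).
Proof.
move=> z; apply: continuous_comp; last exact: continuous_sin.
by apply/differentiable_continuous/derivable1_diffP; case: (dlin z).
Qed.

Let ck : continuous k.
Proof.
move=> z; apply: cvgB; apply: cvgM.
- exact: cvg_cst.
- exact: ccos.
- exact: cvg_id.
- exact: csin.
Qed.

Let Ik : intg N k.
Proof.
apply: (@intg_le _ _ _ N k (fun z : R => `|a| + `|z|)).
- exact: continuous_measurable_fun.
- by apply: intgD; [exact: intg_cst|exact: intg_abs intg_normal_id].
move=> z; rewrite [leRHS]ger0_norm ?addr_ge0//.
apply: le_trans (ler_normB _ _) _.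
by rewrite !normrM lerD// ler_piMr// ?cos_max ?sin_max.
Qed.

Let FTC (m : nat) : \int[N]_z (k z * \1_`[- m.+1%:R, m.+1%:R] z) = F m.+1%:R - F (- m.+1%:R).
Proof.
have Ik1 : intg N (fun z => k z * \1_`[- m.+1%:R, m.+1%:R] z).
  under eq_fun do rewrite mulrC.
  apply: intgM_bnd Ik; last by move=> z; exact: indic_bnd.
  exact: indic_mfun.
have [_ ->] := normal_Rint Ik1.
have cF : continuous F.
  by move=> z; apply/differentiable_continuous/derivable1_diffP; case: (dF z).
have lt : - m.+1%:R < m.+1%:R :> R by rewrite gtrN// ltr0n.
have := @continuous_FTC2 R (fun z => k z * phi z) F (- m.+1%:R) m.+1%:R lt.
rewrite /Rintegral => h; rewrite -[RHS]/(fine ((F m.+1%:R)%:E - (F (- m.+1%:R))%:E)%E).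
rewrite -h; last 3 first.
- apply: continuous_subspaceT => z; apply: cvgM; first exact: ck.
  by apply: continuous_normal_pdf; rewrite oner_eq0.
- split.
  + by move=> z _; case: (dF z).
  + exact/cvg_at_right_filter/cF.
  + exact/cvg_at_left_filter/cF.
- move=> z _; rewrite derive1E; case: (dF z) => _ -> //.
congr fine; rewrite [RHS]integral_mkcond; apply: eq_integral => z _.
by rewrite patchE indicE; case: ifP => _; rewrite ?mulr1 ?mulr0 ?mul0r.
Qed.

(** At [|z| = m + 1] the density is at most its peak over [1 + z ^+ 2 / 2], and this denominator is
    at least [m + 1]. *)
Let F_le m : `|F m.+1%:R - F (- m.+1%:R)| <= 2 * normal_peak 1 * harmonic m.
Proof.
have m0 : 0 < m.+1%:R :> R by rewrite ltr0n.
have phi_le z : `|z| = m.+1%:R -> `|F z| <= normal_peak 1 * harmonic m.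
  move=> zm; rewrite /F normrM [X in _ * X]ger0_norm ?normal_pdf_ge0//.
  apply: (@le_trans _ _ (phi z)).
    by rewrite ler_piMl ?normal_pdf_ge0// sin_max.
  apply: le_trans (std_pdf_le z) _; rewrite ler_pM2l ?std_peak_gt0// /harmonic/=.
  rewrite -(real_normK (num_real z)) zm lef_pV2 ?posrE//.
  by have := sqr_ge0 (m.+1%:R - 1 : R); rewrite sqrrB; lra.
apply: le_trans (ler_normB _ _) _.
rewrite -mulrA mulr_natl mulr2n lerD ?phi_le//; first by rewrite ger0_norm// ltW.
by rewrite normrN ger0_norm// ltW.
Qed.

(* [k z * phi z] is the derivative of [F], which vanishes at infinity. *)
Lemma stein_trig : \int[N]_z k z = 0.
Proof.
have cv : \int[N]_z (k z * \1_`[- m.+1%:R, m.+1%:R] z) @[m --> \oo] --> \int[N]_z k z.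
  have [|||||_ _ cvI] := @dominated_convergence _ _ _ N setT measurableT
    (fun m z => (k z * \1_`[- m.+1%:R, m.+1%:R] z)%:E) (EFin \o k) (fun z => `|k z|%:E).
  - move=> m; apply/measurable_EFinP; apply: measurable_funM; first exact: intg_mfun Ik.
    exact: indic_mfun.
  - by apply/measurable_EFinP; exact: intg_mfun Ik.
  - apply: aeW => z _; apply: cvg_near_cst; near=> m.
    rewrite indicE mem_set ?mulr1//= in_itv/= -ler_norml.
    apply: (@le_trans _ _ m%:R); last by rewrite ler_nat.
    by near: m; exact: nbhs_infty_ger.
  - exact: intg_abs Ik.
  - apply: aeW => z m _; rewrite /= lee_fin normrM ler_piMr//.
    exact: indic_bnd.
  move: cvI; rewrite (_ : (\int[N]_z (EFin \o k) z)%E = (\int[N]_z k z)%:E).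
    by move/fine_cvg.
  exact: intgE.
have cv0 : \int[N]_z (k z * \1_`[- m.+1%:R, m.+1%:R] z) @[m --> \oo] --> (0 : R).
  under eq_fun do rewrite FTC.
  apply: norm_cvg0.
  apply: (@squeeze_cvgr _ _ _ R (cst 0) (fun m => 2 * normal_peak 1 * harmonic m)).
  - by apply: nearW => m /=; rewrite normr_ge0/= F_le.
  - exact: cvg_cst.
  - rewrite -[X in _ --> X](mulr0 (2 * normal_peak 1)).
    by apply: cvgMr; exact: cvg_harmonic.
exact: (cvg_unique _ cv cv0).
Unshelve. all: by end_near. Qed.

Lemma intg_normal_idsin : intg N (fun z => z * sin (a * z + b)).
Proof.
under eq_fun do rewrite mulrC.
apply: (intgM_bnd (M := 1)) intg_normal_id; first exact: continuous_measurable_fun.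
by move=> z; exact: sin_max.
Qed.

(** Stein's identity [E Z f(Z) = E f'(Z)] for [f z = sin (a * z + b)]. *)
Lemma stein_cos : \int[N]_z (z * sin (a * z + b)) = a * \int[N]_z cos (a * z + b).
Proof.
have Ic : intg N (fun z => cos (a * z + b)).
  by apply: (intg_bnd (M := 1)) => [|z]; [exact: continuous_measurable_fun|exact: cos_max].
have := stein_trig; rewrite /k EB//; last 2 first.
- exact: intgZ.
- exact: intg_normal_idsin.
by rewrite EZ// => /eqP; rewrite subr_eq0 => /eqP.
Qed.

End gaussian.

Section gaussian_charf.
Context {R : realType}.
Local Notation N := (std_normal R).
Variable b : R.

Let psi (a : R) := \int[N]_z cos (a * z + b).

Let dcos (z a : R) : is_derive a 1 (fun a : R => cos (a * z + b)) (- (z * sin (a * z + b))).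
Proof.
have dl : is_derive a 1 (fun a : R => a * z + b) z.
  have -> : (fun a => a * z + b) = z \*: (id : R -> R) + cst b.
    by apply/funext => y; rewrite mulrC.
  by apply: is_derive_eq; rewrite addr0 /GRing.scale/= mulr1.
have d2 : is_derive a 1 (@cos R \o (fun a : R => a * z + b)) (- sin (a * z + b) * z).
  exact: is_derive1_comp.
by apply: is_derive_eq; ring.
Qed.

(** Differentiation under the integral, with [|z|] as dominating function, gives the mean of
    [- z sin (a z + b)], which Stein's identity turns back into [psi]. *)
Let dpsi (a : R) : is_derive a 1 psi (- (a * psi a)).
Proof.
have Ic (x : R) : intg N (fun z => cos (x * z + b)).
  apply: (intg_bnd (M := 1)) => [|z]; last exact: cos_max.
  apply: measurableT_comp; first by apply: continuous_measurable_fun; exact: continuous_cos.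
  by apply: measurable_funD => //; exact: measurable_funM.
have d1E x y : partial1of2 (fun x z : R => cos (x * z + b)) x y = - (y * sin (x * y + b)).
  by rewrite partial1of2E; case: (dcos y x) => _ ->.
have aI : (`]a - 1, a + 1[%classic : set R) a by rewrite /= in_itv/= ltrBlDr ltrDl ltr01.
have Ia : intg N (fun z : R => `|z|) by exact: intg_abs intg_normal_id.
have der (x z : R) : `]a - 1, a + 1[%classic x -> setT z ->
    derivable (fun x : R => cos (x * z + b)) x 1.
  by move=> _ _; case: (dcos z x).
have bnd (x z : R) : `]a - 1, a + 1[%classic x -> setT z ->
    `|partial1of2 (fun x z : R => cos (x * z + b)) x z| <= `|z|.
  by move=> _ _; rewrite d1E normrN normrM ler_piMr// sin_max.
have D := @differentiation_under_integral R _ _ N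
  (fun x z : R => cos (x * z + b)) setT measurableT a (a - 1) (a + 1) aI
  (fun x _ => Ic x) der (fun z => `|z|) (fun z => normr_ge0 z) Ia bnd.
have D' := @derivable_under_integral R _ _ N
  (fun x z : R => cos (x * z + b)) setT measurableT a (a - 1) (a + 1) aI
  (fun x _ => Ic x) der (fun z => `|z|) (fun z => normr_ge0 z) Ia bnd.
apply: DeriveDef => //; rewrite -derive1E D.
rewrite /psi -stein_cos -mulN1r -EZ; last exact: intg_normal_idsin.
by apply: eq_Rintegral => z _; rewrite d1E mulN1r.
Qed.

(** [psi] solves [psi' = - a psi], so [expR (a ^+ 2 / 2) * psi a] is constant, with value [cos b] at
    0. *)
Lemma normal_charf (a : R) :
  \int[N]_z cos (a * z + b) = expR (- (a ^+ 2 / 2)) * cos b.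
Proof.
rewrite -/(psi a); pose u (a : R) := expR (a ^+ 2 / 2) * psi a.
have du (x : R) : is_derive x 1 u 0.
  have de : is_derive x 1 (expR \o (2^-1 \*: (id ^+ 2))) (expR (x ^+ 2 / 2) * x).
    apply: is_derive_eq; rewrite /GRing.scale/= mulr1 expr1.
    rewrite (_ : expR _ = expR (x ^+ 2 / 2)); first by field.
    by congr expR; rewrite mulrC.
  have -> : u = (expR \o (2^-1 \*: (id ^+ 2))) * psi.
    by apply/funext => y; congr (expR _ * _); rewrite mulrC.
  apply: (is_derive_eq (is_deriveM de (dpsi x))).
  rewrite /GRing.scale/=.
  rewrite (_ : expR ((2^-1 \*: id ^+ 2) x) = expR (x ^+ 2 / 2)); first by ring.
  by congr expR; rewrite mulrC.
have := is_derive_0_is_cst a 0 du.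
rewrite /u expr0n/= mul0r expR0 mul1r => E.
have p0 : psi 0 = cos b.
  by rewrite /psi; under eq_Rintegral do rewrite mul0r add0r; rewrite Ecst.
by rewrite expRN -p0 -E mulrA mulVf ?mul1r// gt_eqF// expR_gt0.
Qed.

End gaussian_charf.

(** * Levy's continuity theorem *)

Section step_polynomial.
Context {R : realType}.
Implicit Types u x y s : R.

Lemma bernoulli_ineq u (m : nat) : -1 <= u -> 1 + m%:R * u <= (1 + u) ^+ m.
Proof.
move=> u1; elim: m => [|m IH]; first by rewrite mul0r addr0 expr0.
have u0 : 0 <= 1 + u by lra.
rewrite exprS; apply: le_trans (ler_wpM2l u0 IH).
have : 0 <= m%:R * u ^+ 2 by rewrite mulr_ge0// sqr_ge0.
rewrite (_ : (1 + u) * (1 + m%:R * u) = 1 + m.+1%:R * u + m%:R * u ^+ 2); first by lra.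
by rewrite -natr1; ring.
Qed.

(** Bernoulli's inequality bounds [1 + m u] by [(1 + u) ^+ m], and [(1 - u) (1 + u) <= 1]. *)
Lemma expr1B_le u (m : nat) : 0 <= u <= 1 -> (1 - u) ^+ m <= (1 + m%:R * u)^-1.
Proof.
move=> /andP[u0 u1]; have m0 : 0 <= m%:R * u by rewrite mulr_ge0.
have d0 : 0 < 1 + m%:R * u by rewrite ltr_pwDl.
rewrite -[leRHS]mul1r ler_pdivlMr//.
have h : 1 + m%:R * u <= (1 + u) ^+ m by apply: bernoulli_ineq; lra.
have v0 : 0 <= 1 - u by lra.
apply: le_trans (ler_wpM2l (exprn_ge0 m v0) h) _.
rewrite -exprMn exprn_ile1//; first by rewrite mulr_ge0//; lra.
have -> : (1 - u) * (1 + u) = 1 - u ^+ 2 by ring.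
by rewrite gerBl sqr_ge0.
Qed.

Lemma step_poly (s eps : R) : 0 < s < 1 -> 0 < eps -> exists p : {poly R},
  forall y, -1 <= y <= 1 -> [/\ 0 <= p.[y] <= 1,
    (s <= y -> 1 - eps <= p.[y]) & (y <= - s -> p.[y] <= eps)].
Proof.
move=> /andP[s0 s1] e0.
(* Large enough for [1 / (1 + n * s) <= eps], the error on both sides of the step. *)
have [n /ltW nE] : exists n : nat, (eps^-1 / s) < n%:R.
  by exists (Num.truncn (eps^-1 / s)).+1; exact: truncnS_gt.
have nse : (1 + n%:R * s)^-1 <= eps.
  rewrite -[leRHS]invrK lef_pV2 ?posrE ?invr_gt0//; last first.
    by rewrite ltr_pwDl// mulr_ge0// ltW.
  by move: nE; rewrite ler_pdivrMr//; lra.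
pose Z : {poly R} := 2^-1 *: (1 + 'X).
(* the polynomial of the elementary proofs of the Stone-Weierstrass theorem *)
exists (1 - (1 - Z ^+ n) ^+ (2 ^ n)) => y /andP[y1 y2].
set z : R := 2^-1 * (1 + y).
have z0 : 0 <= z by rewrite /z mulr_ge0//; lra.
have z1 : z <= 1 by rewrite /z; lra.
have zn0 : 0 <= z ^+ n by rewrite exprn_ge0.
have zn1 : z ^+ n <= 1 by rewrite exprn_ile1.
have w0 : 0 <= 1 - z ^+ n by lra.
have -> : (1 - (1 - Z ^+ n) ^+ (2 ^ n)).[y] = 1 - (1 - z ^+ n) ^+ (2 ^ n).
  by rewrite !hornerE.
have w1 : 0 <= (1 - z ^+ n) ^+ (2 ^ n) <= 1.
  by rewrite exprn_ge0// exprn_ile1//; lra.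
have E2 : (2 ^ n)%:R * z ^+ n = (1 + y) ^+ n.
  by rewrite natrX -exprMn /z mulrA divff// mul1r.
split; first by lra.
- move=> sy; rewrite lerD2l lerN2.
  have zn : 0 <= z ^+ n <= 1 by rewrite zn0 zn1.
  have := expr1B_le (2 ^ n) zn.
  rewrite E2 => h; apply: (le_trans h); apply: le_trans nse.
  have b1 : 1 + n%:R * s <= (1 + y) ^+ n.
    apply: (@le_trans _ _ ((1 + s) ^+ n)); first by apply: bernoulli_ineq; lra.
    by rewrite lerXn2r// ?nnegrE; lra.
  have ns : 0 <= n%:R * s by rewrite mulr_ge0// ltW.
  by rewrite lef_pV2 ?posrE; lra.
move=> ys; apply: (@le_trans _ _ ((1 + y) ^+ n)).
  have zn : -1 <= - z ^+ n by lra.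
  by have := bernoulli_ineq (2 ^ n) zn; rewrite mulrN E2; lra.
apply: le_trans nse.
apply: (@le_trans _ _ ((1 - s) ^+ n)).
  by rewrite lerXn2r// ?nnegrE; lra.
by apply: expr1B_le; lra.
Qed.

Lemma sin_le_itv x y : - (pi / 2) <= x -> x <= y -> y <= pi / 2 -> sin x <= sin y.
Proof.
move=> x0; rewrite le_eqVlt => /predU1P[->//|xy] y0; apply: ltW.
by rewrite ltr_sin// in_itv/=; lra.
Qed.

Lemma step_trig (r1 r2 L eps : R) : r1 < r2 -> 0 < L -> `|r1| <= L -> `|r2| <= L ->
  0 < eps -> exists (p : {poly R}) (a b : R), forall x,
    [/\ 0 <= p.[cos (a * x + b)] <= 1,
     (x <= r1 -> `|x| <= L -> 1 - eps <= p.[cos (a * x + b)]) &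
     (r2 <= x -> `|x| <= L -> p.[cos (a * x + b)] <= eps)].
Proof.
move=> r12 L0 r1L r2L e0.
(* [rho] is the midpoint of the gap. As [l] exceeds [2 * L], for [|x| <= L] the argument of the sine
   stays in [-1, 1], where the sine increases; [s0] is half the gap after scaling. *)
pose rho := (r1 + r2) / 2; pose l := 2 * L + 1; pose s0 := (r2 - r1) / 2 / l.
have l0 : 0 < l by rewrite /l; lra.
have hp1 := @pihalf_ge1 R.
have s00 : 0 < s0 by rewrite /s0 !divr_gt0// subr_gt0.
move: (r1L) (r2L); rewrite !ler_norml => /andP[h1 h2] /andP[h3 h4].
have s01 : s0 < 1 by rewrite /s0 ltr_pdivrMr// /l; lra.
have ss : 0 < sin s0 < 1.
  rewrite sin2_gt0 ?s00/=; last by lra.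
  by rewrite -sin_pihalf ltr_sin ?in_itv/=; lra.
have [p pP] := step_poly ss e0.
exists p, l^-1, (- (rho / l) + pi / 2) => x.
have -> : l^-1 * x + (- (rho / l) + pi / 2) = (x - rho) / l + pi / 2.
  by field; rewrite gt_eqF.
rewrite cosDpihalf -sinN; set u := - ((x - rho) / l).
have uE : u = (rho - x) / l by rewrite /u -mulNr opprB.
have [|p01 pP1 pP2] := pP (sin u); first by rewrite sin_geN1 sin_le1.
have uL : `|x| <= L -> - (pi / 2) <= u <= pi / 2.
  rewrite ler_norml => /andP[x1 x2].
  have : -1 <= u <= 1; last by lra.
  by rewrite uE ler_pdivlMr// ler_pdivrMr// /rho /l; lra.
split => // xr /uL/andP[u1 u2]; [apply: pP1|apply: pP2; rewrite -sinN].
- apply: sin_le_itv => //; first by lra.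
  by rewrite uE /s0 ler_pM2r ?invr_gt0// /rho; lra.
- apply: sin_le_itv => //; last by lra.
  by rewrite uE /s0 -mulNr ler_pM2r ?invr_gt0// /rho; lra.
Qed.

End step_polynomial.

(** Pointwise the indicator of [X <= r1] is at most [f X + eps] plus the indicator of [|X| >= L],
    and [f X] is bounded likewise through [r2]; outside the interval only [0 <= f <= 1] is known. *)
Lemma cdf_sandwich {d : measure_display} {T : measurableType d} {R : realType}
    (P : probability T R) (X : T -> R) (f : R -> R) (r1 r2 L eps : R) :
  measurable_fun setT X -> measurable_fun setT f ->
  (forall x, [/\ 0 <= f x <= 1, (x <= r1 -> `|x| <= L -> 1 - eps <= f x) &
     (r2 <= x -> `|x| <= L -> f x <= eps)]) -> 0 <= eps ->
  fine (P [set t | X t <= r1]) <=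
    \int[P]_t f (X t) + eps + fine (P [set t | L <= `|X t|]) /\
  \int[P]_t f (X t) <=
    fine (P [set t | X t <= r2]) + eps + fine (P [set t | L <= `|X t|]).
Proof.
move=> mX mf fP e0.
have mXle r : measurable [set t | X t <= r].
  exact: measurable_le_set.
have mXge : measurable [set t | L <= `|X t|].
  by apply: measurable_ge_set; apply: measurableT_comp.
have If : intg P (fun t => f (X t)).
  apply: (intg_bnd (M := 1)); first exact: measurableT_comp.
  by move=> t; have [/andP[f0 f1] _ _] := fP (X t); rewrite ger0_norm.
have I1 (A : set T) : measurable A -> intg P (\1_A : T -> R) by exact: intg_indic.
have Ie : intg P (fun=> eps) by exact: intg_cst.
set A1 := [set t | X t <= r1]; set A2 := [set t | X t <= r2].
set B := [set t | L <= `|X t|].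
have IA1 : intg P (\1_A1 : T -> R) by exact: (I1 _ (mXle r1)).
have IA2 : intg P (\1_A2 : T -> R) by exact: (I1 _ (mXle r2)).
have IB : intg P (\1_B : T -> R) by exact: (I1 _ mXge).
have Ife : intg P (fun t => f (X t) + eps) by exact: intgD.
have IAe : intg P (fun t => \1_A2 t + eps) by exact: intgD.
rewrite -!Eindic//; [split|exact: mXle..].
- have -> : \int[P]_t f (X t) + eps + \int[P]_t \1_B t =
      \int[P]_t (f (X t) + eps + \1_B t) by rewrite !ED// Ecst.
  apply: Ele => //; first exact: intgD.
  move=> t /=; have [/andP[f0 f1] fr1 _] := fP (X t); rewrite !indicE.
  have [/set_mem /= x1|_] := boolP (t \in A1); last by rewrite !addr_ge0.
  have [_|] := boolP (t \in B); first by rewrite /=; lra.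
  rewrite notin_setE /= => /negP; rewrite -ltNge => /ltW xL.
  by have := fr1 x1 xL; rewrite /=; lra.
- have -> : \int[P]_t \1_A2 t + eps + \int[P]_t \1_B t =
      \int[P]_t (\1_A2 t + eps + \1_B t) by rewrite !ED// Ecst.
  apply: Ele => //; first exact: intgD.
  move=> t /=; have [/andP[f0 f1] _ fr2] := fP (X t); rewrite !indicE.
  have [_|] := boolP (t \in A2).
    by rewrite /= (le_trans f1)// -addrA lerDl addr_ge0.
  rewrite notin_setE /= => /negP; rewrite -ltNge => /ltW x2.
  have [_|] := boolP (t \in B); first by rewrite /=; lra.
  rewrite notin_setE /= => /negP; rewrite -ltNge => /ltW xL.
  by have := fr2 x2 xL; rewrite /=; lra.
Qed.

Section normal_cdf.
Context {R : realType}.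
Local Notation N := (std_normal R).

Lemma std_normal_tail (eps : R) : 0 < eps -> exists2 L0 : R, 0 < L0 &
  forall L, L0 <= L -> fine (N [set z | (L <= `|z|)%R]) <= eps.
Proof.
move=> e0; pose m := \int[N]_z `|z|.
have m0 : 0 <= m by apply: Rintegral_ge0.
have Im : intg N (fun z => `|z|) by exact: intg_abs intg_normal_id.
exists ((m + 1) / eps); first by rewrite divr_gt0// ltr_pwDr.
move=> L LL; have L0 : 0 < L by apply: lt_le_trans LL; rewrite divr_gt0// ltr_pwDr.
have := markov_ge0 Im (fun z => normr_ge0 z) L0.
have mS : measurable [set z : R | L <= `|z|].
  exact: measurable_ge_set.
rewrite -lee_fin fineK ?fin_num_measure// => /le_trans; apply.
rewrite lee_fin -/m ler_pdivrMr// mulrC -ler_pdivrMr//; apply: le_trans LL.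
by rewrite ler_pM2r ?invr_gt0// lerDl.
Qed.

(** The normal density is bounded by its peak, so [eps] divided by the peak works at every [r]. *)
Lemma std_normal_cdf_cont (r eps : R) : 0 < eps -> exists2 s : R, 0 < s &
  fine (N [set z : R | z <= r + s]) <= fine (N [set z | z <= r]) + eps /\
  fine (N [set z : R | z <= r]) <= fine (N [set z | z <= r - s]) + eps.
Proof.
move=> e0; have p0 := @std_peak_gt0 R; pose s := eps / normal_peak 1.
have s0 : 0 < s by rewrite divr_gt0.
have mle (x : R) : measurable [set z : R | z <= x].
  exact: measurable_le_set.
have K x : fine (N [set z : R | z <= x + s]) <= fine (N [set z | z <= x]) + eps.
  have mI : measurable `]x, (x + s)]%classic by [].
  rewrite (_ : [set z : R | z <= x + s] = [set z | z <= x] `|` `]x, (x + s)]%classic); last first.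
    apply/seteqP; split => z /=; rewrite in_itv/=.
      by move=> zs; case: (leP z x) => zx; [left|right; rewrite zs].
    by case=> [zx|/andP[]//]; rewrite (le_trans zx)// lerDl ltW.
  rewrite -lee_fin EFinD !fineK ?fin_num_measure//; [|exact: mle|]; last first.
    by apply: measurableU => //; exact: mle.
  apply: (le_trans (measureU2 N (mle x) mI)); rewrite leeD2l//.
  have -> : eps%:E = (\int[@lebesgue_measure R]_(z in `]x, (x + s)%R]%classic)
      (normal_peak 1)%:E)%E.
    rewrite integral_cst//= lebesgue_measure_itv/= lte_fin ltrDl s0.
    by rewrite -EFinB -EFinM addrAC subrr add0r /s mulrCA divff ?mulr1// gt_eqF.
  apply: ge0_le_integral => //.
  - by move=> z _; rewrite lee_fin normal_pdf_ge0.
  - by apply/measurable_EFinP; apply: measurable_funTS; exact: measurable_normal_pdf.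
  - by move=> z _; rewrite lee_fin normal_pdf_ub// oner_eq0.
exists s => //; split; first exact: K.
by have := K (r - s); rewrite subrK.
Qed.

End normal_cdf.

Section levy.
Context {d : measure_display} {T : measurableType d} {R : realType}.
Variables (P : probability T R) (X : nat -> T -> R).
Local Notation N := (std_normal R).
Hypothesis mX : forall n, measurable_fun setT (X n).
Hypothesis charf : forall a b : R,
  \int[P]_t cos (a * X n t + b) @[n --> \oo] --> expR (- (a ^+ 2 / 2)) * cos b.
Hypothesis tight : forall eps : R, 0 < eps -> exists2 L : R, 0 < L &
  \forall n \near \oo, (P [set t | (L <= `|X n t|)%R] <= eps%:E)%E.

(** Test functions along which expectations converge; the class is enlarged from single cosines to
    polynomials in a cosine. *)
Let good (f : R -> R) := [/\ measurable_fun setT f, (exists M : R, forall x, `|f x| <= M) &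
  \int[P]_t f (X n t) @[n --> \oo] --> \int[N]_z f z].

Let good_int f : good f -> (forall n, intg P (fun t => f (X n t))) /\ intg N f.
Proof.
move=> [mf [M fM] _]; split; last exact: (@intg_bnd _ _ _ N f M).
by move=> n; apply: (intg_bnd (M := M)) => //; exact: measurableT_comp.
Qed.

Let good_ext f g : f =1 g -> good f -> good g.
Proof. by move/funext => ->. Qed.

Let good_lin (c : R) f g : good f -> good g -> good (fun x => c * f x + g x).
Proof.
move=> gf gg; have [If IfN] := good_int gf; have [Ig IgN] := good_int gg.
case: gf gg => [mf [M fM] cf] [mg [M' gM'] cg].
split.
- by apply: measurable_funD => //; exact: measurable_funM.
- exists (`|c| * M + M') => x; apply: le_trans (ler_normD _ _) _.
  by rewrite lerD// normrM ler_wpM2l.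
rewrite ED//; last exact: intgZ.
rewrite EZ//.
have E n : \int[P]_t (c * f (X n t) + g (X n t)) =
    c * \int[P]_t f (X n t) + \int[P]_t g (X n t).
  by rewrite ED ?EZ//; exact: intgZ.
under eq_fun do rewrite E.
by apply: cvgD => //; apply: cvgMr.
Qed.

Let mcos : measurable_fun setT (@cos R).
Proof. by apply: continuous_measurable_fun; exact: continuous_cos. Qed.

Let good_cos (a b : R) : good (fun x => cos (a * x + b)).
Proof.
split.
- apply: measurableT_comp => //.
  by apply: measurable_funD => //; exact: measurable_funM.
- by exists 1 => x; exact: cos_max.
- by rewrite normal_charf; exact: charf.
Qed.

(** Product-to-sum formula. The extra cosine with free frequency and phase keeps the induction
    going: each factor [cos (a x + b)] splits it into two. *)
Let good_cosX (a b : R) k : forall a' b',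
  good (fun x => cos (a * x + b) ^+ k * cos (a' * x + b')).
Proof.
elim: k => [|k IH] a' b'.
  by apply: good_ext (good_cos a' b') => x; rewrite expr0 mul1r.
have h1 := IH (a' + a) (b' + b); have h2 := IH (a' - a) (b' - b).
have g0 : good (fun=> 0).
  split; [exact: measurable_cst|by exists 0 => x; rewrite normr0|].
  by rewrite !Ecst; exact: cvg_cst.
apply: good_ext (good_lin 2^-1 h1 (good_lin 2^-1 h2 g0)) => x.
rewrite (_ : (a' + a) * x + (b' + b) = (a' * x + b') + (a * x + b)); last by ring.
rewrite (_ : (a' - a) * x + (b' - b) = (a' * x + b') - (a * x + b)); last by ring.
set u := a' * x + b'; set v := a * x + b.
by rewrite (cosD u v) (cosB u v) exprS; field.
Qed.

Let good_poly (p : {poly R}) (a b : R) : good (fun x => p.[cos (a * x + b)]).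
Proof.
have g0 : good (fun=> 0).
  split; [exact: measurable_cst|by exists 0 => x; rewrite normr0|].
  by rewrite !Ecst; exact: cvg_cst.
have gs n (c : nat -> R) : good (fun x => \sum_(i < n) c i * cos (a * x + b) ^+ i).
  elim: n => [|n IH].
    by apply: good_ext g0 => x; rewrite big_ord0.
  apply: good_ext (good_lin (c n) (good_cosX a b n 0 0) IH) => x.
  by rewrite big_ord_recr/= mul0r add0r cos0 mulr1 addrC.
by apply: good_ext (gs (size p) (fun i => p`_i)) => x; rewrite horner_coef.
Qed.

(** Polynomials in a cosine approximate a step on a bounded interval only; [tight] and the normal
    tail bound take care of the rest. *)
Lemma levy_cdf (r : R) :
  P [set t | X n t <= r] @[n --> \oo] --> std_normal R `]-oo, r]%classic.
Proof.
have mX' n x : measurable [set t | X n t <= x].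
  exact: measurable_le_set.
have mXge n x : measurable [set t | x <= `|X n t|].
  by apply: measurable_ge_set; apply: measurableT_comp => //; exact: mX.
have -> : `]-oo, r]%classic = [set z : R | z <= r].
  by apply/seteqP; split => z /=; rewrite in_itv.
have -> : N [set z : R | z <= r] = (fine (N [set z : R | z <= r]))%:E.
  rewrite fineK// fin_num_measure//.
  exact: measurable_le_set.
apply/fine_cvgP; split; first by apply: nearW => n; rewrite fin_num_measure.
apply/cvgrPdist_le => eps' e0'.
(* Six errors: the step approximation and the tail, each under both laws, the convergence of one
   polynomial mean, and the continuity of the normal distribution function. *)
pose eps := eps' / 6; have e0 : 0 < eps by rewrite divr_gt0.
have [s s0 [Ns1 Ns2]] := std_normal_cdf_cont r e0.
have [L1 L10 NL] := std_normal_tail e0.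
have [L2 L20 XL] := tight e0.
pose L := L1 + L2 + `|r| + s.
have L0 : 0 < L by rewrite /L; have := normr_ge0 r; lra.
have rL : `|r| <= L by rewrite /L; lra.
have rs1 : `|r + s| <= L.
  by apply: le_trans (ler_normD _ _) _; rewrite (gtr0_norm s0) /L; lra.
have rs2 : `|r - s| <= L.
  by apply: le_trans (ler_normB _ _) _; rewrite (gtr0_norm s0) /L; lra.
have tN : fine (N [set z | L <= `|z|]) <= eps by apply: NL; rewrite /L; have := normr_ge0 r; lra.
have r12 : r < r + s by lra.
have r01 : r - s < r by lra.
have [p1 [a1 [b1 P1]]] := step_trig r12 L0 rL rs1 e0.
have [p2 [a2 [b2 P2]]] := step_trig r01 L0 rs2 rL e0.
have [m1 _ c1] := good_poly p1 a1 b1; have [m2 _ c2] := good_poly p2 a2 b2.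
have e0w := ltW e0.
have [_ B1] : _ /\ (\int[N]_z p1.[cos (a1 * z + b1)] <=
    fine (N [set z | z <= r + s]) + eps + fine (N [set z | L <= `|z|])) :=
  @cdf_sandwich _ _ _ N id _ _ _ _ _ (@measurable_id _ _ setT) m1 P1 e0w.
have [B2 _] : (fine (N [set z | z <= r - s]) <=
    \int[N]_z p2.[cos (a2 * z + b2)] + eps + fine (N [set z | L <= `|z|])) /\ _ :=
  @cdf_sandwich _ _ _ N id _ _ _ _ _ (@measurable_id _ _ setT) m2 P2 e0w.
near=> n.
have tX : fine (P [set t | L <= `|X n t|]) <= eps.
  rewrite -lee_fin fineK ?fin_num_measure//.
  have : (P [set t | (L2 <= `|X n t|)%R] <= eps%:E)%E by near: n; exact: XL.
  apply: le_trans; apply: le_measure; rewrite ?inE// => t /=.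
  by apply: le_trans; rewrite /L; have := normr_ge0 r; lra.
have [A1 _] := cdf_sandwich P (@mX n) m1 P1 e0w.
have [_ A2] := cdf_sandwich P (@mX n) m2 P2 e0w.
have D1 : `|\int[N]_z p1.[cos (a1 * z + b1)] - \int[P]_t p1.[cos (a1 * X n t + b1)]| <= eps.
  by near: n; move/cvgrPdist_le : c1; exact.
have D2 : `|\int[N]_z p2.[cos (a2 * z + b2)] - \int[P]_t p2.[cos (a2 * X n t + b2)]| <= eps.
  by near: n; move/cvgrPdist_le : c2; exact.
change (`|fine (N [set z | z <= r]) - fine (P [set t | X n t <= r])| <= eps').
move: D1 D2; rewrite !ler_norml => /andP[D1 D1'] /andP[D2 D2'].
by rewrite (_ : eps' = 6 * eps); [lra|rewrite /eps; field].
Unshelve. all: by end_near. Qed.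

End levy.

(** * Conditioning on the history *)

Section independence.
Context {d : measure_display} {T : measurableType d} {R : realType}.
Variable P : probability T R.
Implicit Types (G : set_system T) (A B C : set T).

Lemma sigI G A B : <<s G>> A -> <<s G>> B -> <<s G>> (A `&` B).
Proof. exact: (@measurableI _ (g_sigma_algebraType G)). Qed.

Lemma sigT G : <<s G>> setT.
Proof. exact: (@measurableT _ (g_sigma_algebraType G)). Qed.

Lemma sig_mono G G' : G `<=` <<s G'>> -> <<s G>> `<=` <<s G'>>.
Proof. by move=> GG'; apply: smallest_sub => //; exact: smallest_sigma_algebra. Qed.

Lemma sig_meas G : G `<=` d.-measurable -> <<s G>> `<=` d.-measurable.
Proof. by move=> Gm; apply: smallest_sub => //; exact: sigma_algebra_measurable. Qed.

(** Both sides are finite measures in [A] that agree on a generating family closed under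
    intersection and containing the whole space; uniqueness of measures does the rest. *)
Lemma indep_ext G C : G `<=` d.-measurable -> setI_closed G -> G setT ->
  measurable C -> (forall A, G A -> P (A `&` C) = (P A * P C)%E) ->
  forall A, <<s G>> A -> P (A `&` C) = (P A * P C)%E.
Proof.
move=> Gm GI GT mC H A GA.
have PC0 : 0 <= fine (P C) by rewrite fine_ge0.
have PCE : P C = (fine (P C))%:E by rewrite fineK// fin_num_measure.
have cov : \bigcup_(k : nat) (fun=> setT) k = [set: T].
  by apply/seteqP; split => // x _; exists 0%N.
have E := @g_sigma_algebra_measure_unique d R T G Gm (fun=> setT) (fun=> GT) cov
  (mrestr P mC) (mscale (NngNum PC0) P) GI.
have SE B : mscale (NngNum PC0) P B = (P B * P C)%E by rewrite /mscale/= -PCE muleC.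
transitivity (mscale (NngNum PC0) P A); last exact: SE.
apply: E => //.
- by move=> B GB; transitivity (P B * P C)%E; [exact: H|exact/esym/SE].
- move=> _; rewrite -[X in (X < _)%E]/(P (setT `&` C)) -ge0_fin_numE//.
  by apply: fin_num_measure; exact: measurableI.
Qed.

Lemma indep_integral G C (g : T -> R) : G `<=` d.-measurable -> measurable C ->
  (forall A, <<s G>> A -> P (A `&` C) = (P A * P C)%E) ->
  adp G g -> (forall x, 0 <= g x) ->
  (\int[P]_(x in C) (g x)%:E = P C * \int[P]_x (g x)%:E)%E.
Proof.
move=> Gm mC ind ag g0; have PC0 : 0 <= fine (P C) by rewrite fine_ge0.
have mg := adp_mfun Gm ag.
have mid : measurable_fun setT (id : T -> g_sigma_algebraType G).
  by move=> _ A mA; rewrite setTI; exact: sig_meas mA.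
have := @weighted_transfer _ _ _ T T (g_sigma_algebraType G) R P P id id
  (\1_C) (cst (fine (P C))) g mid mid (indic_mfun mC) (measurable_cst _) _ _ _ ag g0.
have -> : (\int[P]_x (g x * \1_C x)%:E = \int[P]_(x in C) (g x)%:E)%E.
  rewrite [RHS]integral_mkcond; apply: eq_integral => x _.
  by rewrite patchE indicE; case: ifP => _; rewrite ?mulr1 ?mulr0.
move=> ->; first last.
- move=> A mA; have mA' := sig_meas Gm mA.
  transitivity (P C * P A)%E; last first.
    rewrite (eq_integral (cst (P C))) ?integral_cst// => x _.
    by rewrite /= fineK// fin_num_measure.
  transitivity (P (A `&` C)); last by rewrite ind// muleC.
  by rewrite integral_indic// setIC.
- by move=> x.
- by move=> x; rewrite indicE.
transitivity (\int[P]_x ((fine (P C))%:E * (g x)%:E))%E.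
  by apply: eq_integral => x _; rewrite EFinM muleC.
rewrite ge0_integralZl//= ?fineK ?fin_num_measure//; first exact/measurable_EFinP.
by move=> x _; rewrite lee_fin.
Qed.

End independence.

Section bandit.
Context {R : realType} {d : measure_display} {T : measurableType d}.
Variables (P : probability T R) (W : finType) (Wt : nat -> T -> W).
Variables (Y : nat -> W -> T -> R) (e : nat -> W -> T -> R).
Hypothesis mW : forall t (a : W), measurable (Wt t @^-1` [set a]).
Hypothesis mY : forall t a, measurable_fun setT (Y t a).
Hypothesis iidY : iid_vectors P Y.
Hypothesis eH : forall t a, is_cond_prob P (hist_sigma Wt Y t) (Wt t @^-1` [set a]) (e t a).
Hypothesis eF : forall t a,
  is_cond_prob P (<<s hist_gen Wt Y t `|` future_gen Y t >>) (Wt t @^-1` [set a]) (e t a).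
Hypothesis e0 : forall t a x, 0 < e t a x.

Local Notation H := (hist_gen Wt Y).
Local Notation F := (future_gen Y).
Local Notation V := (vec_gen Y).

Let mYB t a (B : set R) : measurable B -> measurable (Y t a @^-1` B).
Proof. by move=> mB; rewrite -[X in measurable X]setTI; exact: mY. Qed.

Let armE t (A : set T) : A = \bigcup_(a in [set: W]) (A `&` Wt t @^-1` [set a]).
Proof.
by rewrite -setI_bigcupr -preimage_bigcup (_ : \bigcup_(_ in _) _ = setT) ?preimage_setT ?setIT//;
  apply/seteqP; split => // a _; exists a.
Qed.

Lemma arm_sum t (A : set T) : measurable A ->
  (P A = \sum_(a \in [set: W]) P (A `&` Wt t @^-1` [set a]))%E.
Proof.
move=> mA; rewrite [in LHS](armE t A) measure_fin_bigcup//.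
- exact: finite_finset.
- by move=> a b _ _ [x [[_ /= <-] [_ /= <-]]].
- by move=> a _; exact: measurableI.
Qed.

Lemma measurable_observed s (B : set R) : measurable B ->
  measurable ((fun x => Y s (Wt s x) x) @^-1` B).
Proof.
move=> mB; rewrite (armE s ((fun x => Y s (Wt s x) x) @^-1` B)); apply: fin_bigcup_measurable => [|a _]; first exact: finite_finset.
have -> : (fun x => Y s (Wt s x) x) @^-1` B `&` Wt s @^-1` [set a] =
    Y s a @^-1` B `&` Wt s @^-1` [set a].
  by apply/seteqP; split => x [/= xB xa]; split => //=; move: xB; rewrite xa.
by apply: measurableI => //; exact: mYB.
Qed.

Lemma hist_meas t : H t `<=` d.-measurable.
Proof.
move=> A [s _ [[a ->]|[B mB ->]]]; first exact: mW.
exact: measurable_observed.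
Qed.

Lemma vec_meas t : V t `<=` d.-measurable.
Proof. by move=> A [a [B mB ->]]; exact: mYB. Qed.

(** Intersections rather than unions of generators: the family is closed under intersection, as
    [indep_ext] requires, and generates the past together with the current outcome vector. *)
Let hist_vec t : set_system T := [set A `&` B | A in <<s H t>> & B in <<s V t>>].

Let cyl (S : seq nat) (A : nat -> set T) := \bigcap_(s in [set` S]) A s.

Let cyl_meas S A : (forall s, s \in S -> <<s V s>> (A s)) -> measurable (cyl S A).
Proof.
move=> SA; apply: bigcap_measurableType.
by move=> s sS; apply: (sig_meas (@vec_meas s)); exact: SA.
Qed.

Lemma hist_mono t : H t `<=` H t.+1.
Proof. by move=> A [s st h]; exists s => //; exact: ltnW. Qed.

(* On the event [Wt t = a] the outcome observed at time [t] is [Y t a], so every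
   event of the next history coincides there with one of [H t] and [Y t]. *)
Lemma hist_trace t (E : set T) (a : W) : <<s H t.+1>> E ->
  exists2 E', <<s hist_vec t>> E' &
    E `&` Wt t @^-1` [set a] = E' `&` Wt t @^-1` [set a].
Proof.
pose D : set_system T := [set E | exists2 E', <<s hist_vec t>> E' &
    E `&` Wt t @^-1` [set a] = E' `&` Wt t @^-1` [set a]].
suff : <<s H t.+1>> `<=` D by move=> h /h.
have hs : H t `<=` <<s hist_vec t>>.
  move=> A HA; apply: sub_sigma_algebra; exists A; first exact: sub_sigma_algebra.
  by exists setT; [exact: sigT|rewrite setIT].
apply: smallest_sub.
- split.
  + by exists set0 => //; exact: sigma_algebra0.
  + move=> A [A' HA' AA']; exists (~` A'); first exact: sigma_algebraC.
    rewrite setTD; apply/seteqP; split => x [/= nA xa]; split => // xA; apply: nA.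
      by have : (A' `&` Wt t @^-1` [set a]) x by []; rewrite -AA' => -[].
    by have : (A `&` Wt t @^-1` [set a]) x by []; rewrite AA' => -[].
  + move=> A DA; have {DA} DA n : exists E', <<s hist_vec t>> E' /\
        A n `&` Wt t @^-1` [set a] = E' `&` Wt t @^-1` [set a].
      by have [E' h1 h2] := DA n; exists E'.
    have [A' hA'] := choice DA.
    exists (\bigcup_k A' k); first by apply: sigma_algebra_bigcup => i; case: (hA' i).
    by rewrite !setI_bigcupl; apply: eq_bigcupr => i _; case: (hA' i).
- move=> A [s]; rewrite ltnS leq_eqVlt => /predU1P[->|st] h; last first.
    by exists A => //; apply: hs; exists s.
  rewrite /D/=; case: h => [[b ->]|[B mB ->]].
    have [->|ab] := eqVneq a b.
      by exists setT; [exact: sigT|rewrite setTI setIid].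
    exists set0; first exact: sigma_algebra0.
    rewrite set0I; apply/seteqP; split => // x [/= xb xa].
    by move: ab; rewrite -xa -xb eqxx.
  exists (Y t a @^-1` B).
    apply: sub_sigma_algebra; exists setT; first exact: sigT.
    exists (Y t a @^-1` B); last by rewrite setTI.
    by apply: sub_sigma_algebra; exists a; exists B.
  by apply/seteqP; split => x [/=] + xa; rewrite xa.
Qed.

Lemma cyl_cons t (B : set T) S A : t \notin S ->
  B `&` cyl S A = cyl (t :: S) (fun s => if s == t then B else A s).
Proof.
move=> tS; apply/seteqP; split => [x [xB xA] s /=|x xA].
  rewrite inE; case: eqVneq => [_|_]/= sS //; exact: xA.
split; first by have := xA t; rewrite /= inE eqxx; exact.
move=> s /= sS; have := xA s; rewrite /= inE sS orbT => /(_ isT).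
by case: eqVneq sS tS => // -> ->.
Qed.

(** Arms depend on past outcomes, so independence of history and future must be derived, by
    induction on [t]. Cylinders over several times are needed: passing to [t.+1] moves [Y t] from
    the cylinder into the history. *)
Lemma hist_indep t (E : set T) S A : <<s H t>> E -> uniq S ->
  (forall s, s \in S -> (t <= s)%N) -> (forall s, s \in S -> <<s V s>> (A s)) ->
  (P (E `&` cyl S A) = P E * P (cyl S A))%E.
Proof.
elim: t E S A => [|t IH] E S A HE uS tS SA; have mC := cyl_meas SA.
  apply: (@indep_ext _ _ _ P [set setT]) => //.
  - by move=> _ ->.
  - by move=> _ _ -> ->; rewrite setIT.
  - by move=> _ ->; rewrite setTI probability_setT mul1e.
  - by apply: sub_sigma_algebra2 HE => B [].
set C := cyl S A in mC *.
have tnS : t \notin S by apply/negP => /tS; rewrite ltnn.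
have tS' s : s \in S -> (t <= s)%N by move/tS/ltnW.
have hvm : hist_vec t `<=` d.-measurable.
  move=> _ [A1 HA1] [B1 VB1 <-]; apply: measurableI.
    exact: (sig_meas (@hist_meas t)).
  exact: (sig_meas (@vec_meas t)).
(* The induction hypothesis for [t :: S] separates the old history from [Y t] and [C] jointly, and
   independence of the vectors separates [Y t] from [C]. *)
have ind B : <<s hist_vec t>> B -> (P (B `&` C) = P B * P C)%E.
  apply: indep_ext => //.
  - move=> _ _ [A1 HA1] [B1 VB1 <-] [A2 HA2] [B2 VB2 <-].
    exists (A1 `&` A2); first exact: sigI.
    by exists (B1 `&` B2); [exact: sigI|rewrite setIACA].
  - exists setT; first exact: sigT.
    by exists setT; [exact: sigT|rewrite setIT].
  move=> _ [A1 HA1] [B1 VB1 <-].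
  have VB s : s \in t :: S -> <<s V s>> (if s == t then B1 else A s).
    by rewrite inE; case: eqVneq => [->//|_]/=; exact: SA.
  have uS' : uniq (t :: S) by rewrite /= tnS.
  have tS'' s : s \in t :: S -> (t <= s)%N.
    by rewrite inE => /predU1P[->//|]; exact: tS'.
  rewrite -setIA /C (cyl_cons _ _ tnS) (IH _ _ _ HA1 uS' tS'' VB).
  have -> : P (cyl (t :: S) (fun s => if s == t then B1 else A s)) = (P B1 * P C)%E.
    case: iidY => prodY _; rewrite /C /cyl (prodY _ uS' _ VB) (prodY _ uS _ SA).
    rewrite big_cons eqxx; congr (_ * _)%E; apply: eq_big_seq => s sS.
    by case: eqVneq sS tnS => // -> ->.
  rewrite muleA; congr (_ * _)%E.
  have VB1' s : s \in [:: t] -> <<s V s>> (if s == t then B1 else setT).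
    by rewrite inE => /eqP ->; rewrite eqxx.
  have := IH A1 [:: t] (fun s => if s == t then B1 else setT) HA1 isT _ VB1'.
  have -> : cyl [:: t] (fun s => if s == t then B1 else setT) = B1.
    apply/seteqP; split => [x /(_ t)|x xB s] /=; first by rewrite inE eqxx; exact.
    by rewrite inE => /eqP ->; rewrite eqxx.
  by move=> -> // s; rewrite inE => /eqP ->.
have CF : <<s F t>> C.
  rewrite /C /cyl; apply: (@bigcap_measurableType _ (g_sigma_algebraType (F t))).
  move=> s sS; have VF : V s `<=` <<s F t>>.
    move=> B [a [B' mB' ->]]; apply: sub_sigma_algebra.
    by exists s, a; split; [exact: tS'|exists B'].
  exact: (sig_mono VF (SA s sS)).
(* Given past and future the arm has probability [e t a], which depends on the history only; its
   integral over [B] and [C] therefore factors out [P C]. *)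
have armC B a : <<s hist_vec t>> B ->
    (P (B `&` C `&` Wt t @^-1` [set a]) = P (B `&` Wt t @^-1` [set a]) * P C)%E.
  move=> HB; have [me1 Ee] := eF t a.
  have hvF : <<s hist_vec t>> `<=` <<s H t `|` F t>>.
    apply: sig_mono => _ [A1 HA1] [B1 VB1 <-]; apply: sigI.
      by apply: sub_sigma_algebra2 HA1 => D; left.
    apply: sig_mono VB1 => D [b [B' mB' ->]]; apply: sub_sigma_algebra; right.
    by exists t, b; split => //; exists B'.
  have mB : measurable B by exact: (sig_meas hvm).
  have HF : <<s H t `|` F t>> C by apply: sub_sigma_algebra2 CF => D; right.
  rewrite (Ee _ (sigI (hvF _ HB) HF)) (Ee _ (hvF _ HB)).
  have ae : adp (hist_vec t) (e t a).
    apply/adp_wrt => D mD; have [me _] := eH t a.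
    have := me D mD; apply: sig_mono => A1 HA1; apply: sub_sigma_algebra.
    exists A1; first exact: sub_sigma_algebra.
    by exists setT; [exact: sigT|rewrite setIT].
  have aeB : adp (hist_vec t) (fun x => e t a x * \1_B x).
    by apply: adpM => //; exact: (@measurable_indic _ (g_sigma_algebraType (hist_vec t))).
  have := indep_integral hvm mC ind aeB.
  have -> : (\int[P]_(x in C) (e t a x * \1_B x)%:E = \int[P]_(x in B `&` C) (e t a x)%:E)%E.
    rewrite setIC integral_mkcondr; apply: eq_integral => x _.
    by rewrite patchE indicE; case: ifP => _; rewrite ?mulr1 ?mulr0.
  have -> : (\int[P]_x (e t a x * \1_B x)%:E = \int[P]_(x in B) (e t a x)%:E)%E.
    rewrite [RHS]integral_mkcond; apply: eq_integral => x _.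
    by rewrite patchE indicE; case: ifP => _; rewrite ?mulr1 ?mulr0.
  move=> ->; first by rewrite muleC.
  by move=> x; rewrite mulr_ge0// ?ltW// indicE.
have mE : measurable E by exact: (sig_meas (@hist_meas t.+1)).
(* Summation over the finitely many arms, on each of which [E] coincides with an event generated by
   [hist_vec t]. *)
rewrite (arm_sum t (measurableI _ _ mE mC)) (arm_sum t mE).
rewrite ge0_mule_fsuml//; apply: eq_fsbigr => a _.
have [E' HE' EE'] := hist_trace a HE.
by rewrite setIAC EE' setIAC armC.
Qed.

Lemma hist_indep1 t a (E : set T) (B : set R) : <<s H t>> E -> measurable B ->
  (P (E `&` Y t a @^-1` B) = P E * P (Y t a @^-1` B))%E.
Proof.
move=> HE mB; have VB s : s \in [:: t] -> <<s V s>> (Y s a @^-1` B).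
  by move=> _; apply: sub_sigma_algebra; exists a; exists B.
have := hist_indep HE (isT : uniq [:: t]) _ VB.
have -> : cyl [:: t] (fun s => Y s a @^-1` B) = Y t a @^-1` B.
  apply/seteqP; split => [x /(_ t)/=|x xB s /=]; first by rewrite inE eqxx; exact.
  by rewrite inE => /eqP ->.
by apply => s; rewrite inE => /eqP ->.
Qed.

Lemma outcome_id t a (B : set R) : measurable B -> P (Y t a @^-1` B) = P (Y 0%N a @^-1` B).
Proof.
move=> mB; pose B' b := if b == a then B else setT.
have mB' b : measurable (B' b) by rewrite /B'; case: ifP.
have E s : \bigcap_(b in [set: W]) (Y s b @^-1` B' b) = Y s a @^-1` B.
  apply/seteqP; split => [x /(_ a I)|x xB b _]; rewrite /B' ?eqxx//.
  by case: eqVneq => // ->.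
by case: iidY => _ /(_ t B' mB'); rewrite !E.
Qed.

Lemma outcome_integral t a (phi : R -> R) : measurable_fun setT phi ->
  (forall y, 0 <= phi y) ->
  (\int[P]_x (phi (Y t a x))%:E = \int[P]_x (phi (Y 0%N a x))%:E)%E.
Proof.
move=> mphi phi0.
transitivity (\int[P]_x (phi (Y t a x) * cst 1 x)%:E)%E.
  by apply: eq_integral => x _; rewrite mulr1.
transitivity (\int[P]_x (phi (Y 0%N a x) * cst 1 x)%:E)%E; last first.
  by apply: eq_integral => x _; rewrite mulr1.
apply: weighted_transfer => // A mA.
rewrite !(eq_integral (cst 1%E))// !integral_cst ?mul1e; [exact: outcome_id|exact: mYB..].
Qed.

Variables (t : nat) (w : W).

Let drawn x : R := (Wt t x == w)%:R.

Let drawnE x : drawn x = \1_(Wt t @^-1` [set w]) x.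
Proof.
rewrite /drawn indicE; congr (_%:R); congr nat_of_bool; apply/idP/idP.
  by move=> /eqP xw; rewrite inE.
by rewrite inE => /= ->.
Qed.

Let mdrawn : measurable_fun setT drawn.
Proof.
by rewrite (_ : drawn = \1_(Wt t @^-1` [set w])); [exact: indic_mfun|exact/funext].
Qed.

Let me : measurable_fun setT (e t w).
Proof.
by case: (eH t w) => he _; apply: (adp_mfun (@hist_meas t)); apply/adp_wrt.
Qed.

Let ade : adp (H t) (e t w).
Proof. by case: (eH t w) => he _; apply/adp_wrt. Qed.

(** The conditional probability given history and future is integrated over an event of both;
    independence of [Y t w] from the history then pulls out its law. *)
Let cond_event A (B : set R) : <<s H t>> A -> measurable B ->
  (P (A `&` Y t w @^-1` B `&` Wt t @^-1` [set w]) =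
   P (Y t w @^-1` B) * \int[P]_(x in A) (e t w x)%:E)%E.
Proof.
move=> HA mB; have [_ Ee] := eF t w.
rewrite Ee; last first.
  apply: sigI; first by apply: sub_sigma_algebra2 HA => D; left.
  apply: sub_sigma_algebra; right; exists t, w; split => //; by exists B.
have mA : measurable A by exact: (sig_meas (@hist_meas t)).
have ind A' : <<s H t>> A' -> (P (A' `&` Y t w @^-1` B) = P A' * P (Y t w @^-1` B))%E.
  by move=> HA'; exact: hist_indep1.
have aeA : adp (H t) (fun x => e t w x * \1_A x).
  by apply: adpM => //; exact: (@measurable_indic _ (g_sigma_algebraType (H t))).
have := indep_integral (@hist_meas t) (mYB t w mB) ind aeA.
have -> : (\int[P]_(x in Y t w @^-1` B) (e t w x * \1_A x)%:E =
    \int[P]_(x in A `&` Y t w @^-1` B) (e t w x)%:E)%E.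
  rewrite setIC integral_mkcondr; apply: eq_integral => x _.
  by rewrite patchE indicE; case: ifP => _; rewrite ?mulr1 ?mulr0.
have -> : (\int[P]_x (e t w x * \1_A x)%:E = \int[P]_(x in A) (e t w x)%:E)%E.
  rewrite [RHS]integral_mkcond; apply: eq_integral => x _.
  by rewrite patchE indicE; case: ifP => _; rewrite ?mulr1 ?mulr0.
by apply => x; rewrite mulr_ge0// ?ltW// indicE.
Qed.

Let int_e_fin A : <<s H t>> A -> (\int[P]_(x in A) (e t w x)%:E)%E \is a fin_num.
Proof.
move=> HA; have [_ Ee] := eH t w; rewrite -Ee//; apply: fin_num_measure.
by apply: measurableI => //; exact: (sig_meas (@hist_meas t)).
Qed.

(** Renders [E[1{W_t = w} phi(Y_t(w)) | H] = e_t E phi(Y)] by integrals alone. Two transfers reduce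
    it to sets, first for [K] over history events, then for [phi] over outcome events. *)
Lemma product_formula_ge0 (K : T -> R) (phi : R -> R) :
  adp (H t) K -> (forall x, 0 <= K x) -> measurable_fun setT phi ->
  (forall y, 0 <= phi y) -> intg P (fun x => phi (Y 0%N w x)) ->
  (\int[P]_x (K x * (drawn x * phi (Y t w x)))%:E =
   \int[P]_x (K x * (e t w x * \int[P]_x phi (Y 0%N w x)))%:E)%E.
Proof.
move=> aK K0 mphi phi0 Iphi; set c := \int[P]_x phi (Y 0%N w x).
have c0 : 0 <= c by apply: Rintegral_ge0 => x _; exact: phi0.
have cE : (\int[P]_x (phi (Y t w x))%:E)%E = c%:E.
  by rewrite (outcome_integral t w)// (intgE Iphi).
have mid : measurable_fun setT (id : T -> g_sigma_algebraType (H t)).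
  by move=> _ A mA; rewrite setTI; exact: (sig_meas (@hist_meas t) mA).
have mphiY : measurable_fun setT (fun x => phi (Y t w x)) by exact: measurableT_comp.
have e00 x : 0 <= e t w x by exact: ltW.
apply: (@weighted_transfer _ _ _ T T (g_sigma_algebraType (H t)) R P P id id
  (fun x => drawn x * phi (Y t w x)) (fun x => e t w x * c) K) => //.
- exact: measurable_funM.
- exact: measurable_funM.
- by move=> x; rewrite mulr_ge0.
- by move=> x; rewrite mulr_ge0.
move=> A HA; have mA : d.-measurable (A : set T) by exact: (sig_meas (@hist_meas t) HA).
set p := fine (\int[P]_(x in A) (e t w x)%:E).
have p0 : 0 <= p by apply: fine_ge0; apply: integral_ge0 => x _; rewrite lee_fin.
transitivity (c%:E * p%:E)%E; last first.
  rewrite [RHS](_ : _ = \int[P]_(x in A) (c%:E * (e t w x)%:E))%E; last first.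
    by apply: eq_integral => x _; rewrite EFinM muleC.
  rewrite ge0_integralZl//; last 2 first.
  - by apply/measurable_EFinP; apply: measurable_funTS.
  - by move=> x _; rewrite lee_fin.
  by rewrite /p fineK// int_e_fin.
rewrite -cE -ge0_integralZr//; last 2 first.
- exact/measurable_EFinP.
- by move=> x _; rewrite lee_fin.
transitivity (\int[P]_x (phi (Y t w x) * cst p x)%:E)%E; last first.
  by apply: eq_integral => x _; rewrite -EFinM.
transitivity (\int[P]_x (phi (Y t w x) * (\1_A x * drawn x))%:E)%E.
  rewrite [LHS]integral_mkcond; apply: eq_integral => x _.
  rewrite patchE indicE; case: ifP => _; rewrite ?mul0r ?mulr0//=.
  by rewrite mul1r mulrC.
apply: weighted_transfer => //.
- by apply: measurable_funM => //; exact: indic_mfun.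
- by move=> x; rewrite mulr_ge0// indicE.
move=> B mB.
transitivity (P (A `&` Y t w @^-1` B `&` Wt t @^-1` [set w])).
  rewrite (_ : A `&` _ `&` _ = A `&` Wt t @^-1` [set w] `&` Y t w @^-1` B); last first.
    by rewrite setIAC.
  rewrite -integral_indic//; last 2 first.
  - exact: mYB.
  - exact: measurableI.
  apply: eq_integral => x _; rewrite drawnE !indicE in_setI.
  by case: (x \in A); case: (x \in _); rewrite ?mulr1 ?mulr0.
rewrite cond_event//.
transitivity (\int[P]_(x in Y t w @^-1` B) (cst (p%:E) x))%E; last by [].
rewrite integral_cst; last exact: mYB.
by rewrite muleC /p fineK// int_e_fin.
Qed.

(** Integrability is asked of [K * e t w] instead of [K], which admits multipliers containing the
    inverse propensity. *)
Lemma product_formula (K : T -> R) (phi : R -> R) :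
  adp (H t) K -> intg P (fun x => K x * e t w x) -> measurable_fun setT phi ->
  intg P (fun x => phi (Y 0%N w x)) ->
  intg P (fun x => K x * ((Wt t x == w)%:R * phi (Y t w x))) /\
  \int[P]_x (K x * ((Wt t x == w)%:R * phi (Y t w x))) =
  \int[P]_x (K x * e t w x) * \int[P]_x phi (Y 0%N w x).
Proof.
move=> aK IKe mphi Iphi.
pose pos (f : T -> R) x := Num.max (f x) 0.
pose ppos (f : R -> R) x := Num.max (f x) 0.
have maxE (u : R) : u = Num.max u 0 - Num.max (- u) 0.
  have [h|h] := leP 0 u; first by rewrite max_r ?oppr_le0// subr0.
  by rewrite max_l ?oppr_ge0 ?(ltW h)// sub0r opprK.
have max0 (u : R) : 0 <= Num.max u 0 by rewrite le_max lexx orbT.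
have maxN (u : R) : `|Num.max u 0| <= `|u|.
  by have [h|h] := leP 0 u; rewrite ?normr0.
have mmax : measurable_fun setT (fun u : R => Num.max u 0).
  by apply: measurable_maxr => //; exact: measurable_cst.
(* all four sign combinations reduce to the nonnegative case *)
have ge0 (K' : T -> R) (phi' : R -> R) : adp (H t) K' -> (forall x, 0 <= K' x) ->
    measurable_fun setT phi' -> (forall y, 0 <= phi' y) ->
    intg P (fun x => K' x * e t w x) -> intg P (fun x => phi' (Y 0%N w x)) ->
    intg P (fun x => K' x * ((Wt t x == w)%:R * phi' (Y t w x))) /\
    \int[P]_x (K' x * ((Wt t x == w)%:R * phi' (Y t w x))) =
    \int[P]_x (K' x * e t w x) * \int[P]_x phi' (Y 0%N w x).
  move=> aK' K'0 mphi' phi'0 IK' Iphi'.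
  have mK' := adp_mfun (@hist_meas t) aK'.
  have E := product_formula_ge0 aK' K'0 mphi' phi'0 Iphi'.
  set c := \int[P]_x phi' (Y 0%N w x).
  have IKc : intg P (fun x => c * (K' x * e t w x)) by exact: intgZ.
  have E2 : (\int[P]_x (K' x * ((Wt t x == w)%:R * phi' (Y t w x)))%:E =
      (\int[P]_x (c * (K' x * e t w x)))%:E)%E.
    rewrite -(intgE IKc) [LHS]E; apply: eq_integral => x _.
    by rewrite -/c; congr (_%:E); ring.
  split.
    apply: intg_ge0; last by rewrite E2 ltry.
      apply: measurable_funM => //; apply: measurable_funM => //.
      exact: measurableT_comp.
    by move=> x; rewrite !mulr_ge0//; case: eqP.
  by rewrite {1}/Rintegral E2 /= EZ// mulrC.
have ade_pos (f : T -> R) : adp (H t) f -> adp (H t) (pos f) by move=> af; exact: (adp_comp mmax af).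
have mpos (f : R -> R) : measurable_fun setT f -> measurable_fun setT (ppos f).
  by move=> mf; exact: (measurableT_comp mmax mf).
have IKpos (f : T -> R) : adp (H t) f -> intg P (fun x => f x * e t w x) ->
    intg P (fun x => pos f x * e t w x).
  move=> af If; apply: (intg_le _ If) => [|x].
    by apply: measurable_funM => //; exact: (adp_mfun (@hist_meas t) (ade_pos _ af)).
  by rewrite !normrM ler_wpM2r// maxN.
have Ippos (f : R -> R) : measurable_fun setT f -> intg P (fun x => f (Y 0%N w x)) ->
    intg P (fun x => ppos f (Y 0%N w x)).
  move=> mf If; apply: (intg_le _ If) => [|x]; last exact: maxN.
  by apply: measurableT_comp; [exact: mpos|exact: mY].
pose Kn x := - K x; pose phin y := - phi y.
have aKn : adp (H t) Kn.
  by apply: (@adp_comp _ _ _ _ K (fun y => - y)) => //; exact: measurable_funN.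
have mphin : measurable_fun setT phin by exact: measurable_funN.
have IKn : intg P (fun x => Kn x * e t w x).
  have := intgZ (-1) IKe; under eq_fun do rewrite mulN1r -mulNr; exact.
have Iphin : intg P (fun x => phin (Y 0%N w x)).
  by have := intgZ (-1) Iphi; under eq_fun do rewrite mulN1r.
have [I1 E1] := ge0 (pos K) (ppos phi) (ade_pos _ aK) (fun x => max0 _) (mpos _ mphi)
  (fun x => max0 _) (IKpos _ aK IKe) (Ippos _ mphi Iphi).
have [I2 E2] := ge0 (pos K) (ppos phin) (ade_pos _ aK) (fun x => max0 _) (mpos _ mphin)
  (fun x => max0 _) (IKpos _ aK IKe) (Ippos _ mphin Iphin).
have [I3 E3] := ge0 (pos Kn) (ppos phi) (ade_pos _ aKn) (fun x => max0 _) (mpos _ mphi)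
  (fun x => max0 _) (IKpos _ aKn IKn) (Ippos _ mphi Iphi).
have [I4 E4] := ge0 (pos Kn) (ppos phin) (ade_pos _ aKn) (fun x => max0 _) (mpos _ mphin)
  (fun x => max0 _) (IKpos _ aKn IKn) (Ippos _ mphin Iphin).
have -> : (fun x => K x * ((Wt t x == w)%:R * phi (Y t w x))) = (fun x =>
    (pos K x * ((Wt t x == w)%:R * ppos phi (Y t w x)) -
     pos K x * ((Wt t x == w)%:R * ppos phin (Y t w x))) -
    (pos Kn x * ((Wt t x == w)%:R * ppos phi (Y t w x)) -
     pos Kn x * ((Wt t x == w)%:R * ppos phin (Y t w x)))).
  apply/funext => x; rewrite {1}(maxE (K x)) {1}(maxE (phi _)).
  by rewrite /pos /ppos /Kn /phin; ring.
have -> : (fun x => K x * e t w x) =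
    (fun x => pos K x * e t w x - pos Kn x * e t w x).
  by apply/funext => x; rewrite {1}(maxE (K x)) /pos /Kn; ring.
have -> : (fun x => phi (Y 0%N w x)) =
    (fun x => ppos phi (Y 0%N w x) - ppos phin (Y 0%N w x)).
  by apply/funext => x; rewrite {1}(maxE (phi _)).
have J12 := intgB I1 I2; have J34 := intgB I3 I4.
have JK := IKpos _ aK IKe; have JKn := IKpos _ aKn IKn.
have Jp := Ippos _ mphi Iphi; have Jpn := Ippos _ mphin Iphin.
split; first exact: intgB.
by rewrite (EB J12 J34) (EB I1 I2) (EB I3 I4) (EB JK JKn) (EB Jp Jpn) E1 E2 E3 E4; ring.
Qed.

End bandit.

(** * The stopped array of AIPW increments *)

Section stopped.
Context {R : realType}.

(** An open gate at [n] certifies the whole partial sum through [n], which dominates the gated one;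
    a closed gate adds nothing. The gate need not be monotone in time. *)
Lemma stopped_sum_le (n : nat) (a J : nat -> R) (B : R) : 0 <= B ->
  (forall t, 0 <= a t) -> (forall t, J t = 0 \/ J t = 1 /\ \sum_(j < t.+1) a j <= B) ->
  \sum_(t < n) J t * a t <= B.
Proof.
move=> B0 a0 HJ; elim: n => [|n IH]; first by rewrite big_ord0.
rewrite big_ord_recr/=; case: (HJ n) => [->|[-> sB]].
  by rewrite mul0r addr0.
apply: le_trans sB; rewrite big_ord_recr/= mul1r lerD2r; apply: ler_sum => i _.
by case: (HJ i) => [->|[-> _]]; rewrite ?mul0r ?mul1r.
Qed.

Lemma powR_add_le (x y q : R) : 0 <= x -> 0 <= y -> 0 <= q ->
  (x + y) `^ q <= 2 `^ q * (x `^ q + y `^ q).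
Proof.
move=> x0 y0 q0; wlog xy : x y x0 y0 / x <= y.
  move=> h; have [|/ltW] := leP x y; first exact: h.
  by move=> yx; rewrite addrC [X in _ * X]addrC; exact: h.
apply: (@le_trans _ _ ((2 * y) `^ q)).
  by apply: ge0_ler_powR; rewrite ?nnegrE ?addr_ge0 ?mulr_ge0//; lra.
by rewrite powRM// ler_wpM2l ?powR_ge0// lerDr powR_ge0.
Qed.

End stopped.

Section aipw_array.
Context {d : measure_display} {T : measurableType d} {R : realType}.
Variables (P : probability T R) (G : nat -> set_system T).
Variables (I y ee m : nat -> T -> R) (Q M s2 q : R).
Hypothesis Gm : forall k, G k `<=` d.-measurable.
Hypothesis Gmono : forall k, <<s G k>> `<=` <<s G k.+1>>.
Hypothesis I01 : forall t x, I t x = 0 \/ I t x = 1.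
Hypothesis adI : forall t, adp (G t.+1) (I t).
Hypothesis adIy : forall t, adp (G t.+1) (fun x => I t x * y t x).
Hypothesis adee : forall t, adp (G t) (ee t).
Hypothesis ee0 : forall t x, 0 < ee t x.
Hypothesis ee1 : forall t x, ee t x <= 1.
Hypothesis adm : forall t, adp (G t) (m t).
Hypothesis mM : forall t x, `|m t x| <= M.
Hypothesis my : forall t, measurable_fun setT (y t).
Hypothesis core : forall t (K : T -> R) (phi : R -> R),
  adp (G t) K -> intg P (fun x => K x * ee t x) -> measurable_fun setT phi ->
  intg P (fun x => phi (y 0%N x)) ->
  intg P (fun x => K x * (I t x * phi (y t x))) /\
  \int[P]_x (K x * (I t x * phi (y t x))) =
  \int[P]_x (K x * ee t x) * \int[P]_x phi (y 0%N x).
Hypothesis q23 : 2 <= q <= 3.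
Hypothesis Iyq : intg P (fun x => `|y 0%N x| `^ q).
Hypothesis Ey : \int[P]_x y 0%N x = Q.
Hypothesis Ey2 : \int[P]_x (y 0%N x ^+ 2) = s2 + Q ^+ 2.
Hypothesis s20 : 0 <= s2.

Definition score t x := I t x / ee t x * y t x + (1 - I t x / ee t x) * m t x.

Let B := s2 + (M + `|Q|) ^+ 2.

Let M0 : 0 <= M.
Proof. exact: le_trans (normr_ge0 _) (mM 0 point). Qed.

Let MQ0 : 0 <= M + `|Q|. Proof. by rewrite addr_ge0. Qed.

Let Iy2 : intg P (fun x => y 0%N x ^+ 2).
Proof.
apply: (@intg_le _ _ _ P _ (fun x => 1 + `|y 0%N x| `^ q)).
- exact/measurable_funX/my.
- by apply: intgD => //; exact: intg_cst.
move=> x; rewrite [leRHS]ger0_norm ?addr_ge0 ?powR_ge0// normrX.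
case/andP: q23 => q2 _; have [z1|z1] := leP `|y 0%N x| 1.
  by rewrite (@le_trans _ _ 1)// ?exprn_ile1// lerDl powR_ge0.
by rewrite -powR_mulrn// (@le_trans _ _ (`|y 0%N x| `^ q)) ?lerDr// ler_powR// ltW.
Qed.

Let Iy1 : intg P (y 0%N).
Proof.
apply: (@intg_le _ _ _ P _ (fun x => 1 + y 0%N x ^+ 2)); first exact: my.
  by apply: intgD => //; exact: intg_cst.
move=> x; rewrite [leRHS]ger0_norm ?addr_ge0 ?sqr_ge0//.
rewrite -(real_normK (num_real (y 0%N x))).
by have := sqr_ge0 (`|y 0%N x| - 1); rewrite sqrrB; have := normr_ge0 (y 0%N x); lra.
Qed.

Let Iyq' : intg P (fun x => (`|y 0%N x| + M) `^ q).
Proof.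
apply: (@intg_le _ _ _ P _ (fun x => 2 `^ q * (`|y 0%N x| `^ q + M `^ q))).
- apply: (measurableT_comp (@measurable_powR R q)).
  by apply: measurable_funD => //; apply: measurableT_comp => //; exact: my.
- by apply: intgZ; apply: intgD => //; exact: intg_cst.
move=> x; rewrite [leLHS]ger0_norm ?powR_ge0//.
rewrite [leRHS]ger0_norm ?mulr_ge0 ?addr_ge0 ?powR_ge0//.
by apply: powR_add_le => //; case/andP: q23 => *; lra.
Qed.

Variables (h : nat -> T -> R) (D eta : R).
Hypothesis h0 : forall t x, 0 <= h t x.
Hypothesis adh : forall t, adp (G t) (h t).
Hypothesis D0 : 0 < D.
Hypothesis eta0 : 0 <= eta.

Let c t x := h t x / Num.sqrt D.

Definition awt t x := h t x ^+ 2 / ee t x / D.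
(** With [q = 2 + delta] this is the normalized summand of (iii); up to a constant it bounds the
    conditional [q]-th moment of [incr]. *)
Definition lam t x := c t x `^ q * ee t x `^ (1 - q).

(** The sums include time [t] itself and are still known at time [t], as weights and propensities
    are; an open gate thus also bounds the current term. *)
Let U t x := \sum_(j < t.+1) awt j x.
Let L t x := \sum_(j < t.+1) lam j x.

(* predictable stopping: makes the conditional variances and the Lyapunov sum bounded *)
Definition gate t x : R := (U t x <= 2)%R%:R * (L t x <= eta)%R%:R.

Definition incr t x := c t x * (score t x - Q).
Definition cvar t x := awt t x * (s2 + (1 - ee t x) * (Q - m t x) ^+ 2).

Let c0 t x : 0 <= c t x.
Proof. by rewrite divr_ge0// ltW. Qed.

Let awtE t x : awt t x = c t x ^+ 2 / ee t x.
Proof.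
rewrite /awt /c expr_div_n sqr_sqrtr ?(ltW D0)//; field.
by rewrite !gt_eqF.
Qed.

Let awt_ge0' t x : 0 <= awt t x.
Proof. by rewrite awtE divr_ge0 ?sqr_ge0// ltW. Qed.

Let lam_ge0' t x : 0 <= lam t x.
Proof. by rewrite mulr_ge0 ?powR_ge0. Qed.

Let gate_cases' t x : gate t x = 0 \/ [/\ gate t x = 1, U t x <= 2 & L t x <= eta].
Proof.
rewrite /gate; case: (leP (U t x) 2) => hU; last by left; rewrite mul0r.
by case: (leP (L t x) eta) => hL; [right; rewrite mul1r|left; rewrite mulr0].
Qed.

Let gate_ge0 t x : 0 <= gate t x.
Proof. by case: (gate_cases' t x) => [|[]] ->. Qed.

Let gate_sq t x : gate t x * gate t x = gate t x.
Proof. by case: (gate_cases' t x) => [|[]] ->; rewrite ?mul0r ?mul1r. Qed.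

Let adc t : adp (G t) (c t).
Proof. by apply: adpM => //; exact: adp_cst. Qed.

Let adV t : adp (G t) (fun x => (ee t x)^-1).
Proof. exact: adpV. Qed.

Let adawt t : adp (G t) (awt t).
Proof.
rewrite (_ : awt t = fun x => c t x ^+ 2 * (ee t x)^-1); last exact/funext/awtE.
by apply: adpM => //; exact: adpX.
Qed.

Let adlam t : adp (G t) (lam t).
Proof. by apply: adpM; exact: adp_powR. Qed.

Let adle (k : nat) (f : T -> R) (b : R) : adp (G k) f ->
  adp (G k) (fun x => (f x <= b)%R%:R : R).
Proof.
apply: (adp_comp (phi := fun u => (u <= b)%R%:R)).
rewrite (_ : (fun u => _) = \1_`]-oo, b]%classic); first exact: measurable_indic.
by apply/funext => u; rewrite indicE mem_setE in_itv.
Qed.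

Let ad_up i j (f : T -> R) : (i <= j)%N -> adp (G i) f -> adp (G j) f.
Proof. by move=> ij; apply: adp_sub; exact: Gmono_le. Qed.

Let adp_gate t : adp (G t) (gate t).
Proof.
apply: adpM; apply: adle.
  by apply: (adp_sum (F := awt)) => j jt; exact: ad_up (@adawt j).
by apply: (adp_sum (F := lam)) => j jt; exact: ad_up (@adlam j).
Qed.

Let x' t x := gate t x * incr t x.
Let v' t x := gate t x * cvar t x.
Let l' t x := gate t x * lam t x.

Let gc t x := gate t x * c t x.

Let gawt_le2 t x : gate t x * awt t x <= 2.
Proof.
case: (gate_cases' t x) => [->|[-> hU _]]; first by rewrite mul0r.
rewrite mul1r; apply: le_trans hU; rewrite /U big_ord_recr/= lerDr.
by apply: sumr_ge0 => i _.
Qed.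

Let gc0 t x : 0 <= gc t x. Proof. by rewrite mulr_ge0. Qed.

Let gc2 t x : gc t x ^+ 2 = gate t x * awt t x * ee t x.
Proof.
by rewrite awtE /gc exprMn [gate t x ^+ 2]expr2 gate_sq -[RHS]mulrA divfK// gt_eqF.
Qed.

Let gc_le2 t x : gc t x <= 2.
Proof.
have g2 : gc t x ^+ 2 <= 2.
  rewrite gc2; apply: le_trans (gawt_le2 t x).
  by apply: ler_piMr; [exact: mulr_ge0|exact: ee1].
by have := gc0 t x; nra.
Qed.

Let adgc t : adp (G t) (gc t). Proof. exact: adpM. Qed.

Let score_split t x : score t x - Q =
  I t x * y t x / ee t x - I t x * (m t x / ee t x) + (m t x - Q).
Proof. by rewrite /score; field; rewrite gt_eqF. Qed.

Lemma adp_incr t : adp (G t.+1) (incr t).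
Proof.
have up (f : T -> R) : adp (G t) f -> adp (G t.+1) f by exact: ad_up.
rewrite (_ : incr t = fun x => c t x * (I t x * y t x * (ee t x)^-1 -
    I t x * (m t x * (ee t x)^-1) + (m t x - Q))); last first.
  by apply/funext => x; rewrite /incr score_split.
apply: adpM; first exact: (up _ (@adc t)).
apply: adpD; last by apply: adpB; [exact: (up _ (@adm t))|exact: adp_cst].
apply: adpB.
  by apply: adpM; [exact: adIy|exact: (up _ (@adV t))].
apply: adpM; first exact: adI.
by apply: adpM; [exact: (up _ (@adm t))|exact: (up _ (@adV t))].
Qed.

Let adp_gincr' t : adp (G t.+1) (x' t).
Proof. by apply: adpM; [exact: ad_up (@adp_gate t)|exact: adp_incr]. Qed.

Let Qm_le t x : (Q - m t x) ^+ 2 <= (M + `|Q|) ^+ 2.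
Proof.
rewrite -(real_normK (num_real (Q - m t x))) ler_pXn2r ?nnegrE//.
by apply: le_trans (ler_normB _ _) _; rewrite addrC lerD2r.
Qed.

Let cvar_factor_bnd' t x : 0 <= s2 + (1 - ee t x) * (Q - m t x) ^+ 2 <= B.
Proof.
have e1 := ee1 t x; have e0 := ee0 t x; have qm := Qm_le t x.
have qm0 := sqr_ge0 (Q - m t x); rewrite /B.
move: qm qm0; set Z := (Q - m t x) ^+ 2; set N := (M + `|Q|) ^+ 2 => qm qm0.
have w0 : 0 <= 1 - ee t x by lra.
have w1 : 1 - ee t x <= 1 by lra.
have := mulr_ge0 w0 qm0; have := ler_piMl qm0 w1.
by move=> p1 p2; rewrite addr_ge0//= lerD2l (le_trans p1).
Qed.

Let B0 : 0 <= B. Proof. by rewrite addr_ge0// sqr_ge0. Qed.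

Let gcvar_ge0' t x : 0 <= v' t x.
Proof.
by apply: mulr_ge0 => //; apply: mulr_ge0 => //; case/andP: (cvar_factor_bnd' t x).
Qed.

Let sum_gawt n x : \sum_(t < n) gate t x * awt t x <= 2.
Proof.
apply: (@stopped_sum_le R n (awt^~ x) (gate^~ x)) => // t.
by case: (gate_cases' t x) => [|[-> hU _]]; [left|right].
Qed.

Lemma sum_glam n x : \sum_(t < n) gate t x * lam t x <= eta.
Proof.
apply: (@stopped_sum_le R n (lam^~ x) (gate^~ x)) => // t.
by case: (gate_cases' t x) => [|[-> _ hL]]; [left|right].
Qed.

Let sum_gcvar' n x : \sum_(t < n) v' t x <= 2 * B.
Proof.
apply: (@le_trans _ _ (\sum_(t < n) gate t x * awt t x * B)); last first.
  by rewrite -mulr_suml ler_wpM2r.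
apply: ler_sum => t _; rewrite /v' /cvar mulrA; apply: ler_wpM2l.
  by apply: mulr_ge0.
by case/andP: (cvar_factor_bnd' t x).
Qed.

Let adp_gcvar' t : adp (G t) (v' t).
Proof.
apply: adpM => //; apply: adpM => //; apply: adpD; first exact: adp_cst.
apply: adpM; first by apply: adpB => //; exact: adp_cst.
by apply: adpX; apply: adpB => //; exact: adp_cst.
Qed.

Let mfun t (f : T -> R) : adp (G t) f -> measurable_fun setT f.
Proof. exact: adp_mfun (@Gm t). Qed.

Let Il' t : intg P (l' t).
Proof.
apply: (intg_bnd (M := eta)); first by apply: mfun; exact: adpM.
move=> x; rewrite ger0_norm; last by apply: mulr_ge0.
apply: le_trans (sum_glam t.+1 x); rewrite big_ord_recr/= lerDr.
by apply: sumr_ge0 => i _; apply: mulr_ge0.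
Qed.

(** From [ee <= 1] and [1 - q <= - (q / 2)]. Through this bound the Lyapunov sum controls every
    single normalized weight. *)
Let awt_le_lam' t x : awt t x `^ (q / 2) <= lam t x.
Proof.
case/andP: q23 => q2 q3; have e0 := ee0 t x; have e1 := ee1 t x.
rewrite awtE /lam powRM ?sqr_ge0 ?invr_ge0 ?(ltW e0)//.
rewrite -powR_mulrn// -powRrM (_ : 2%:R * (q / 2) = q); last by field.
rewrite ler_wpM2l ?powR_ge0//.
rewrite -powR_inv1 ?(ltW e0)// -powRrM; apply: ger_powR; first by rewrite e0.
by lra.
Qed.

(** Charges the second-order compensation error to the Lyapunov sum: under an open gate [awt <= 2],
    so its square is at most a constant times its power [q / 2]. *)
Let gcvar_sq_le t x : v' t x ^+ 2 <= 4 * B ^+ 2 * l' t x.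
Proof.
case/andP: q23 => q2 q3.
rewrite /v' /l' /cvar; case: (gate_cases' t x) => [->|[g1 _ _]].
  by rewrite !mul0r expr0n/= mulr0.
have a2 := gawt_le2 t x; rewrite g1 !mul1r in a2 *.
have /andP[b0 bB] := cvar_factor_bnd' t x.
rewrite exprMn [leRHS](_ : _ = 4 * lam t x * B ^+ 2); last by ring.
apply: ler_pM; rewrite ?sqr_ge0//; last by rewrite ler_pXn2r ?nnegrE.
apply: le_trans (_ : 4 * awt t x `^ (q / 2) <= _); last by rewrite ler_wpM2l.
have [->|an0] := eqVneq (awt t x) 0; first by rewrite expr0n/= mulr_ge0 ?powR_ge0.
have -> : awt t x ^+ 2 = awt t x `^ (2 - q / 2) * awt t x `^ (q / 2).
  by rewrite -powRD ?an0 ?implybT// subrK powR_mulrn.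
rewrite ler_wpM2r ?powR_ge0//.
apply: (@le_trans _ _ (2 `^ (2 - q / 2))).
  by apply: ge0_ler_powR; rewrite ?nnegrE//; lra.
have -> : (4 : R) = 2 `^ 2%:R by rewrite powR_mulrn// -natrX.
by apply: ler_powR; lra.
Qed.

Let bdd (f : T -> R) := exists b : R, forall x, `|f x| <= b.

Let bddM (f g : T -> R) : bdd f -> bdd g -> bdd (fun x => f x * g x).
Proof.
by move=> [b fb] [b' gb]; exists (b * b') => x; rewrite normrM ler_pM.
Qed.

Let bddD (f g : T -> R) : bdd f -> bdd g -> bdd (fun x => f x + g x).
Proof.
move=> [b fb] [b' gb]; exists (b + b') => x.
by apply: le_trans (ler_normD _ _) _; rewrite lerD.
Qed.

Let bdd_cst (b : R) : bdd (fun=> b). Proof. by exists `|b|. Qed.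

Let bdd_ee t : bdd (ee t).
Proof. by exists 1 => x; rewrite ger0_norm// ltW. Qed.

Let bdd_m t : bdd (m t). Proof. by exists M. Qed.

Let bdd_gc t : bdd (gc t).
Proof. by exists 2 => x; rewrite ger0_norm. Qed.

Let gawt t x := gate t x * awt t x.

Let bdd_gawt t : bdd (gawt t).
Proof.
by exists 2 => x; rewrite ger0_norm; [exact: gawt_le2|apply: mulr_ge0].
Qed.

Let adgawt t : adp (G t) (gawt t). Proof. exact: adpM. Qed.

Let intg_bdd t (f : T -> R) : adp (G t) f -> bdd f -> intg P f.
Proof. by move=> af [b fb]; apply: (intg_bnd (M := b)) => //; exact: (@mfun t). Qed.

(** [K] carries the inverse propensity and may be unbounded, but [f = K * ee] is bounded;
    integrability is read off from [f]. *)
Let term (t : nat) (K f : T -> R) (phi : R -> R) :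
  adp (G t) K -> adp (G t) f -> (forall x, K x * ee t x = f x) -> bdd f ->
  measurable_fun setT phi -> intg P (fun x => phi (y 0%N x)) ->
  [/\ intg P (fun x => K x * (I t x * phi (y t x))), intg P f &
  \int[P]_x (K x * (I t x * phi (y t x))) =
  \int[P]_x ((\int[P]_z phi (y 0%N z)) * f x)].
Proof.
move=> aK af Kf fb mphi Iphi; have If := intg_bdd af fb.
have fE : (fun x => K x * ee t x) = f by exact/funext.
have IK : intg P (fun x => K x * ee t x) by rewrite fE.
by have [I1 E1] := core aK IK mphi Iphi; split => //; rewrite E1 fE EZ// mulrC.
Qed.

Let eeV t x : (ee t x)^-1 * ee t x = 1. Proof. by rewrite mulVf// gt_eqF. Qed.

Let I1 : intg P (fun x => (fun=> 1) (y 0%N x)). Proof. exact: intg_cst. Qed.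

Let E1 : \int[P]_x ((fun=> 1) (y 0%N x)) = 1. Proof. exact: Ecst. Qed.

(** The three parts of the centred score integrate to [Q], [- m] and [m - Q] times the multiplier,
    so they cancel whatever the regression guess [m] is. *)
Let incr_mean t (g : T -> R) : adp (G t) g -> bdd g ->
  \int[P]_x (g x * x' t x) = 0.
Proof.
move=> ag bg.
have am := @adm t; have aV := @adV t; have agc := @adgc t.
pose f x := g x * gc t x.
have af : adp (G t) f by exact: adpM.
have bf : bdd f by exact: bddM.
have [J1 _ T1] : [/\ intg P (fun x => f x * (ee t x)^-1 * (I t x * id (y t x))), intg P f &
    \int[P]_x (f x * (ee t x)^-1 * (I t x * id (y t x))) =
    \int[P]_x ((\int[P]_z id (y 0%N z)) * f x)].
  apply: (@term t _ f id) => //; first exact: adpM.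
  by move=> x; rewrite -mulrA eeV mulr1.
have [J2 If2 T2] := @term t (fun x => f x * m t x * (ee t x)^-1) (fun x => f x * m t x)
  (fun=> 1) (adpM (adpM af am) aV) (adpM af am)
  (fun x => etrans (esym (mulrA _ _ _)) (etrans (congr1 _ (eeV t x)) (mulr1 _)))
  (bddM bf (bdd_m t)) (measurable_cst _) I1.
have If : intg P f by exact: (@intg_bdd t).
have If3 : intg P (fun x => f x * (m t x - Q)).
  apply: (@intg_bdd t); first by apply: adpM => //; apply: adpB => //; exact: adp_cst.
  by apply: bddM => //; apply: bddD; [exact: bdd_m|exact: bdd_cst].
transitivity (\int[P]_x (f x * (ee t x)^-1 * (I t x * id (y t x)) -
    f x * m t x * (ee t x)^-1 * (I t x * 1) + f x * (m t x - Q))).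
  apply: eq_Rintegral => x _; rewrite /x' /incr score_split /f /gc /=.
  by field; rewrite gt_eqF.
rewrite ED//; last exact: intgB.
rewrite EB// T1 T2 E1 Ey -EB//; [|exact: intgZ..].
rewrite -ED//; last by apply: intgB; exact: intgZ.
rewrite -[RHS](Ecst P 0); apply: eq_Rintegral => x _; ring.
Qed.

(** As [I] is 0 or 1, it equals its square; the terms are sorted by powers of the outcome so that
    the product formula applies to each. *)
Let incr_sq t x : x' t x ^+ 2 = gawt t x * (ee t x)^-1 * (I t x * y t x ^+ 2) +
  gawt t x * (- 2 * m t x * (ee t x)^-1 + 2 * (m t x - Q)) * (I t x * y t x) +
  gawt t x * (m t x ^+ 2 * (ee t x)^-1 - 2 * m t x * (m t x - Q)) * (I t x * 1) +
  gawt t x * ee t x * (m t x - Q) ^+ 2.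
Proof.
rewrite /gawt /x' /incr score_split awtE exprMn [gate t x ^+ 2]expr2 gate_sq.
by case: (I01 t x) => ->; field; rewrite gt_eqF.
Qed.

Let incr_var t (g : T -> R) : adp (G t) g -> bdd g ->
  intg P (fun x => g x * x' t x ^+ 2) /\
  \int[P]_x (g x * x' t x ^+ 2) = \int[P]_x (g x * v' t x).
Proof.
move=> ag bg.
have am := @adm t; have aV := @adV t; have aga := @adgawt t; have aee := @adee t.
pose f x := g x * gawt t x.
have af : adp (G t) f by exact: adpM.
have bf : bdd f by exact: bddM.
have amQ : adp (G t) (fun x => m t x - Q) by apply: adpB => //; exact: adp_cst.
have bmQ : bdd (fun x => m t x - Q).
  by apply: bddD; [exact: bdd_m|exact: bdd_cst].
have ac b : adp (G t) (fun=> b) by exact: adp_cst.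
have [J1 F1 T1] : [/\ intg P (fun x => f x * (ee t x)^-1 * (I t x * y t x ^+ 2)), intg P f &
    \int[P]_x (f x * (ee t x)^-1 * (I t x * y t x ^+ 2)) =
    \int[P]_x ((\int[P]_z (y 0%N z ^+ 2)) * f x)].
  apply: (@term t _ f (fun u => u ^+ 2)) => //; first exact: adpM.
  by move=> x; rewrite -mulrA eeV mulr1.
have [J2 F2 T2] : [/\ intg P (fun x =>
    f x * (- 2 * m t x * (ee t x)^-1 + 2 * (m t x - Q)) * (I t x * y t x)),
    intg P (fun x => f x * (- 2 * m t x + 2 * (m t x - Q) * ee t x)) &
    \int[P]_x (f x * (- 2 * m t x * (ee t x)^-1 + 2 * (m t x - Q)) * (I t x * y t x)) =
    \int[P]_x ((\int[P]_z y 0%N z) *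
      (f x * (- 2 * m t x + 2 * (m t x - Q) * ee t x)))].
  apply: (@term t _ _ id) => //.
  - apply: adpM => //; apply: adpD; last exact: adpM.
    by apply: adpM => //; exact: adpM.
  - apply: adpM => //; apply: adpD; first exact: adpM.
    by apply: adpM => //; exact: adpM.
  - by move=> x; field; rewrite gt_eqF.
  - by apply: bddM => //; apply: bddD; apply: bddM => //; apply: bddM.
have [J3 F3 T3] : [/\ intg P (fun x =>
    f x * (m t x ^+ 2 * (ee t x)^-1 - 2 * m t x * (m t x - Q)) * (I t x * 1)),
    intg P (fun x => f x * (m t x * m t x + (- 2) * m t x * (m t x - Q) * ee t x)) &
    \int[P]_x (f x * (m t x ^+ 2 * (ee t x)^-1 - 2 * m t x * (m t x - Q)) * (I t x * 1)) =
    \int[P]_x ((\int[P]_z (fun=> 1) (y 0%N z)) *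
      (f x * (m t x * m t x + (- 2) * m t x * (m t x - Q) * ee t x)))].
  apply: (@term t _ _ (fun=> 1)) => //.
  - apply: adpM => //; apply: adpB; first by apply: adpM => //; exact: adpX.
    by apply: adpM => //; exact: adpM.
  - apply: adpM => //; apply: adpD; first exact: adpM.
    by apply: adpM => //; apply: adpM => //; exact: adpM.
  - by move=> x; field; rewrite gt_eqF.
  - apply: bddM => //; apply: bddD; first exact: bddM.
    by apply: bddM => //; apply: bddM => //; apply: bddM.
have F4 : intg P (fun x => f x * ee t x * (m t x - Q) ^+ 2).
  apply: (@intg_bdd t).
    by apply: adpM; [exact: adpM|exact: adpX].
  by apply: bddM; [exact: bddM|under eq_fun do rewrite expr2; exact: bddM].
have gE : (fun x => g x * x' t x ^+ 2) = (fun x =>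
    f x * (ee t x)^-1 * (I t x * y t x ^+ 2) +
    f x * (- 2 * m t x * (ee t x)^-1 + 2 * (m t x - Q)) * (I t x * y t x) +
    f x * (m t x ^+ 2 * (ee t x)^-1 - 2 * m t x * (m t x - Q)) * (I t x * 1) +
    f x * ee t x * (m t x - Q) ^+ 2).
  by apply/funext => x; rewrite incr_sq /f; ring.
have J12 := intgD J1 J2; have J123 := intgD J12 J3.
rewrite gE; split; first exact: intgD.
rewrite (ED J123 F4) (ED J12 J3) (ED J1 J2) T1 T2 T3 E1 Ey Ey2.
have Z1 := intgZ (s2 + Q ^+ 2) F1; have Z2 := intgZ Q F2; have Z3 := intgZ 1 F3.
have Z12 := intgD Z1 Z2; have Z123 := intgD Z12 Z3.
rewrite -(ED Z1 Z2) -(ED Z12 Z3) -(ED Z123 F4).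
apply: eq_Rintegral => x _; rewrite /v' /cvar /f /gawt; ring.
Qed.

Let phiq (u : R) := (`|u| + M) `^ q.

Let mphiq : measurable_fun setT phiq.
Proof.
apply: (measurableT_comp (@measurable_powR R q)).
by apply: measurable_funD => //; exact: measurableT_comp.
Qed.

(** The power of 2 comes from splitting a sum of two terms. The bracket collects the part with
    inverse propensity, where [|y - m| <= |y| + M], and the part [|m - Q| <= M + |Q|]. *)
Definition lyap := 2 `^ q * (\int[P]_x phiq (y 0%N x) + (M + `|Q|) `^ q).

Let incr_pow t : intg P (fun x => `|x' t x| `^ q) /\
  \int[P]_x (`|x' t x| `^ q) <= lyap * \int[P]_x l' t x.
Proof.
case/andP: q23 => q2 q3; have qn0 : q != 0 by rewrite gt_eqF//; lra.
have q0 : 0 <= q by lra.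
have aV := @adV t; have aee := @adee t.
pose K x := gate t x * (c t x `^ q * ee t x `^ (- q)).
have powI x : I t x `^ q = I t x.
  by case: (I01 t x) => ->; rewrite ?powR0// powR1.
have aK : adp (G t) K.
  by apply: adpM => //; apply: adpM; exact: adp_powR.
have al : adp (G t) (l' t) by exact: adpM.
have bl : bdd (l' t).
  exists eta => x; rewrite ger0_norm; last by apply: mulr_ge0.
  apply: le_trans (sum_glam t.+1 x); rewrite big_ord_recr/= lerDr.
  by apply: sumr_ge0 => i _; apply: mulr_ge0.
have Kl x : K x * ee t x = l' t x.
  have -> : l' t x = gate t x * (c t x `^ q * (ee t x `^ (- q) * ee t x)).
    rewrite /l' /lam -[X in _ * (_ * (_ * X))](powRr1 (ltW (ee0 t x))).
    by rewrite -powRD ?(gt_eqF (ee0 t x)) ?implybT// (addrC 1).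
  by rewrite /K; ring.
have [J1 Il T1] := term aK al Kl bl mphiq Iyq'.
have pw x : `|x' t x| `^ q <= 2 `^ q * (K x * (I t x * phiq (y t x)) +
    l' t x * (M + `|Q|) `^ q).
  have e0 := ee0 t x; have e1 := ee1 t x.
  have Ix0 : 0 <= I t x by case: (I01 t x) => ->.
  have hx : `|score t x - Q| <= I t x / ee t x * (`|y t x| + M) + (M + `|Q|).
    have -> : score t x - Q = I t x / ee t x * (y t x - m t x) + (m t x - Q).
      by rewrite score_split; field; rewrite gt_eqF.
    apply: le_trans (ler_normD _ _) _; apply: lerD.
      rewrite normrM ger0_norm; last by rewrite divr_ge0// ltW.
      rewrite ler_wpM2l//; first by rewrite divr_ge0// ltW.
      by apply: le_trans (ler_normB _ _) _; rewrite lerD2l.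
    by apply: le_trans (ler_normB _ _) _; rewrite lerD2r.
  have w0 : 0 <= I t x / ee t x * (`|y t x| + M).
    by rewrite mulr_ge0 ?addr_ge0// divr_ge0// ltW.
  have hp : `|score t x - Q| `^ q <= 2 `^ q * (I t x * (ee t x `^ (- q)) * phiq (y t x) +
      (M + `|Q|) `^ q).
    apply: (@le_trans _ _ ((I t x / ee t x * (`|y t x| + M) + (M + `|Q|)) `^ q)).
      by apply: ge0_ler_powR => //; rewrite nnegrE// addr_ge0.
    apply: le_trans (powR_add_le _ _ _) _ => //.
    rewrite powRM ?addr_ge0 ?divr_ge0 ?(ltW e0)// powRM ?invr_ge0 ?(ltW e0)//.
    by rewrite powI -powR_inv1 ?(ltW e0)// -powRrM mulN1r.
  rewrite /x' /K /l' /incr; case: (gate_cases' t x) => [->|[-> _ _]].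
    by rewrite !mul0r normr0 powR0// addr0 mulr0.
  rewrite !mul1r normrM (ger0_norm (c0 t x)) powRM//.
  apply: le_trans (ler_wpM2l (powR_ge0 _ _) hp) _.
  rewrite mulrCA ler_wpM2l ?powR_ge0// mulrDr lerD//.
    by rewrite le_eqVlt; apply/orP; left; apply/eqP; ring.
  (* The part without inverse propensity is absorbed too, because the power [1 - q] of [ee <= 1] is
     at least 1. *)
  rewrite ler_wpM2r ?powR_ge0// /lam ler_peMr ?powR_ge0//.
  rewrite -[leLHS](powRr0 (ee t x)); apply: ger_powR; first by rewrite e0.
  by lra.
have Z1 : intg P (fun x => l' t x * (M + `|Q|) `^ q).
  by under eq_fun do rewrite mulrC; exact: intgZ.
have mx'q : measurable_fun setT (fun x => `|x' t x| `^ q).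
  apply: (measurableT_comp (@measurable_powR R q)); apply: measurableT_comp => //.
  exact: mfun (@adp_gincr' t).
have IR : intg P (fun x => 2 `^ q * (K x * (I t x * phiq (y t x)) +
    l' t x * (M + `|Q|) `^ q)) by apply: intgZ; exact: intgD.
have IL : intg P (fun x => `|x' t x| `^ q).
  apply: (intg_le mx'q IR) => x; rewrite ger0_norm ?powR_ge0//.
  by apply: le_trans (pw x) _; exact: ler_norm.
split => //; apply: le_trans (Ele IL IR pw) _.
rewrite EZ; last exact: intgD.
rewrite (ED J1 Z1) T1 EZ//.
have -> : \int[P]_x (l' t x * (M + `|Q|) `^ q) = (M + `|Q|) `^ q * \int[P]_x l' t x.
  by rewrite -EZ//; apply: eq_Rintegral => x _; rewrite mulrC.
by rewrite -mulrDl mulrA.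
Qed.

Let q0 : 0 <= q. Proof. by case/andP: q23 => *; lra. Qed.

Let lyap0 : 0 <= lyap.
Proof.
rewrite /lyap mulr_ge0 ?powR_ge0// addr_ge0 ?powR_ge0//.
by apply: Rintegral_ge0 => x _; exact: powR_ge0.
Qed.

Lemma awt_ge0 t x : 0 <= awt t x. Proof. exact: awt_ge0'. Qed.

Lemma lam_ge0 t x : 0 <= lam t x. Proof. exact: lam_ge0'. Qed.

Lemma awt_le_lam t x : awt t x `^ (q / 2) <= lam t x.
Proof. exact: awt_le_lam'. Qed.

Lemma gate_eq1 n x t : (t < n)%N -> \sum_(j < n) awt j x <= 2 ->
  \sum_(j < n) lam j x <= eta -> gate t x = 1.
Proof.
move=> tn hU hL; have le_sum (f : nat -> T -> R) : (forall j x, 0 <= f j x) ->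
    \sum_(j < t.+1) f j x <= \sum_(j < n) f j x.
  move=> f0; rewrite -!(big_mkord xpredT (fun j => f j x)) [leRHS](big_cat_nat _ tn)//=.
  by rewrite lerDl sumr_ge0.
rewrite /gate /U /L (le_trans (le_sum _ awt_ge0) hU).
by rewrite (le_trans (le_sum _ lam_ge0) hL) mulr1.
Qed.

Lemma adp_gincr t : adp (G t.+1) (fun x => gate t x * incr t x).
Proof. exact: adp_gincr'. Qed.

Lemma adp_gcvar t : adp (G t) (fun x => gate t x * cvar t x).
Proof. exact: adp_gcvar'. Qed.

Lemma gcvar_ge0 t x : 0 <= gate t x * cvar t x.
Proof. exact: gcvar_ge0'. Qed.

Lemma sum_gcvar n x : \sum_(t < n) gate t x * cvar t x <= 2 * (s2 + (M + `|Q|) ^+ 2).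
Proof. exact: sum_gcvar'. Qed.

Variable n : nat.

Let El' : \sum_(k < n) \int[P]_x l' k x <= eta.
Proof.
rewrite -Esum//; rewrite -[leRHS](Ecst P); apply: Ele.
- by apply: intg_sum => k _; exact: Il'.
- exact: intg_cst.
- by move=> x; exact: sum_glam.
Qed.

Let Ex1' k (g : T -> R) (b : R) : adp (G k) g -> (forall t, `|g t| <= b) ->
  \int[P]_t (g t * x' k t) = 0.
Proof. by move=> ag gb; apply: incr_mean => //; exists b. Qed.

Let Ex2' k (g : T -> R) (b : R) : adp (G k) g -> (forall t, `|g t| <= b) ->
  \int[P]_t (g t * x' k t ^+ 2) = \int[P]_t (g t * v' k t).
Proof. by move=> ag gb; have [] := incr_var ag; first by exists b. Qed.

Let Ix2' k : intg P (fun t => x' k t ^+ 2).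
Proof.
have [] := @incr_var k (fun=> 1); [exact: adp_cst|exact: bdd_cst|].
by under eq_fun do rewrite mul1r.
Qed.

(** The constant in front of [eta] involves neither [n], [D] nor the weights, so the error vanishes
    with the Lyapunov threshold. *)
Lemma gated_charf (a b : R) :
  `|\int[P]_t (expR (a ^+ 2 / 2 * \sum_(j < n) gate j t * cvar j t) *
      cos (a * (\sum_(j < n) gate j t * incr j t) + b)) - cos b| <=
  (expR (a ^+ 2 / 2 * (2 * B)) * (4 * `|a| `^ q) * lyap + expR (a ^+ 2 / 2 * (2 * B)) *
    ((a ^+ 2 / 2) ^+ 2 * (4 * B ^+ 2) * expR (a ^+ 2 / 2 * (2 * B)))) * eta.
Proof.
have := @charf_bound _ _ _ P n G x' v' l' q (2 * B) lyap (4 * B ^+ 2) Gm Gmono adp_gincr' adp_gcvar'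
  gcvar_ge0' (sum_gcvar' n) q23 Ix2' (fun k => (incr_pow k).1) Il' Ex1' Ex2'
  (fun k => (incr_pow k).2) gcvar_sq_le a b.
move=> h1; apply: (le_trans h1); rewrite ler_wpM2l//.
apply: addr_ge0.
  apply: mulr_ge0; last exact: lyap0.
  by apply: mulr_ge0; [exact: expR_ge0|rewrite mulr_ge0 ?powR_ge0].
apply: mulr_ge0; first exact: expR_ge0.
apply: mulr_ge0; last exact: expR_ge0.
by apply: mulr_ge0; [exact: sqr_ge0|rewrite mulr_ge0 ?sqr_ge0].
Qed.

Lemma gated_laplace (a : R) : 0 <= a ->
  `|\int[P]_t (expR (a * \sum_(j < n) gate j t * cvar j t) *
      expR (- (a * (\sum_(j < n) (gate j t * incr j t) ^+ 2)))) - 1| <=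
  (expR (a * (2 * B)) * (a + a ^+ 2) * lyap + expR (a * (2 * B)) *
    (a ^+ 2 * (4 * B ^+ 2) * expR (a * (2 * B)))) * eta.
Proof.
move=> a0.
have := @laplace_bound _ _ _ P n G x' v' l' q (2 * B) lyap (4 * B ^+ 2) Gm Gmono adp_gincr' adp_gcvar'
  gcvar_ge0' (sum_gcvar' n) q23 Ix2' (fun k => (incr_pow k).1) Il' Ex1' Ex2'
  (fun k => (incr_pow k).2) gcvar_sq_le a a0.
move=> h1; apply: (le_trans h1); rewrite ler_wpM2l//.
apply: addr_ge0.
  apply: mulr_ge0; last exact: lyap0.
  by apply: mulr_ge0; [exact: expR_ge0|rewrite addr_ge0 ?sqr_ge0].
apply: mulr_ge0; first exact: expR_ge0.
apply: mulr_ge0; last exact: expR_ge0.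
by apply: mulr_ge0; [exact: sqr_ge0|rewrite mulr_ge0 ?sqr_ge0].
Qed.

Lemma gated_tail (Lv : R) : 0 < Lv ->
  (P [set t | (Lv <= `|\sum_(j < n) gate j t * incr j t|)%R] <=
   (2 * (2 * B) / Lv ^+ 2)%:E)%E.
Proof.
move=> Lv0.
exact: (@partial_sum_tail _ _ _ P n G x' v' (2 * B) Gm Gmono adp_gincr' adp_gcvar' gcvar_ge0' (sum_gcvar' n)
  Ix2' Ex1' Ex2' Lv Lv0).
Qed.

End aipw_array.

(** * Slutsky and studentization *)

Section slutsky.
Context {d : measure_display} {T : measurableType d} {R : realType}.
Variables (P : probability T R) (X rho Z : nat -> T -> R).
Local Notation N := (std_normal R).
Hypothesis mX : forall n, measurable_fun setT (X n).
Hypothesis mZ : forall n, measurable_fun setT (Z n).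
Hypothesis cX : forall r : R, P [set x | X n x <= r] @[n --> \oo] --> N `]-oo, r]%classic.
Hypothesis cr : forall eps : R, 0 < eps -> whp P (fun n => [set x | `|rho n x - 1| <= eps]).
Hypothesis cZ : whp P (fun n => [set x | Z n x = X n x / rho n x]).

Let mN r : measurable [set z : R | z <= r].
Proof. exact: measurable_le_set. Qed.

Let setr (r : R) : `]-oo, r]%classic = [set z : R | z <= r].
Proof. by apply/seteqP; split => z /=; rewrite in_itv. Qed.

Let cXf r : fine (P [set x | X n x <= r]) @[n --> \oo] --> fine (N [set z | z <= r]).
Proof.
have := @cX r; rewrite setr -[X in _ --> X -> _]fineK ?fin_num_measure//; last exact: mN.
by move/fine_cvgP => [].
Qed.

Lemma slutsky_cdf (r : R) :
  P [set x | Z n x <= r] @[n --> \oo] --> N `]-oo, r]%classic.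
Proof.
rewrite setr -[X in _ --> X]fineK ?fin_num_measure//; last exact: mN.
have mst n := measurable_le_set r (@mZ n); have mx n u := measurable_le_set u (@mX n).
apply/fine_cvgP; split; first by apply: nearW => n; rewrite fin_num_measure.
apply/cvgrPdist_le => eps' e0'.
(* One [eps] each for the bad event, the convergence of [X], and the continuity of the normal
   law. *)
pose eps := eps' / 3; have e0 : 0 < eps by rewrite divr_gt0.
have [s s0 [Ns1 Ns2]] := std_normal_cdf_cont r e0.
(* The bound 1/2 keeps [rho] positive, so that dividing by it preserves inequalities; the other
   bound moves the threshold [r * rho] by at most [s]. *)
pose k := Num.min 2^-1 (s / (`|r| + 1)).
have r1 : 0 < `|r| + 1 by rewrite ltr_wpDl.
have k0 : 0 < k by rewrite lt_min invr_gt0 ltr0n/= divr_gt0.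
have h1 := (cvgrPdist_le _ _).1 (@cXf (r + s)) _ e0.
have h2 := (cvgrPdist_le _ _).1 (@cXf (r - s)) _ e0.
have h3 : \forall n \near \oo, exists B, [/\ measurable B,
    B `<=` [set x | `|rho n x - 1| <= k /\ Z n x = X n x / rho n x] &
    (P (~` B) <= eps%:E)%E].
  have w : whp P _ := cr k0; exact: (whpI w cZ e0).
near=> n.
have [B [mB BE PB]] : exists B, [/\ measurable B,
    B `<=` [set x | `|rho n x - 1| <= k /\ Z n x = X n x / rho n x] &
    (P (~` B) <= eps%:E)%E] by near: n.
have a1 : `|fine (N [set z | z <= r + s]) - fine (P [set x | X n x <= r + s])| <= eps by near: n; exact: h1.
have a2 : `|fine (N [set z | z <= r - s]) - fine (P [set x | X n x <= r - s])| <= eps by near: n; exact: h2.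
change (`|fine (N [set z | z <= r]) - fine (P [set x | Z n x <= r])| <= eps').
have PB' : fine (P (~` B)) <= eps.
  by rewrite -lee_fin fineK ?fin_num_measure//; exact: measurableC.
have mC := measurableC mB.
have sub2 (A C : set T) : measurable A -> measurable C -> A `<=` C `|` ~` B ->
    fine (P A) <= fine (P C) + eps.
  move=> mA mC' AC; rewrite -lee_fin EFinD !fineK ?fin_num_measure//.
  apply: (@le_trans _ _ (P (C `|` ~` B))).
    by apply: le_measure; rewrite ?inE//; exact: measurableU.
  apply: (le_trans (measureU2 _ _ _)) => //.
  by apply: leeD2l; rewrite -[leLHS]fineK ?fin_num_measure// lee_fin.
have key x : B x -> [/\ 0 < rho n x, `|r * rho n x - r| <= s & Z n x = X n x / rho n x].
  move=> /BE [/= + zE]; rewrite le_min => /andP[c1 c2]; split => //.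
    by move: c1; rewrite ler_norml => /andP[]; lra.
  rewrite -{2}(mulr1 r) -mulrBr normrM.
  apply: le_trans (_ : (`|r| + 1) * (s / (`|r| + 1)) <= _).
    by apply: ler_pM => //; rewrite lerDl.
  by rewrite mulrC divfK// gt_eqF.
have L1 : fine (P [set x | Z n x <= r]) <= fine (P [set x | X n x <= r + s]) + eps.
  apply: sub2 => // x /= h; have [Bx|nB] := pselect (B x); last by right.
  have [p0 p1 zE] := key _ Bx; left; move: h; rewrite zE ler_pdivrMr// => h.
  by move: p1; rewrite ler_norml => /andP[_]; lra.
have L2 : fine (P [set x | X n x <= r - s]) <= fine (P [set x | Z n x <= r]) + eps.
  apply: sub2 => // x /= h; have [Bx|nB] := pselect (B x); last by right.
  have [p0 p1 zE] := key _ Bx; left; rewrite zE ler_pdivrMr//.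
  by move: p1; rewrite ler_norml => /andP[]; lra.
move: a1 a2; rewrite !ler_norml => /andP[a1 a2] /andP[b1 b2].
by rewrite (_ : eps' = 3 * eps); [lra|rewrite /eps; field].
Unshelve. all: by end_near. Qed.

End slutsky.

(** * Algebra of the studentized error *)

Section studentized.
Context {R : realType}.
Variables (n : nat) (h g : nat -> R) (Q D : R).
Hypothesis h0 : forall t, 0 <= h t.
Hypothesis D0 : 0 < D.

Let s := \sum_(t < n) h t.
Let Qh := (\sum_(t < n) h t * g t) / s.
Let Vh := (\sum_(t < n) h t ^+ 2 * (g t - Qh) ^+ 2) / s ^+ 2.
Let S := \sum_(t < n) h t / Num.sqrt D * (g t - Q).
Let QV := \sum_(t < n) (h t / Num.sqrt D * (g t - Q)) ^+ 2.

Lemma estimator_error : s != 0 -> Qh - Q = S * Num.sqrt D / s.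
Proof.
move=> s0; have d0 : Num.sqrt D != 0 by rewrite gt_eqF// sqrtr_gt0.
have -> : S = (\sum_(t < n) h t * g t - Q * s) / Num.sqrt D.
  rewrite /S /s mulr_sumr -sumrB mulr_suml; apply: eq_bigr => t _; ring.
by rewrite divfK// /Qh; field.
Qed.

Lemma studentized_error : 0 < s ->
  (Qh - Q) / Num.sqrt Vh = S / Num.sqrt ((\sum_(t < n) h t ^+ 2 * (g t - Qh) ^+ 2) / D).
Proof.
move=> s0.
rewrite estimator_error ?gt_eqF// /Vh.
set A := \sum_(t < n) _; have A0 : 0 <= A by apply: sumr_ge0 => t _; rewrite mulr_ge0 ?sqr_ge0.
rewrite !(sqrtrM _ A0) sqrtrV ?sqr_ge0// sqrtr_sqr (gtr0_norm s0) sqrtrV ?(ltW D0)//.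
rewrite !invfM !invrK.
(* A vanishing residual sum makes both sides 0, by the convention for the inverse of 0. *)
have [->|a0] := eqVneq (Num.sqrt A) 0; first by rewrite invr0; ring.
by field; rewrite a0 gt_eqF.
Qed.

(** With [De = Qh - Q] and [u = g t - Q], each squared residual differs from [u ^+ 2] by
    [De * (De - 2 * u)], and [2 * |u| <= 1 + u ^+ 2] expresses the error by the quadratic
    variation. *)
Lemma residual_qv (r : R) : `|Qh - Q| <= r -> \sum_(t < n) h t ^+ 2 / D <= 2 ->
  `|(\sum_(t < n) h t ^+ 2 * (g t - Qh) ^+ 2) / D - QV| <= r * (2 + QV) + 2 * r ^+ 2.
Proof.
move=> Dr A2; set De := Qh - Q in Dr.
have r0 : 0 <= r by exact: le_trans Dr.
have QVE : QV = \sum_(t < n) h t ^+ 2 / D * (g t - Q) ^+ 2.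
  by apply: eq_bigr => t _; rewrite exprMn expr_div_n sqr_sqrtr ?(ltW D0)//.
have hD t : 0 <= h t ^+ 2 / D by rewrite divr_ge0 ?sqr_ge0// ltW.
apply: (@le_trans _ _ (\sum_(t < n) h t ^+ 2 / D * (r * (1 + (g t - Q) ^+ 2) + r ^+ 2))).
  rewrite QVE mulr_suml -sumrB; apply: le_trans (ler_norm_sum _ _ _) _.
  apply: ler_sum => t _.
  have -> : h t ^+ 2 * (g t - Qh) ^+ 2 / D - h t ^+ 2 / D * (g t - Q) ^+ 2 =
      h t ^+ 2 / D * (De * (De - 2 * (g t - Q))) by rewrite /De; ring.
  rewrite normrM (ger0_norm (hD t)) ler_wpM2l// normrM.
  have -> : r * (1 + (g t - Q) ^+ 2) + r ^+ 2 = r * (r + (1 + (g t - Q) ^+ 2)) by ring.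
  apply: ler_pM => //; apply: le_trans (ler_normB _ _) _; apply: lerD => //.
  rewrite normrM normr_nat -(real_normK (num_real (g t - Q))).
  by have := sqr_ge0 (`|g t - Q| - 1); rewrite sqrrB; lra.
have -> : \sum_(t < n) h t ^+ 2 / D * (r * (1 + (g t - Q) ^+ 2) + r ^+ 2) =
    r * (\sum_(t < n) h t ^+ 2 / D + QV) + r ^+ 2 * \sum_(t < n) h t ^+ 2 / D.
  rewrite QVE -big_split/= !mulr_sumr -big_split/=; apply: eq_bigr => t _; ring.
apply: lerD; first by rewrite ler_wpM2l// lerD2r.
by rewrite mulrC ler_wpM2r// sqr_ge0.
Qed.

End studentized.

(** * The limit theorem for predictable weights *)

Lemma expRB1_le {R : realType} (u : R) : `|u| <= 2^-1 -> `|expR u - 1| <= 2 * `|u|.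
Proof.
move=> u2; move: (u2); rewrite ler_norml => /andP[h1 h2].
have e1 := expR_ge1Dx u; have e2 := expR_ge1Dx (- u).
have e0 := expR_gt0 u; have eN : expR u * expR (- u) = 1 by rewrite -expRD subrr expR0.
have e3 : expR u * (1 - u) <= 1 by rewrite -[leRHS]eN ler_wpM2l// ltW.
have [u0|u0] := leP 0 u; first by rewrite (ger0_norm u0) ger0_norm; nra.
rewrite (ltr0_norm u0) ler0_norm; first by lra.
by rewrite subr_le0 expR_le1 ltW.
Qed.

Lemma sum_lt_le {R : realType} (n N : nat) : \sum_(t < n) ((t < N)%N%:R : R) <= N%:R.
Proof.
suff : \sum_(t < n) ((t < N)%N%:R : R) <= (minn n N)%:R.
  by move/le_trans; apply; rewrite ler_nat geq_minr.
elim: n => [|n IH]; first by rewrite big_ord0.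
rewrite big_ord_recr/=; apply: le_trans (lerD IH (lexx _)) _.
by rewrite -natrD ler_nat; case: ltnP => nN /=; lia.
Qed.

Section clt.
Context {d : measure_display} {T : measurableType d} {R : realType}.
Variables (P : probability T R) (G : nat -> set_system T).
Variables (I y ee m : nat -> T -> R) (Q M s2 q : R).
Hypothesis Gm : forall k, G k `<=` d.-measurable.
Hypothesis Gmono : forall k, <<s G k>> `<=` <<s G k.+1>>.
Hypothesis I01 : forall t x, I t x = 0 \/ I t x = 1.
Hypothesis adI : forall t, adp (G t.+1) (I t).
Hypothesis adIy : forall t, adp (G t.+1) (fun x => I t x * y t x).
Hypothesis adee : forall t, adp (G t) (ee t).
Hypothesis ee0 : forall t x, 0 < ee t x.
Hypothesis ee1 : forall t x, ee t x <= 1.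
Hypothesis adm : forall t, adp (G t) (m t).
Hypothesis mM : forall t x, `|m t x| <= M.
Hypothesis my : forall t, measurable_fun setT (y t).
Hypothesis core : forall t (K : T -> R) (phi : R -> R),
  adp (G t) K -> intg P (fun x => K x * ee t x) -> measurable_fun setT phi ->
  intg P (fun x => phi (y 0%N x)) ->
  intg P (fun x => K x * (I t x * phi (y t x))) /\
  \int[P]_x (K x * (I t x * phi (y t x))) =
  \int[P]_x (K x * ee t x) * \int[P]_x phi (y 0%N x).
Hypothesis q23 : 2 <= q <= 3.
Hypothesis Iyq : intg P (fun x => `|y 0%N x| `^ q).
Hypothesis Ey : \int[P]_x y 0%N x = Q.
Hypothesis Ey2 : \int[P]_x (y 0%N x ^+ 2) = s2 + Q ^+ 2.
Hypothesis s20 : 0 < s2.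
Variables (h : nat -> nat -> T -> R) (D : nat -> R) (kappa : R).
Hypothesis h0 : forall n t x, 0 <= h n t x.
Hypothesis adh : forall n t, adp (G t) (h n t).
Hypothesis D0 : \forall n \near \oo, 0 < D n.
Hypothesis kappa0 : 0 <= kappa.
Hypothesis Hagg : forall N : R,
  whp P (fun n => [set x | N < (\sum_(t < n) h n t x) ^+ 2 / D n]).
Hypothesis Huse : forall eps : R, 0 < eps ->
  whp P (fun n => [set x | `|\sum_(t < n) awt ee (h n) (D n) t x - 1| <= eps]).
Hypothesis Hlam : forall eps : R, 0 < eps ->
  whp P (fun n => [set x | \sum_(t < n) lam ee q (h n) (D n) t x <= eps]).
Hypothesis Hz : {ae P, forall x,
  (1 - ee t x) * (Q - m t x) ^+ 2 @[t --> \oo] --> kappa}.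

Let aw n t x := awt ee (h n) (D n) t x.
Let ic n t x := incr I y ee m Q (h n) (D n) t x.
Let cv n t x := cvar ee m Q s2 (h n) (D n) t x.
Let ga eta n t x := gate ee q (h n) (D n) eta t x.
Let z t x := (1 - ee t x) * (Q - m t x) ^+ 2.
Let S n x := \sum_(t < n) ic n t x.
Let QV n x := \sum_(t < n) ic n t x ^+ 2.
Let V n x := \sum_(t < n) cv n t x.
Let v := s2 + kappa.
Let B := s2 + (M + `|Q|) ^+ 2.

Let v0 : 0 < v. Proof. by rewrite ltr_wpDr. Qed.

Let s20w : 0 <= s2. Proof. exact: ltW. Qed.

Let whp_D0 : whp P (fun n => [set x | 0 < D n]).
Proof.
by apply: whp_near; apply: filterS D0 => n Dn; apply/seteqP; split.
Qed.

Let whp_gate eta : 0 < eta ->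
  whp P (fun n => [set x | forall t, (t < n)%N -> ga eta n t x = 1]).
Proof.
move=> e0; have w1 : whp P _ := Huse ltr01; have w2 : whp P _ := Hlam e0.
apply: whpS (whpI (whpI w1 w2) whp_D0) _; apply: nearW => n x [[/= hU hL] Dn] t tn.
apply: (gate_eq1 ee0 Dn tn) => //.
by move: hU; rewrite ler_norml => /andP[_]; lra.
Qed.

Let mz t : measurable_fun setT (z t).
Proof.
apply: (adp_mfun (@Gm t)); apply: adpM; first by apply: adpB => //; exact: adp_cst.
by apply: adpX; apply: adpB => //; exact: adp_cst.
Qed.

(** The events where the bound holds from [N] on increase to an almost sure event, so one [N]
    suffices up to probability [eps']. *)
Let egorov (eps eps' : R) : 0 < eps -> 0 < eps' -> exists N : nat, exists A : set T,
  [/\ measurable A, (P (~` A) <= eps'%:E)%E &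
   forall x, A x -> forall t, (N <= t)%N -> `|z t x - kappa| <= eps].
Proof.
move=> e0 e0'.
pose A N := \bigcap_(t in [set t | (N <= t)%N]) [set x | `|z t x - kappa| <= eps].
have mA1 t : measurable [set x | `|z t x - kappa| <= eps].
  by apply: measurable_le_set; apply: measurableT_comp => //; apply: measurable_funB => //; exact: mz.
have mA N : measurable (A N) by apply: bigcap_measurableType => t _; exact: mA1.
have mU : measurable (\bigcup_N A N) by exact: bigcupT_measurable.
have PU : P (\bigcup_N A N) = 1%E.
  apply/eqP; rewrite eq_le probability_le1//=.
  have PC : P (~` (\bigcup_N A N)) = 0%E.
    apply/negligibleP; first exact: measurableC.
    apply: negligibleS Hz => x /= nA; apply: contra_not nA => cx.
    have [N _ hN] : \forall t \near \oo, `|z t x - kappa| <= eps.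
      by apply: filterS ((cvgrPdist_le _ _).1 cx _ e0) => t; rewrite distrC.
    by exists N => // t /= Nt; exact: hN.
  by move: PC; rewrite probability_setC// => /eqP; rewrite sube_eq ?fin_num_measure// add0e => /eqP <-.
have cA : P (A N) @[N --> \oo] --> 1%E.
  rewrite -PU; apply: nondecreasing_cvg_mu => //.
  by apply/nondecreasing_seqP => N; apply/subsetPset => x Ax t /= Nt; apply: Ax; exact: ltnW.
have wA := whp_cvg1 mA cA; have [N _ hN] := wA _ e0'.
have [C [mC CA PC]] := hN N (leqnn N).
by exists N, C; split => // x /CA Ax t Nt; exact: Ax.
Qed.

(** [V - v * Uw] is the sum of [aw t * (z t - kappa)]: at late times [z t] is uniformly close to
    [kappa], and at the at most [N] early ones each weight is below [theta]. *)
Let whp_V eps : 0 < eps -> whp P (fun n => [set x | `|V n x - v| <= eps]).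
Proof.
move=> e0 eps' e0'; have e2' : 0 < eps' / 2 by rewrite divr_gt0.
pose Bz := (M + `|Q|) ^+ 2 + kappa + 1.
have Bz0 : 0 < Bz.
  by have := sqr_ge0 (M + `|Q|); rewrite /Bz; move: kappa0; lra.
have zB t x : `|z t x - kappa| <= Bz.
  have M0 : 0 <= M by exact: le_trans (normr_ge0 _) (mM 0 point).
  have e1 := ee1 t x; have e_0 := ee0 t x.
  have qm : (Q - m t x) ^+ 2 <= (M + `|Q|) ^+ 2.
    rewrite -(real_normK (num_real (Q - m t x))) ler_pXn2r ?nnegrE ?addr_ge0//.
    by apply: le_trans (ler_normB _ _) _; rewrite addrC lerD2r.
  have qm0 := sqr_ge0 (Q - m t x).
  have w0 : 0 <= 1 - ee t x by lra.
  have w1 : 1 - ee t x <= 1 by lra.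
  have z0 : 0 <= z t x by exact: mulr_ge0.
  have z1 : z t x <= (M + `|Q|) ^+ 2 by apply: le_trans qm; exact: ler_piMl.
  apply: le_trans (ler_normB _ _) _; rewrite (ger0_norm z0) (ger0_norm kappa0).
  by rewrite /Bz -addrA lerD// lerDl.
have e8 : 0 < eps / 8 by rewrite divr_gt0.
have [N [A [mA PA hA]]] := egorov e8 e2'.
(* Makes the [N] early terms, each at most [theta * Bz], sum to at most [eps / 4]; the added 1
   covers [N = 0]. *)
pose theta := eps / 4 / (N%:R + 1) / Bz.
have N1 : 0 < N%:R + 1 :> R by rewrite ltr_pwDr.
have th0 : 0 < theta by rewrite /theta !divr_gt0.
have t0 : 0 < theta `^ (q / 2) by rewrite powR_gt0.
pose rho := Num.min 1 (eps / 4 / v).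
have rho0 : 0 < rho by rewrite lt_min ltr01/= !divr_gt0.
have w : whp P _ := whpI (whpI (Huse rho0) (Hlam t0)) whp_D0.
apply: filterS (w _ e2') => n [C [mC CE PC]].
exists (A `&` C); split; first exact: measurableI.
  move=> x [Ax /CE [[/= hU hL] Dn]].
  have la0 t := lam_ge0 ee q (h n) (D n) t x.
  have aw0 t : 0 <= aw n t x by exact: awt_ge0.
  have awth t : (t < n)%N -> aw n t x <= theta.
    (* A single weight above [theta] would by itself push the Lyapunov sum over its bound. *)
    move=> tn; rewrite leNgt; apply/negP => ath.
    have : theta `^ (q / 2) < aw n t x `^ (q / 2).
      apply: gt0_ltr_powR => //; rewrite ?nnegrE//; last exact: ltW.
      by case/andP: q23 => *; lra.
    apply/negP; rewrite -leNgt.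
    apply: le_trans (awt_le_lam ee0 ee1 q23 (@h0 n) Dn t x) _.
    apply: le_trans hL; rewrite (bigD1 (Ordinal tn))//= lerDl.
    by apply: sumr_ge0 => i _; exact: la0.
  set Uw := \sum_(t < n) awt ee (h n) (D n) t x in hU.
  have V1 : `|V n x - v * Uw| <= eps / 4 + eps / 8 * Uw.
    have -> : V n x - v * Uw = \sum_(t < n) aw n t x * (z t x - kappa).
      rewrite /V /Uw mulr_sumr -sumrB; apply: eq_bigr => t _.
      by rewrite /cv /cvar /v /z /aw; ring.
    apply: le_trans (ler_norm_sum _ _ _) _.
    apply: (@le_trans _ _ (\sum_(t < n) ((t < N)%N%:R * (theta * Bz) + eps / 8 * aw n t x))).
      apply: ler_sum => t _; rewrite normrM (ger0_norm (aw0 t)).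
      case: (ltnP t N) => tN.
        rewrite mul1r (@le_trans _ _ (theta * Bz))//; last first.
          by rewrite lerDl mulr_ge0// ltW.
        by apply: ler_pM => //; exact: awth.
      by rewrite mul0r add0r mulrC ler_wpM2r// hA.
    rewrite big_split/= -mulr_suml -mulr_sumr lerD2r.
    apply: (@le_trans _ _ (N%:R * (theta * Bz))).
      by rewrite ler_wpM2r ?sum_lt_le// mulr_ge0// ltW.
    have -> : theta * Bz = eps / 4 / (N%:R + 1).
      by rewrite /theta; field; rewrite !gt_eqF.
    rewrite mulrA ler_pdivrMr// mulrC ler_wpM2l//; first by rewrite divr_ge0// ltW.
    by rewrite lerDl.
  have r1 : rho <= 1 by rewrite ge_min lexx.
  have r2 : v * rho <= eps / 4.
    by rewrite mulrC -ler_pdivlMr// ge_min lexx orbT.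
  have U2 : Uw <= 2 by move: hU; rewrite ler_norml => /andP[_]; lra.
  have V2 : `|v * Uw - v| <= eps / 4.
    rewrite -[X in _ - X]mulr1 -mulrBr normrM (gtr0_norm v0).
    by apply: le_trans r2; rewrite ler_wpM2l// ltW.
  rewrite /= (_ : V n x - v = (V n x - v * Uw) + (v * Uw - v)); last by ring.
  apply: le_trans (ler_normD _ _) _.
  have e8U : eps / 8 * Uw <= eps / 8 * 2 by rewrite ler_wpM2l// ltW.
  by move: V1 V2 e8U; lra.
rewrite setCI (splitr eps') EFinD; apply: le_trans (leeD PA PC).
by apply: measureU2 => //; exact: measurableC.
Qed.

(* With high probability all gates are open and the compensator is close to
   [expR (c * v)], so both disappear from the limit. *)
Let ungate (c K1 k : R) (f : nat -> T -> R) (f' : R -> nat -> T -> R) :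
  0 <= c ->
  (forall n, measurable_fun setT (f n)) -> (forall n x, `|f n x| <= 1) ->
  (forall eta n, 0 < D n -> measurable_fun setT (f' eta n)) ->
  (forall eta n x, `|f' eta n x| <= 1) ->
  (forall eta n x, (forall t, (t < n)%N -> ga eta n t x = 1) -> f' eta n x = f n x) ->
  (forall eta n, 0 <= eta -> 0 < D n ->
    `|\int[P]_x (expR (c * \sum_(t < n) ga eta n t x * cv n t x) * f' eta n x) - k| <= K1 * eta) ->
  forall eps, 0 < eps ->
  \forall n \near \oo, `|\int[P]_x f n x - expR (- (c * v)) * k| <= eps.
Proof.
move=> c0 mf f1 mf' f'1 ff' hk eps e0.
have K10 : 0 <= K1.
  have [n Dn] := filter_ex D0; rewrite -[K1]mulr1.
  exact: le_trans (hk 1 n ler01 Dn).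
pose eta := eps / 2 / (K1 + 1).
have K11 : 0 < K1 + 1 by rewrite ltr_wpDl.
have eta0 : 0 < eta by rewrite !divr_gt0.
pose Mb := 1 + expR (c * (2 * B)).
have Mb0 : 0 < 1 + Mb by rewrite /Mb; have := expR_gt0 (c * (2 * B)); lra.
pose e2 := eps / 2 / (1 + Mb).
have e20 : 0 < e2 by rewrite !divr_gt0.
(* With [V] within [e3] of [v], [|c * (V - v)|] is at most 1/2 and at most [e2 / 2], so its
   exponential is within [e2] of 1; [c + 1] covers [c = 0]. *)
pose e3 := Num.min 2^-1 (e2 / 2) / (c + 1).
have c1 : 0 < c + 1 by rewrite ltr_wpDl.
have min0 : 0 < Num.min 2^-1 (e2 / 2) by rewrite lt_min invr_gt0 ltr0n/= divr_gt0.
have e30 : 0 < e3 by rewrite divr_gt0.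
have w : whp P _ := whpI (whp_gate eta0) (whp_V e30).
apply: filterS2 D0 (w _ e20) => n Dn [C [mC CE PC]].
pose V' x := \sum_(t < n) ga eta n t x * cv n t x.
have V'0 x : 0 <= V' x by apply: sumr_ge0 => t _; exact: (gcvar_ge0 Q q ee0 ee1 mM s20w (h n) eta Dn t x).
have V'B x : V' x <= 2 * B by exact: (sum_gcvar Q q ee0 ee1 mM s20w (h n) eta Dn n x).
have mV' : measurable_fun setT V'.
  apply: (adp_mfun (@Gm n)).
  apply: (adp_sum (F := fun t x => ga eta n t x * cv n t x)) => t tn.
  apply: (adp_sub (Gmono_le Gmono (ltnW tn))).
  exact: (adp_gcvar Q s2 q Gmono adee ee0 adm eta (@adh n) Dn).
pose g x := expR (- (c * v)) * (expR (c * V' x) * f' eta n x).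
have mg0 : measurable_fun setT (fun x => expR (c * V' x) * f' eta n x).
  apply: measurable_funM; last exact: mf'.
  by apply: measurableT_comp => //; apply: measurable_funM.
have g0b x : `|expR (c * V' x) * f' eta n x| <= expR (c * (2 * B)).
  rewrite normrM -[leRHS]mulr1 ler_pM// ger0_norm ?expR_ge0// ler_expR.
  by rewrite ler_wpM2l.
have Ig0 : intg P (fun x => expR (c * V' x) * f' eta n x) by exact: intg_bnd mg0 g0b.
have Ig : intg P g by exact: intgZ.
have If : intg P (f n) by exact: intg_bnd (@mf n) (f1 n).
have ev1 : expR (- (c * v)) <= 1 by rewrite expR_le1 oppr_le0 mulr_ge0// ltW.
have ev0 := expR_ge0 (- (c * v)).
have fg : `|\int[P]_x f n x - \int[P]_x g x| <= (1 + Mb) * e2.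
  apply: (Edist_whp If Ig mC (ltW e20)) => [x|x Cx|//].
    apply: le_trans (ler_normB _ _) _; apply: lerD; first exact: f1.
    rewrite /g normrM (ger0_norm ev0) -[leRHS]mul1r.
    by apply: ler_pM.
  have [/= gx Vx] := CE _ Cx.
  have V'E : V' x = V n x.
    by apply: eq_bigr => t _; rewrite gx ?mul1r.
  rewrite /g V'E ff'// mulrA -expRD -{1}(mul1r (f n x)) -mulrBl normrM -[leRHS]mulr1.
  apply: ler_pM => //; rewrite distrC.
  have uE : - (c * v) + c * V n x = c * (V n x - v) by ring.
  have ub : `|c * (V n x - v)| <= Num.min 2^-1 (e2 / 2).
    rewrite normrM (ger0_norm c0) mulrC.
    apply: le_trans (_ : e3 * (c + 1) <= _); last by rewrite /e3 divfK// gt_eqF.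
    by apply: ler_pM => //; rewrite lerDl.
  rewrite uE; apply: le_trans (expRB1_le _) _.
    by apply: le_trans ub _; rewrite ge_min lexx.
  by move: ub; rewrite le_min => /andP[_]; lra.
have gk : `|\int[P]_x g x - expR (- (c * v)) * k| <= eps / 2.
  rewrite /g EZ// -mulrBr normrM (ger0_norm ev0).
  apply: (@le_trans _ _ (K1 * eta)).
    rewrite -[leRHS]mul1r; apply: ler_pM => //.
    by apply: hk => //; exact: ltW.
  rewrite /eta mulrA ler_pdivrMr// mulrC ler_wpM2l ?divr_ge0 ?(ltW e0)//.
  by rewrite lerDl.
rewrite (splitr eps); apply: le_trans (ler_distD (\int[P]_x g x) _ _) _.
apply: lerD => //; apply: le_trans fg _.
by rewrite /e2 mulrC divfK// gt_eqF.
Qed.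

Let mic n t : measurable_fun setT (ic n t).
Proof. by apply: (adp_mfun (@Gm t.+1)); apply: (adp_incr Q Gmono) => //; exact: adh. Qed.

Let mS n : measurable_fun setT (S n).
Proof. by apply: measurable_sum => t; exact: mic. Qed.

Let mgic eta n t : 0 < D n -> measurable_fun setT (fun x => ga eta n t x * ic n t x).
Proof.
move=> Dn; apply: (adp_mfun (@Gm t.+1)).
by apply: (adp_gincr Q q Gmono) => //; exact: adh.
Qed.

Lemma clt_charf (a b : R) :
  \int[P]_x cos (a * S n x + b) @[n --> \oo] --> expR (- (a ^+ 2 / 2 * v)) * cos b.
Proof.
apply/cvgrPdist_le => eps e0.
have c0 : 0 <= a ^+ 2 / 2 by rewrite divr_ge0 ?sqr_ge0.
have mcos (Z : T -> R) : measurable_fun setT Z -> measurable_fun setT (fun x => cos (a * Z x + b)).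
  move=> mZ; apply: measurableT_comp; first by apply: continuous_measurable_fun; exact: continuous_cos.
  by apply: measurable_funD => //; apply: measurable_funM.
have : forall eps, 0 < eps -> \forall n \near \oo,
    `|\int[P]_x cos (a * S n x + b) - expR (- (a ^+ 2 / 2 * v)) * cos b| <= eps.
  eapply (ungate (f := fun n x => cos (a * S n x + b))
    (f' := fun eta n x => cos (a * (\sum_(t < n) ga eta n t x * ic n t x) + b)) c0).
  - by move=> n; apply: mcos.
  - by move=> n x; exact: cos_max.
  - move=> eta n Dn; apply: (mcos (fun x => \sum_(t < n) ga eta n t x * ic n t x)).
    by apply: measurable_sum => t; exact: mgic.
  - by move=> eta n x; exact: cos_max.
  - move=> eta n x g1; congr (cos (a * _ + b)); apply: eq_bigr => t _.
    by rewrite g1 ?mul1r.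
  move=> eta n eta0 Dn.
  exact: (gated_charf Gm Gmono I01 adI adIy adee ee0 ee1 adm mM my core q23 Iyq
    Ey Ey2 s20w (@h0 n) (@adh n) Dn eta0 n a b).
by move=> /(_ _ e0); apply: filterS => n; rewrite distrC.
Qed.

Let QV0 n x : 0 <= QV n x.
Proof. by apply: sumr_ge0 => t _; exact: sqr_ge0. Qed.

Let mQV n : measurable_fun setT (QV n).
Proof. by apply: measurable_sum => t; apply: measurable_funX; exact: mic. Qed.

Let expQV01 a n x : 0 <= a -> `|expR (- (a * QV n x))| <= 1.
Proof.
by move=> a0; rewrite ger0_norm ?expR_ge0// expR_le1 oppr_le0 mulr_ge0.
Qed.

Let mexpQV a n : measurable_fun setT (fun x => expR (- (a * QV n x))).
Proof.
by apply: measurableT_comp => //; apply: measurableT_comp => //; apply: measurable_funM.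
Qed.

Lemma clt_laplace (a : R) : 0 <= a -> forall eps, 0 < eps -> \forall n \near \oo,
  `|\int[P]_x expR (- (a * QV n x)) - expR (- (a * v))| <= eps.
Proof.
move=> a0.
rewrite -[expR (- (a * v))]mulr1.
eapply (ungate (f := fun n x => expR (- (a * QV n x)))
  (f' := fun eta n x => expR (- (a * \sum_(t < n) (ga eta n t x * ic n t x) ^+ 2))) a0).
- by move=> n; exact: mexpQV.
- by move=> n x; exact: expQV01.
- move=> eta n Dn; apply: measurableT_comp => //; apply: measurableT_comp => //.
  apply: measurable_funM => //.
  by apply: measurable_sum => t; apply: measurable_funX; exact: mgic.
- move=> eta n x; rewrite ger0_norm ?expR_ge0// expR_le1 oppr_le0 mulr_ge0//.
  by apply: sumr_ge0 => t _; exact: sqr_ge0.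
- move=> eta n x g1; congr (expR (- (a * _))); apply: eq_bigr => t _.
  by rewrite g1 ?mul1r.
move=> eta n eta0 Dn.
exact: (gated_laplace Gm Gmono I01 adI adIy adee ee0 ee1 adm mM my core q23 Iyq
  Ey Ey2 s20w (@h0 n) (@adh n) Dn eta0 n a0).
Qed.

(* The Laplace transforms at 1 and 2 make the variance of [expR (- QV)] vanish. *)
Lemma whp_QV eps : 0 < eps -> whp P (fun n => [set x | `|QV n x - v| <= eps]).
Proof.
move=> e0 eps' e0'.
(* The distance from [expR (- v)] to [expR (- (v + eps))], the smaller of the two gaps; a deviation
   of [QV] beyond [eps] moves [u] by at least this much. *)
pose de := expR (- v) * (1 - expR (- eps)).
have ev0 := expR_gt0 (- v); have ev1 : expR (- v) <= 1 by rewrite expR_le1 oppr_le0 ltW.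
have de0 : 0 < de by rewrite mulr_gt0// subr_gt0 expR_lt1 oppr_lt0.
(* A third, because the mean of [f] collects the error of the transform at 2 once and the error at 1
   with factor [2 * expR (- v) <= 2]. *)
have k0 : 0 < eps' * de ^+ 2 / 3 by rewrite divr_gt0// mulr_gt0// exprn_gt0.
have L1 := clt_laplace ler01 k0; have L2 := clt_laplace (ler0n R 2) k0.
apply: filterS2 L1 L2 => n L1 L2.
pose u x := expR (- (1 * QV n x)).
pose u2 x := expR (- (2 * QV n x)).
have Iu : intg P u by exact: intg_bnd (@mexpQV 1 n) (fun x => expQV01 n x ler01).
have Iu2 : intg P u2 by exact: intg_bnd (@mexpQV 2 n) (fun x => expQV01 n x (ler0n R 2)).
have u2E x : u2 x = u x ^+ 2 by rewrite /u /u2 -expRM_natl -mulr_natl mulrN mul1r.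
pose f x := u2 x - (2 * expR (- v)) * u x + expR (- v) ^+ 2.
have fE x : f x = (u x - expR (- v)) ^+ 2 by rewrite /f u2E; ring.
have Iuz : intg P (fun x => (2 * expR (- v)) * u x) by exact: intgZ.
have If : intg P f by apply: intgD; [exact: intgB|exact: intg_cst].
have f0 x : 0 <= f x by rewrite fE sqr_ge0.
have Ef : \int[P]_x f x <= eps' * de ^+ 2.
  have -> : \int[P]_x f x = \int[P]_x u2 x - 2 * expR (- v) * \int[P]_x u x + expR (- v) ^+ 2.
    rewrite /f ED; last 2 first.
    - exact: intgB.
    - exact: intg_cst.
    by rewrite EB// Ecst EZ//.
  have e2v : expR (- (2 * v)) = expR (- v) ^+ 2.
    by rewrite -expRM_natl -mulr_natl mulrN.
  move: L1 L2; rewrite -/u -/u2 e2v mul1r !ler_norml => /andP[l1 l1'] /andP[l2 l2'].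
  set U := \int[P]_x u x in l1 *; set E := expR (- v) in ev0 ev1 l1 l2' *.
  set K := eps' * de ^+ 2 in k0 l1 l2' *; set U2 := \int[P]_x u2 x in l2' *.
  have b1 : 0 <= E * (U - E + K / 3) by rewrite mulr_ge0 ?(ltW ev0)//; lra.
  have b2 : 0 <= (1 - E) * (K / 3) by rewrite mulr_ge0 ?(ltW k0)//; lra.
  by move: b1 b2 l2'; lra.
have d20 : 0 < de ^+ 2 by rewrite exprn_gt0.
have mk := markov_ge0 If f0 d20.
have mA : measurable [set x | de ^+ 2 <= f x].
  by apply: measurable_ge_set; exact: intg_mfun If.
exists (~` [set x | de ^+ 2 <= f x]); split; first exact: measurableC.
  move=> x /= /negP; rewrite -ltNge fE -(real_normK (num_real (u x - _))) ltr_pXn2r ?nnegrE ?(ltW de0)//.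
  rewrite ltr_norml => /andP[h1 h2]; rewrite ler_norml; apply/andP; split; rewrite leNgt; apply/negP => hc.
    have : expR (- v) * expR eps <= u x.
      by rewrite -expRD /u mul1r ler_expR; move: hc; lra.
    have := expR_gt1 eps; rewrite e0 => ep1.
    have pn : expR eps * expR (- eps) = 1 by rewrite -expRD subrr expR0.
    have en0 := expR_gt0 (- eps).
    have p2 : 2 <= expR eps + expR (- eps).
      by have := expR_ge1Dx eps; have := expR_ge1Dx (- eps); lra.
    by move: h2; rewrite /de; nra.
  have : u x <= expR (- v) * expR (- eps).
    by rewrite -expRD /u mul1r ler_expR; move: hc; lra.
  by move: h1; rewrite /de; lra.
rewrite setCK; apply: (le_trans mk); rewrite lee_fin ler_pdivrMr//.
Qed.

Let B0 : 0 <= B. Proof. by rewrite addr_ge0 ?sqr_ge0// ltW. Qed.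

(** The stopped sum has a tail bound and agrees with [S] unless a gate is closed. The Lyapunov
    threshold 1 suffices, as the tail bound does not depend on it. *)
Lemma clt_tight eps : 0 < eps -> exists2 L : R, 0 < L &
  \forall n \near \oo, (P [set x | (L <= `|S n x|)%R] <= eps%:E)%E.
Proof.
(* Then [4 * B / L ^+ 2 <= eps / 2], since [L >= 1] and [L >= 8 * B / eps]. *)
move=> e0; pose L := 1 + 8 * B / eps.
have L1 : 1 <= L by rewrite lerDl divr_ge0 ?mulr_ge0// ltW.
have L0 : 0 < L by exact: lt_le_trans L1.
exists L => //; have e2 : 0 < eps / 2 by rewrite divr_gt0.
apply: filterS2 D0 (whp_gate ltr01 e2) => n Dn [C [mC CE PC]].
pose S' x := \sum_(t < n) ga 1 n t x * ic n t x.
have tl : (P [set x | (L <= `|S' x|)%R] <= (2 * (2 * B) / L ^+ 2)%:E)%E.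
  exact: (gated_tail Gm Gmono I01 adI adIy adee ee0 ee1 adm mM my core q23 Iyq
    Ey Ey2 s20w 1 (@h0 n) (@adh n) Dn n L0).
have mge (Z : T -> R) : measurable_fun setT Z -> measurable [set x | L <= `|Z x|].
  by move=> mZ; apply: measurable_ge_set; apply: measurableT_comp.
have mS' : measurable_fun setT S' by apply: measurable_sum => t; exact: mgic.
have mC' := measurableC mC.
apply: (@le_trans _ _ (P ([set x | L <= `|S' x|] `|` ~` C))).
  apply: le_measure; rewrite ?inE//; [exact: mge|by apply: measurableU => //; exact: mge|].
  move=> x /= h1; have [Cx|nC] := pselect (C x); last by right.
  left; suff -> : S' x = S n x by [].
  by apply: eq_bigr => t _; rewrite (CE _ Cx t) ?mul1r.
rewrite (splitr eps) EFinD; apply: (le_trans (measureU2 _ _ _)) => //; first exact: mge.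
apply: leeD => //; apply: (le_trans tl); rewrite lee_fin ler_pdivrMr ?exprn_gt0//.
have L2 : L <= L ^+ 2 by rewrite expr2 ler_peMl// ltW.
have -> : 2 * (2 * B) = eps / 2 * (8 * B / eps) by field; rewrite gt_eqF.
rewrite ler_wpM2l ?(ltW e2)//; apply: le_trans L2.
by rewrite /L lerDr.
Qed.

Let g t x := score I y ee m t x.
Let s n x := \sum_(t < n) h n t x.

Definition qhat n x := (\sum_(t < n) h n t x * score I y ee m t x) / \sum_(t < n) h n t x.
Definition vhat n x :=
  (\sum_(t < n) h n t x ^+ 2 * (score I y ee m t x - qhat n x) ^+ 2) / (\sum_(t < n) h n t x) ^+ 2.

Let s_ge0 n x : 0 <= s n x. Proof. exact: sumr_ge0. Qed.

Let whp_s : whp P (fun n => [set x | 0 < s n x]).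
Proof.
have w : whp P _ := Hagg 0.
apply: whpS w _; apply: nearW => n x /=; rewrite -/(s n x) => h1.
by rewrite lt_neqAle s_ge0 andbT eq_sym; apply: contraTneq h1 => ->; rewrite expr0n/= mul0r ltxx.
Qed.

Lemma qhat_consistent eps : 0 < eps -> whp P (fun n => [set x | `|qhat n x - Q| <= eps]).
Proof.
move=> e0 eps' e0'; have e2 : 0 < eps' / 2 by rewrite divr_gt0.
(* The error is [S * Num.sqrt D / s], so [|S| < L] and [s ^+ 2 / D > N] bound it by [eps]. *)
have [L L0 HL] := clt_tight e2; pose N := (L / eps) ^+ 2.
have N0 : 0 < N by rewrite exprn_gt0// divr_gt0.
have w : whp P _ := Hagg N; apply: filterS2 (filterI D0 HL) (w _ e2) => n [Dn HLn] [C [mC CE PC]].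
pose A := [set x | L <= `|S n x|].
have mA : measurable A.
  by apply: measurable_ge_set; apply: measurableT_comp => //; exact: mS.
exists (~` A `&` C); split; first by apply: measurableI => //; exact: measurableC.
  move=> x [/= /negP nA /CE /=]; rewrite -/(s n x) -ltNge in nA *; move=> hN.
  have s0 : s n x != 0.
    by apply: contraTneq hN => ->; rewrite expr0n/= mul0r -leNgt ltW.
  have s1 : 0 < s n x by rewrite lt_neqAle eq_sym s0 s_ge0.
  have qE := estimator_error (h := fun t => h n t x) (fun t => g t x) Q Dn s0.
  rewrite [X in `|X|](_ : _ = S n x * Num.sqrt (D n) / s n x); last exact: qE.
  rewrite -(ler_pXn2r (_ : (0 < 2)%N)) ?nnegrE ?(ltW e0)//.
  rewrite real_normK ?num_real// expr_div_n exprMn sqr_sqrtr ?(ltW Dn)//.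
  rewrite -/(s n x) ler_pdivrMr ?exprn_gt0//.
  have S2 : S n x ^+ 2 <= L ^+ 2.
    by rewrite -(real_normK (num_real (S n x))) ler_pXn2r ?nnegrE ?(ltW L0)//; exact: ltW.
  apply: (@le_trans _ _ (L ^+ 2 * D n)); first by rewrite ler_wpM2r// ltW.
  have -> : L ^+ 2 = eps ^+ 2 * N by rewrite /N; field; rewrite gt_eqF.
  rewrite -mulrA ler_wpM2l ?sqr_ge0//.
  by move: hN; rewrite ltr_pdivlMr// => /ltW.
rewrite setCI setCK (splitr eps') EFinD; apply: (le_trans (measureU2 _ _ _)) => //.
  exact: measurableC.
exact: leeD.
Qed.

Let Rn n x := (\sum_(t < n) h n t x ^+ 2 * (g t x - qhat n x) ^+ 2) / D n.

Let whp_Rn eps : 0 < eps -> whp P (fun n => [set x | `|Rn n x - v| <= eps]).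
Proof.
(* [residual_qv] errs by [r * (2 + QV) + 2 * r ^+ 2], at most [r * (v + 5)] once [r <= 1] and
   [QV <= v + 1]. *)
move=> e0; pose r := Num.min 1 (eps / 2 / (v + 5)).
have v5 : 0 < v + 5 by rewrite addr_gt0.
have r0 : 0 < r by rewrite lt_min ltr01/= !divr_gt0.
have r1 : r <= 1 by rewrite ge_min lexx.
have r2 : r * (v + 5) <= eps / 2 by rewrite -ler_pdivlMr// ge_min lexx orbT.
pose k := Num.min 1 (eps / 2).
have k0 : 0 < k by rewrite lt_min ltr01/= divr_gt0.
have k1 : k <= 1 by rewrite ge_min lexx.
have k2 : k <= eps / 2 by rewrite ge_min lexx orbT.
have w1 : whp P _ := qhat_consistent r0; have w2 : whp P _ := whp_QV k0.
have w3 : whp P _ := Huse ltr01.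
apply: whpS (whpI (whpI w1 w2) (whpI w3 whp_D0)) _.
apply: nearW => n x [[/= hq hv] [hU Dn]].
have A2 : \sum_(t < n) h n t x ^+ 2 / D n <= 2.
  apply: (@le_trans _ _ (\sum_(t < n) awt ee (h n) (D n) t x)); last first.
    by move: hU; rewrite ler_norml => /andP[_]; lra.
  apply: ler_sum => t _; rewrite /awt ler_wpM2r ?invr_ge0 ?(ltW Dn)//.
  by rewrite ler_pdivlMr// ler_piMr ?sqr_ge0.
have := residual_qv (h := fun t => h n t x) (g := fun t => g t x) (Q := Q) Dn hq A2.
rewrite -/(Rn n x) -/(QV n x) => h1.
have qvb : QV n x <= v + 1 by move: hv; rewrite ler_norml => /andP[_]; lra.
have := ler_distD (QV n x) (Rn n x) v => /le_trans; apply.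
have rr : r ^+ 2 <= r by rewrite expr2 ler_piMl// ltW.
have rq : r * QV n x <= r * (v + 1) by rewrite ler_wpM2l// ltW.
rewrite (splitr eps); apply: lerD; last exact: le_trans hv k2.
by apply: (le_trans h1); apply: le_trans r2; move: rr rq; nra.
Qed.


Let mg t : measurable_fun setT (g t).
Proof.
have adg : adp (G t.+1) (g t).
  have aie : adp (G t.+1) (fun x => I t x / ee t x).
    apply: (@adpM _ _ _ _ (I t) (fun x => (ee t x)^-1)) => //.
    apply: (adp_sub (@Gmono t)); apply: adpV; exact: adee.
  have -> : g t = (fun x => (ee t x)^-1 * (I t x * y t x) + (1 - I t x / ee t x) * m t x).
    by apply: funext => x; rewrite /g /score; ring.
  apply: adpD.
    apply: (@adpM _ _ _ _ (fun x => (ee t x)^-1) (fun x => I t x * y t x)) => //.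
    apply: (adp_sub (@Gmono t)); apply: adpV; exact: adee.
  apply: (@adpM _ _ _ _ (fun x => 1 - I t x / ee t x) (m t)).
    by apply: adpB => //; exact: adp_cst.
  by apply: (adp_sub (@Gmono t)); exact: adm.
exact: (adp_mfun (@Gm t.+1)).
Qed.

Let mh n t : measurable_fun setT (h n t).
Proof. exact: (adp_mfun (@Gm t)). Qed.

Lemma mqhat n : measurable_fun setT (qhat n).
Proof.
apply: measurable_funM.
  by apply: measurable_sum => t; apply: measurable_funM; [exact: mh|exact: mg].
by apply: (measurableT_comp (@mfun_inv R)); apply: measurable_sum => t; exact: mh.
Qed.

Lemma mvhat n : measurable_fun setT (vhat n).
Proof.
apply: measurable_funM.
  apply: measurable_sum => t; apply: measurable_funM; apply: measurable_funX.
    exact: mh.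
  by apply: measurable_funB; [exact: mg|exact: mqhat].
by apply: (measurableT_comp (@mfun_inv R)); apply: measurable_funX; apply: measurable_sum => t; exact: mh.
Qed.

Lemma mstudentized n : measurable_fun setT (fun x => (qhat n x - Q) / Num.sqrt (vhat n x)).
Proof.
apply: measurable_funM; first by apply: measurable_funB => //; exact: mqhat.
apply: (measurableT_comp (@mfun_inv R)); apply: measurableT_comp; last exact: mvhat.
by apply: continuous_measurable_fun; exact: sqrt_continuous.
Qed.

Lemma studentized_clt (r : R) :
  P [set x | (qhat n x - Q) / Num.sqrt (vhat n x) <= r] @[n --> \oo] -->
  std_normal R `]-oo, r]%classic.
Proof.
have sv0 : 0 < Num.sqrt v by rewrite sqrtr_gt0.
pose X n x := S n x / Num.sqrt v.
have mX n : measurable_fun setT (X n) by apply: measurable_funM => //; exact: mS.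
pose rho n x := Num.sqrt (Rn n x) / Num.sqrt v.
apply: (slutsky_cdf (P := P) (X := X) (rho := rho)
  (Z := fun n x => (qhat n x - Q) / Num.sqrt (vhat n x))).
- exact: mX.
- exact: mstudentized.
- move=> r'; apply: levy_cdf; first exact: mX.
    move=> a b; have := @clt_charf (a / Num.sqrt v) b.
    rewrite expr_div_n sqr_sqrtr ?(ltW v0)//.
    rewrite (_ : a ^+ 2 / v / 2 * v = a ^+ 2 / 2); last by field; rewrite gt_eqF.
    have -> // : (fun n => \int[P]_x cos (a / Num.sqrt v * S n x + b)) =
      (fun n => \int[P]_x cos (a * X n x + b)).
    apply/funext => n; apply: eq_Rintegral => x _.
    by congr (cos (_ + b)); rewrite /X; ring.
  move=> eps e0; have [L L0 HL] := clt_tight e0.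
  exists (L / Num.sqrt v); first by rewrite divr_gt0.
  apply: filterS HL => n; congr (P _ <= _)%E; apply/seteqP.
  by split=> x /=; rewrite /X normrM normfV (gtr0_norm sv0) ler_pM2r ?invr_gt0.
- move=> eps e0; have ev0 : 0 < eps * v by rewrite mulr_gt0.
  have w : whp P _ := whp_Rn ev0; apply: whpS (whpI w whp_D0) _.
  apply: nearW => n x [/= h1 Dn].
  have R0 : 0 <= Rn n x.
    apply: divr_ge0; last exact: ltW.
    by apply: sumr_ge0 => t _; rewrite mulr_ge0 ?sqr_ge0.
  have rho0 : 0 <= rho n x by rewrite divr_ge0 ?sqrtr_ge0.
  have rho2 : rho n x ^+ 2 = Rn n x / v by rewrite expr_div_n !sqr_sqrtr// ltW.
  (* As [rho + 1 >= 1], passing to the square only enlarges the distance to 1. *)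
  apply: (@le_trans _ _ `|rho n x ^+ 2 - 1|).
    rewrite subr_sqr_1 normrM ler_peMr// ger0_norm ?addr_ge0//.
    by rewrite lerDr.
  rewrite rho2 -{1}(divff (_ : v != 0)) ?gt_eqF// -mulrBl normrM normfV (gtr0_norm v0).
  by rewrite ler_pdivrMr.
apply: whpS (whpI whp_s whp_D0) _; apply: nearW => n x [/= s0 Dn].
have -> : X n x / rho n x = S n x / Num.sqrt (Rn n x).
  by rewrite /X /rho invfM invrK mulrCA -mulrA (mulrCA _ (S n x)) mulVf ?gt_eqF// mulr1.
exact: (studentized_error (h := fun t => h n t x) (fun t => g t x) Q Dn s0).
Qed.

End clt.

(** * Transfer to the bandit *)

Section ae.
Context {d : measure_display} {T : measurableType d} {R : realType}.
Variable P : probability T R.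

Lemma intg_ae (f g : T -> R) : measurable_fun setT f -> intg P g ->
  {ae P, forall x, f x = g x} -> intg P f /\ \int[P]_x f x = \int[P]_x g x.
Proof.
move=> mf Ig fg; have mg := intg_mfun Ig; split.
  apply/integrableP; split; first exact/measurable_EFinP.
  move/integrableP : Ig => [_]; congr (_ < _)%E.
  apply: ae_eq_integral => //.
  - by apply: measurableT_comp => //; exact/measurable_EFinP.
  - by apply: measurableT_comp => //; exact/measurable_EFinP.
  by apply: filterS fg => x /= -> _.
congr fine; apply: ae_eq_integral => //; try exact/measurable_EFinP.
by apply: filterS fg => x /= -> _.
Qed.

Lemma probability_eq_outside (A B N : set T) : measurable A -> measurable B -> P.-negligible N ->
  (forall x, ~ N x -> A x <-> B x) -> P A = P B.
Proof.
move=> mA mB [Z [mZ PZ NZ]] AB.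
have le C D : measurable C -> measurable D -> (forall x, ~ N x -> C x -> D x) -> (P C <= P D)%E.
  move=> mC mD CD; rewrite -[leRHS]adde0 -PZ.
  apply: (@le_trans _ _ (P (D `|` Z))); last exact: measureU2.
  apply: le_measure; rewrite ?inE//; first exact: measurableU.
  move=> x Cx; have [/NZ ?|nN] := pselect (N x); first by right.
  by left; exact: CD nN Cx.
by apply/eqP; rewrite eq_le !le// => x nN; case: (AB x nN).
Qed.

Lemma whp_ae (A : set T) : {ae P, forall x, A x} -> whp P (fun=> A).
Proof.
move=> [Z [mZ PZ NZ]] eps e0; apply: nearW => _; exists (~` Z); split.
- exact: measurableC.
- by move=> x nZ; apply: contra_notP nZ => nA; exact: NZ.
by rewrite setCK PZ lee_fin ltW.
Qed.

End ae.

(** * Lowering the exponent in the Lyapunov condition *)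

Section lyapunov_interpolation.
Context {d : measure_display} {T : measurableType d} {R : realType}.
Variables (ee h : nat -> T -> R) (D : R) (t : nat) (x : T).
Hypotheses (ee0 : 0 < ee t x) (h0 : 0 <= h t x) (D0 : 0 < D).

Let c := h t x / Num.sqrt D.
Let c0 : 0 <= c. Proof. by rewrite divr_ge0. Qed.

(** Isolates the ratio [c / ee], whose power is the only part depending on [del]; interpolation
    between exponents compares powers of this ratio. *)
Lemma lam_awt del : 0 < del ->
  lam ee (2 + del) h D t x = awt ee h D t x * (c / ee t x) `^ del.
Proof.
move=> d0; rewrite /lam -/c /awt.
have -> : h t x ^+ 2 / ee t x / D = c ^+ 2 / ee t x.
  rewrite /c expr_div_n sqr_sqrtr ?(ltW D0)//; field.
  by rewrite !gt_eqF.
have -> : c `^ (2 + del) = c ^+ 2 * c `^ del.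
  by rewrite powRD ?powR_mulrn// gt_eqF ?addr_gt0.
have -> : ee t x `^ (1 - (2 + del)) = (ee t x)^-1 * ee t x `^ (- del).
  rewrite (_ : 1 - (2 + del) = - 1 + - del); last by ring.
  by rewrite powRD ?powR_inv1 ?ltW// (gt_eqF ee0) implybT.
rewrite powRM ?invr_ge0 ?(ltW ee0)// -(powR_inv1 (ltW ee0)) -powRrM mulN1r.
ring.
Qed.

Lemma lam_powR del : 0 < del ->
  lam ee (2 + del) h D t x =
  h t x `^ (2 + del) / ee t x `^ (1 + del) / D `^ (1 + del / 2).
Proof.
move=> d0; rewrite /lam powRM ?invr_ge0 ?sqrtr_ge0//.
have -> : (Num.sqrt D)^-1 `^ (2 + del) = (D `^ (1 + del / 2))^-1.
  rewrite -(powR_inv1 (sqrtr_ge0 D)) -(powR12_sqrt (ltW D0)) -!powRrM -powRN.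
  by congr (_ `^ _); field.
by rewrite (_ : 1 - (2 + del) = - (1 + del)) ?powRN 1?mulrAC//; ring.
Qed.

(* Lowers the exponent in condition (iii): split at [h / (ee sqrt D) <= kap]. *)
Lemma lam_interp del del' kap : 0 < del' -> del' <= del -> 0 < kap ->
  lam ee (2 + del') h D t x <=
  awt ee h D t x * kap `^ del' + kap `^ (del' - del) * lam ee (2 + del) h D t x.
Proof.
move=> d0 dd k0; have d1 : 0 < del by exact: lt_le_trans dd.
rewrite !lam_awt// mulrCA -mulrDr ler_wpM2l//.
  by rewrite /awt !mulr_ge0 ?invr_ge0 ?sqr_ge0// ltW.
have b0 : 0 <= c / ee t x by rewrite divr_ge0// ltW.
have [bk|kb] := leP (c / ee t x) kap.
  rewrite -[leLHS]addr0; apply: lerD; last by rewrite mulr_ge0 ?powR_ge0.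
  by apply: ge0_ler_powR; rewrite ?nnegrE// ltW.
rewrite -[leLHS]add0r; apply: lerD; first exact: powR_ge0.
have bp : 0 < c / ee t x by exact: lt_trans kb.
rewrite -[leLHS]mul1r -{1}(powRr0 kap) -{1}(subrr (del' - del)) powRD ?(gt_eqF k0) ?implybT//.
rewrite -mulrA ler_wpM2l ?powR_ge0//.
rewrite opprB (_ : (c / ee t x) `^ del = (c / ee t x) `^ (del - del') * (c / ee t x) `^ del'); last first.
  by rewrite -powRD ?subrK// (gt_eqF bp) implybT.
rewrite ler_wpM2r ?powR_ge0//.
by apply: ge0_ler_powR; rewrite ?nnegrE ?subr_ge0// ltW.
Qed.

End lyapunov_interpolation.

Section transfer.
Context {R : realType} {d : measure_display} {T : measurableType d}.
Variables (P : probability T R) (W : finType) (Wt : nat -> T -> W).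
Variables (Y : nat -> W -> T -> R) (e : nat -> W -> T -> R) (w : W).
Variables (mh : nat -> T -> R) (h : nat -> nat -> T -> R) (Q : R).
Hypothesis mW : forall t (a : W), measurable (Wt t @^-1` [set a]).
Hypothesis mY : forall t a, measurable_fun setT (Y t a).
Hypothesis iidY : iid_vectors P Y.
Hypothesis eH : forall t a, is_cond_prob P (hist_sigma Wt Y t) (Wt t @^-1` [set a]) (e t a).
Hypothesis eF : forall t a,
  is_cond_prob P (<<s hist_gen Wt Y t `|` future_gen Y t >>) (Wt t @^-1` [set a]) (e t a).
Hypothesis e0 : forall t a x, 0 < e t a x.
Hypothesis adm : forall t, meas_wrt (hist_sigma Wt Y t) (mh t).
Hypothesis h0 : forall n t x, 0 <= h n t x.
Hypothesis adh : forall n t, meas_wrt (hist_sigma Wt Y t) (h n t).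

Local Notation G := (hist_gen Wt Y).
Let I t x : R := (Wt t x == w)%:R.
Let y t x := Y t w x.
Let e_ t x := e t w x.
(* a version of the conditional probability bounded by 1 everywhere *)
Let ee t x := Num.min (e t w x) 1.

Let Gm k : G k `<=` d.-measurable. Proof. exact: hist_meas. Qed.

Let Gmono k : <<s G k>> `<=` <<s G k.+1>>.
Proof. by apply: sig_mono => A GA; apply: sub_sigma_algebra; exact: hist_mono. Qed.

Let I01 t x : I t x = 0 \/ I t x = 1.
Proof. by rewrite /I; case: (_ == _); [right|left]. Qed.

Let sigW t : <<s G t.+1>> (Wt t @^-1` [set w]).
Proof. by apply: sub_sigma_algebra; exists t => //; left; exists w. Qed.

Let adI t : adp (G t.+1) (I t).
Proof.
have -> : I t = (\1_(Wt t @^-1` [set w]) : T -> R).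
  by apply/funext => x; rewrite indicE /I; congr (nat_of_bool _)%:R; apply/eqP/idP => [?|/set_mem//]; exact: mem_set.
by apply: (@measurable_indic _ (g_sigma_algebraType (G t.+1))); exact: sigW.
Qed.

Let adIy t : adp (G t.+1) (fun x => I t x * y t x).
Proof.
have -> : (fun x => I t x * y t x) = (fun x => I t x * Y t (Wt t x) x).
  by apply/funext => x; rewrite /I /y; case: eqP => [->//|_]; rewrite !mul0r.
apply: (@adpM _ _ _ _ (I t) (fun x => Y t (Wt t x) x)) => //.
apply/adp_wrt => B mB; apply: sub_sigma_algebra; exists t => //.
by right; exists B.
Qed.

Let ade t : adp (G t) (e_ t).
Proof. by apply/adp_wrt; have [] := eH t w. Qed.

Let adee t : adp (G t) (ee t).
Proof.
apply: (adp_comp (phi := fun u => Num.min u 1)); last exact: ade.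
exact: measurable_minr.
Qed.

Let ee0 t x : 0 < ee t x. Proof. by rewrite lt_min e0 ltr01. Qed.

Let ee1 t x : ee t x <= 1. Proof. by rewrite ge_min lexx orbT. Qed.

Let adm' t : adp (G t) (mh t). Proof. by apply/adp_wrt; exact: adm. Qed.

Let adh' n t : adp (G t) (h n t). Proof. by apply/adp_wrt; exact: adh. Qed.

Let prodf t (K : T -> R) (phi : R -> R) := @product_formula R d T P W Wt Y e mW mY iidY eH eF e0 t w K phi.

(** The product formula is tested with [1_A / e], where [A] is the event [e > 1]: the mean of [1_A]
    equals that of [1_A I / e], although the latter is strictly smaller on [A]. *)
Let e1_ae t : {ae P, forall x, e t w x <= 1}.
Proof.
pose A := [set x | 1 < e t w x].
have mGA : <<s G t>> A.
  have := (eH t w).1 `]1, +oo[%classic (measurable_itv _).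
  by congr (<<s _ >> _); apply/seteqP; split => x /=; rewrite in_itv/= andbT.
have ad1 : adp (G t) (\1_A : T -> R) by exact: (@measurable_indic _ (g_sigma_algebraType (G t))).
have mA : measurable A by exact: (sig_meas (@Gm t)).
pose K x := \1_A x / e t w x.
have adK : adp (G t) K by apply: adpM => //; apply: adpV; exact: ade.
have KE : (fun x => K x * e t w x) = (\1_A : T -> R).
  by apply/funext => x; rewrite /K divfK// gt_eqF.
have IA : intg P (\1_A : T -> R) by exact: intg_indic.
have IK : intg P (fun x => K x * e t w x) by rewrite KE.
have m1 : measurable_fun [set: R] (fun=> 1 : R) by exact: measurable_cst.
have [IKI EKI] := prodf adK IK m1 (@intg_cst _ _ _ P 1).
have EK : \int[P]_x (K x * e t w x) = \int[P]_x (\1_A x : R) by rewrite KE.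
rewrite EK Ecst mulr1 in EKI.
pose f x := \1_A x - K x * (I t x * 1).
have If : intg P f by exact: intgB.
have Ef : \int[P]_x f x = 0 by rewrite /f EB// EKI subrr.
have f0 x : 0 <= f x.
  rewrite /f /K indicE; case: (boolP (x \in A)) => [/set_mem /= xA|_]; last by rewrite !mul0r subrr.
  rewrite mulr1n mulr1 mul1r subr_ge0; case: (I01 t x) => ->; rewrite ?mulr0// mulr1.
  by rewrite invf_le1// ltW.
have mf := intg_mfun If.
have : (\int[P]_x `|(f x)%:E| = 0)%E.
  by transitivity (\int[P]_x (f x)%:E)%E; [apply: eq_integral => x _; rewrite gee0_abs ?lee_fin|rewrite intgE// Ef].
have mEf : measurable_fun setT (EFin \o f) by exact/measurable_EFinP.
move/(ae_eq_integral_abs P measurableT mEf).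
apply: filterS => x /= /(_ Logic.I) [fx0].
rewrite leNgt; apply/negP => xA; move: fx0; rewrite /f /K indicE mem_set//=.
rewrite mulr1n mulr1 mul1r; case: (I01 t x) => ->; rewrite ?mulr0 ?subr0; first by move/eqP; rewrite oner_eq0.
rewrite mulr1 => /eqP; rewrite subr_eq0 => /eqP hE; move: xA.
by rewrite -[e t w x]invrK -hE invr1 ltxx.
Qed.

Lemma cond_prob_le1 : {ae P, forall x, forall t, e t w x <= 1}.
Proof. exact/ae_foralln. Qed.

Let eeE x : (forall t, e t w x <= 1) -> forall t, ee t x = e t w x.
Proof. by move=> ex t; rewrite /ee min_l. Qed.

(** The multiplier [K * ee / e] in the original formula has the right product with [e] everywhere
    and equals [K] almost surely. *)
Let core t (K : T -> R) (phi : R -> R) :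
  adp (G t) K -> intg P (fun x => K x * ee t x) -> measurable_fun setT phi ->
  intg P (fun x => phi (y 0%N x)) ->
  intg P (fun x => K x * (I t x * phi (y t x))) /\
  \int[P]_x (K x * (I t x * phi (y t x))) =
  \int[P]_x (K x * ee t x) * \int[P]_x phi (y 0%N x).
Proof.
move=> adK IK mphi Iphi.
pose K' x := K x * ee t x / e t w x.
have K'E : (fun x => K' x * e t w x) = (fun x => K x * ee t x).
  by apply/funext => x; rewrite /K' divfK// gt_eqF.
have adK' : adp (G t) K'.
  apply: (@adpM _ _ _ _ (fun x => K x * ee t x) (fun x => (e t w x)^-1)).
    by apply: adpM => //; exact: adee.
  by apply: adpV; exact: ade.
have IK' : intg P (fun x => K' x * e t w x) by rewrite K'E.
have [J1 J2] := prodf adK' IK' mphi Iphi.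
rewrite K'E in J2; rewrite -J2; apply: (intg_ae _ J1).
  apply: measurable_funM; first exact: (adp_mfun (@Gm t)).
  apply: measurable_funM; first exact: (adp_mfun (@Gm t.+1)).
  by apply: (measurableT_comp mphi); exact: mY.
apply: filterS cond_prob_le1 => x ex; rewrite /K' -eeE// mulfK//.
by rewrite gt_eqF.
Qed.

Hypothesis cond1 : forall M : R,
  P [set x | M < (\sum_(t < n) h n t x) ^+ 2 / Dh P e w h n] @[n --> \oo] --> 1%E.
Variable p : R.
Hypothesis p1 : 1 < p.
Hypothesis cond2 :
  (\int[P]_x (`|Sh2e e w h n x / Dh P e w h n - 1| `^ p)%:E)%E @[n --> \oo] --> 0%E.
Variable del : R.
Hypothesis del0 : 0 < del.
Hypothesis cond3 : forall eps : R, 0 < eps ->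
  P [set x | eps < `|(\sum_(t < n) (h n t x `^ (2 + del)) / (e t w x `^ (1 + del)))
                       / (Dh P e w h n `^ (1 + del / 2))|] @[n --> \oo] --> 0%E.

Let D n := Dh P e w h n.

Let mh' n t : measurable_fun setT (h n t).
Proof. exact: (adp_mfun (@Gm t)). Qed.

Let me t : measurable_fun setT (e t w).
Proof. exact: (adp_mfun (@Gm t) (@ade t)). Qed.

Let Hagg (N : R) : whp P (fun n => [set x | N < (\sum_(t < n) h n t x) ^+ 2 / D n]).
Proof.
apply: whp_cvg1 (@cond1 N) => n.
apply: measurable_gt_set.
apply: measurable_funM => //; apply: measurable_funX.
by apply: measurable_sum => t; exact: mh'.
Qed.

(** Comes from (i) at level 0: for [D n <= 0] the quotient would be nowhere positive. This also
    excludes an infinite expectation, for which [Dh] takes the default value 0. *)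
Let D0 : \forall n \near \oo, 0 < D n.
Proof.
have w1 : whp P _ := Hagg 0; have h2 : 0 < 2^-1 :> R by rewrite invr_gt0.
apply: filterS (w1 _ h2) => n [B [mB BE PB]]; rewrite ltNge; apply/negP => Dn.
have B0 : B = set0.
  apply/seteqP; split => // x /BE /=; rewrite ltNge => /negP; apply.
  by rewrite mulr_ge0_le0 ?sqr_ge0// invr_le0.
move: PB; rewrite B0 setC0 probability_setT lee_fin.
by apply/negP; rewrite -ltNge invf_lt1// ltr1n.
Qed.

Let whp_e1 : whp P (fun=> [set x | forall t, e t w x <= 1]) := whp_ae cond_prob_le1.

Let awtE n x : (forall t, e t w x <= 1) ->
  \sum_(t < n) awt ee (h n) (D n) t x = Sh2e e w h n x / D n.
Proof.
move=> ex; rewrite /Sh2e mulr_suml; apply: eq_bigr => t _.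
by rewrite /awt eeE.
Qed.

(** Markov's inequality for the power [p] turns (ii) into convergence in probability. *)
Let Huse eps : 0 < eps ->
  whp P (fun n => [set x | `|\sum_(t < n) awt ee (h n) (D n) t x - 1| <= eps]).
Proof.
move=> e_0; pose f n x := `|Sh2e e w h n x / D n - 1| `^ p.
have p0 : 0 < p by exact: lt_trans p1.
have wf : whp P (fun n => [set x | `|Sh2e e w h n x / D n - 1| <= eps]).
  move=> eps' e0'; have ep0 : 0 < eps `^ p by rewrite powR_gt0.
  move: cond2 => /fine_cvgP[fin /cvgrPdist_le cv].
  have k0 : 0 < eps' * eps `^ p by rewrite mulr_gt0.
  apply: filterS2 fin (cv _ k0) => n fin; rewrite /= sub0r normrN => le.
  have mf : measurable_fun setT (f n).
    apply: (measurableT_comp (@measurable_powR R p)); apply: measurableT_comp => //.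
    apply: measurable_funB => //; apply: measurable_funM => //.
    apply: measurable_sum => t; apply: measurable_funM; first by apply: measurable_funX; exact: mh'.
    by apply: (measurableT_comp (@mfun_inv R)); exact: me.
  have f0 x : 0 <= f n x by exact: powR_ge0.
  have If : intg P (f n) by apply: intg_ge0 => //; rewrite ltey_eq fin.
  exists (~` [set x | eps `^ p <= f n x]); split.
  - by apply: measurableC; exact: measurable_ge_set.
  - move=> x /= /negP; rewrite -ltNge => fx; rewrite leNgt; apply/negP => ex; move: fx.
    apply/negP; rewrite -leNgt; apply: ge0_ler_powR; rewrite ?nnegrE ?(ltW p0) ?(ltW e_0)//.
    exact: ltW.
  rewrite setCK; apply: le_trans (markov_ge0 If f0 ep0) _.
  rewrite lee_fin ler_pdivrMr//; apply: le_trans le; exact: ler_norm.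
apply: whpS (whpI wf whp_e1) _; apply: nearW => n x [/= h1 h2].
by rewrite awtE.
Qed.

Let Hlam del' : 0 < del' -> del' <= del -> forall eps : R, 0 < eps ->
  whp P (fun n => [set x | \sum_(t < n) lam ee (2 + del') (h n) (D n) t x <= eps]).
Proof.
move=> d0 dd eps e_0.
(* The power [del'] of [kap] is [eps / 4], so weights summing to at most 2 contribute at most
   [eps / 2]. *)
pose kap := (eps / 4) `^ del'^-1.
have e4 : 0 < eps / 4 by rewrite divr_gt0.
have k0 : 0 < kap by rewrite powR_gt0.
have kE : kap `^ del' = eps / 4 by rewrite -powRrM mulVf ?gt_eqF// powRr1// ltW.
pose c2 := kap `^ (del' - del).
have c20 : 0 < c2 by rewrite powR_gt0.
have e2 : 0 < eps / 2 / c2 by rewrite !divr_gt0.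
have w3 : whp P (fun n => ~` [set x | eps / 2 / c2 <
    `|(\sum_(t < n) (h n t x `^ (2 + del)) / (e t w x `^ (1 + del))) / (D n `^ (1 + del / 2))|]).
  apply: whp_cvg0 (@cond3 _ e2) => n.
  apply: measurable_gt_set.
  apply: measurableT_comp => //; apply: measurable_funM => //.
  apply: measurable_sum => t; apply: measurable_funM.
    by apply: (measurableT_comp (@measurable_powR R _)); exact: mh'.
  apply: (measurableT_comp (@mfun_inv R)).
  by apply: (measurableT_comp (@measurable_powR R _)); exact: me.
have wD : whp P (fun n => [set x | 0 < D n]).
  by apply: whp_near; apply: filterS D0 => n Dn; apply/seteqP; split.
have wU : whp P _ := Huse ltr01.
apply: whpS (whpI (whpI w3 whp_e1) (whpI wU wD)) _; apply: nearW => n x [[/= h3 h1] [hU Dn]].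
apply: (@le_trans _ _ (\sum_(t < n) (awt ee (h n) (D n) t x * kap `^ del' +
    c2 * lam ee (2 + del) (h n) (D n) t x))).
  by apply: ler_sum => t _; apply: lam_interp.
rewrite big_split/= -mulr_suml -mulr_sumr (splitr eps); apply: lerD.
  rewrite kE (_ : eps / 2 = 2 * (eps / 4)); last by field.
  rewrite ler_wpM2r ?(ltW e4)//.
  by move: hU; rewrite ler_norml => /andP[_]; lra.
rewrite mulrC -ler_pdivlMr//; move: h3 => /negP; rewrite -leNgt.
apply: le_trans; apply: le_trans (ler_norm _).
rewrite mulr_suml; apply: ler_sum => t _.
by rewrite lam_powR// eeE.
Qed.

Variable del1 : R.
Hypothesis del10 : 0 < del1.
Hypothesis mom : (\int[P]_x (`|Y 0%N w x| `^ (2 + del1))%:E < +oo)%E.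
Hypothesis EY : 'E_P[Y 0%N w]%E = Q%:E.
Hypothesis VY : 'V_P[Y 0%N w]%E != 0%E.
Variable M : R.
Hypothesis mM : forall t x, `|mh t x| <= M.
Variable kappa : R.
Hypothesis kappa0 : 0 <= kappa.
Hypothesis cz : {ae P, forall x, (1 - e t w x) * (Q - mh t x) ^+ 2 @[t --> \oo] --> kappa}.

(** The common exponent: at most 1 to keep [q <= 3], at most [del] for (iii), and at most [del1] for
    the moments. *)
Let del' := Num.min 1 (Num.min del del1).
Let q := 2 + del'.

Let del'0 : 0 < del'. Proof. by rewrite !lt_min ltr01 del0 del10. Qed.
Let del'1 : del' <= 1. Proof. by rewrite ge_min lexx. Qed.
Let del'd : del' <= del. Proof. by rewrite !ge_min lexx orbT. Qed.
Let del'd1 : del' <= del1. Proof. by rewrite !ge_min lexx !orbT. Qed.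

Let q23 : 2 <= q <= 3.
Proof. by rewrite /q; apply/andP; split; move: del'0 del'1; lra. Qed.

Let Iyp (r : R) : 0 <= r -> r <= 2 + del1 -> intg P (fun x => `|y 0%N x| `^ r).
Proof.
move=> r0 r1; have mpow s : measurable_fun setT (fun x => `|y 0%N x| `^ s).
  apply: (measurableT_comp (@measurable_powR R s)); apply: measurableT_comp => //.
  exact: mY.
apply: (@intg_le _ _ _ P _ (fun x => 1 + `|y 0%N x| `^ (2 + del1))) => //.
  apply: intgD; first exact: intg_cst.
  by apply: intg_ge0 => // x; exact: powR_ge0.
move=> x; rewrite [leLHS]ger0_norm ?powR_ge0// [leRHS]ger0_norm ?addr_ge0 ?powR_ge0//.
have [z1|z1] := leP `|y 0%N x| 1.
  apply: (@le_trans _ _ 1); last by rewrite lerDl powR_ge0.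
  have <- : 1 `^ r = 1 :> R by rewrite powR1.
  by apply: ge0_ler_powR; rewrite ?nnegrE.
apply: (@le_trans _ _ (`|y 0%N x| `^ (2 + del1))); last by rewrite lerDr.
by apply: ler_powR => //; exact: ltW.
Qed.

Let Iyq : intg P (fun x => `|y 0%N x| `^ q).
Proof. by apply: Iyp; [move: del'0|move: del'd1]; rewrite /q; lra. Qed.

Let Iy2 : intg P (fun x => y 0%N x ^+ 2).
Proof.
have -> : (fun x => y 0%N x ^+ 2) = (fun x => `|y 0%N x| `^ 2).
  by apply/funext => x; rewrite powR_mulrn// real_normK ?num_real.
by apply: Iyp => //; move: del10; lra.
Qed.

Let Iy1 : intg P (y 0%N).
Proof.
have h1 : intg P (fun x => `|y 0%N x| `^ 1) by apply: Iyp => //; move: del10; lra.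
apply: (intg_le _ h1); first exact: mY.
by move=> x; rewrite powRr1// normr_id.
Qed.

Let Ey : \int[P]_x y 0%N x = Q.
Proof. by move: EY; rewrite expectation.unlock intgE// => -[]. Qed.

Let s2 := \int[P]_x (y 0%N x - Q) ^+ 2.

Let sqE : (fun x => (y 0%N x - Q) ^+ 2) = (fun x => y 0%N x ^+ 2 - (2 * Q * y 0%N x - Q ^+ 2)).
Proof. by apply/funext => x; ring. Qed.

Let I2 : intg P (fun x => 2 * Q * y 0%N x - Q ^+ 2).
Proof. by apply: intgB; [exact: intgZ|exact: intg_cst]. Qed.

Let Isq : intg P (fun x => (y 0%N x - Q) ^+ 2).
Proof. by rewrite sqE; exact: intgB. Qed.

Let Ey2 : \int[P]_x (y 0%N x ^+ 2) = s2 + Q ^+ 2.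
Proof.
rewrite /s2 sqE EB// EB; [|exact: intgZ|exact: intg_cst].
rewrite EZ// Ey Ecst; ring.
Qed.

Let s20 : 0 < s2.
Proof.
rewrite lt_neqAle Rintegral_ge0 ?andbT; last by move=> x _; exact: sqr_ge0.
apply: contra VY => /eqP s2E; rewrite /variance covariance.unlock EY.
rewrite expectation.unlock; apply/eqP.
transitivity (\int[P]_x ((y 0%N x - Q) ^+ 2)%:E)%E; last by rewrite intgE// -/s2 -s2E.
by apply: eq_integral => x _; rewrite /= expr2.
Qed.

(** The observed outcome may be read as the potential outcome of [w], because the indicator kills
    every other arm. *)
Let scoreE t x : aipw Wt Y e mh w t x = score I y e_ mh t x.
Proof.
by rewrite /aipw /score /I /y /e_; case: eqP => [->//|_]; rewrite !mul0r.
Qed.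

Let QhatE n x : Qhat Wt Y e mh w h n x = qhat I y e_ mh h n x.
Proof. by rewrite /Qhat /qhat; congr (_ / _); apply: eq_bigr => t _; rewrite scoreE. Qed.

Let VhatE n x : Vhat Wt Y e mh w h n x = vhat I y e_ mh h n x.
Proof.
by rewrite /Vhat /vhat QhatE; congr (_ / _); apply: eq_bigr => t _; rewrite scoreE.
Qed.

Let score_ee t x : (forall t, e t w x <= 1) -> score I y e_ mh t x = score I y ee mh t x.
Proof. by move=> ex; rewrite /score eeE. Qed.

Let qhat_ee n x : (forall t, e t w x <= 1) -> qhat I y e_ mh h n x = qhat I y ee mh h n x.
Proof.
by move=> ex; rewrite /qhat; congr (_ / _); apply: eq_bigr => t _; rewrite score_ee.
Qed.

Let vhat_ee n x : (forall t, e t w x <= 1) -> vhat I y e_ mh h n x = vhat I y ee mh h n x.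
Proof.
move=> ex; rewrite /vhat qhat_ee//; congr (_ / _); apply: eq_bigr => t _.
by rewrite score_ee.
Qed.

Let my t : measurable_fun setT (y t). Proof. exact: mY. Qed.

Lemma Qhat_consistent eps : 0 < eps ->
  P [set x | eps < `|Qhat Wt Y e mh w h n x - Q|] @[n --> \oo] --> 0%E.
Proof.
move=> e_0; apply: cvg0_whp => [n|].
  apply: measurable_gt_set.
  apply: measurableT_comp => //; apply: measurable_funB => //.
  rewrite (_ : Qhat _ _ _ _ _ _ _ = qhat I y e_ mh h n); last by apply/funext => x; exact: QhatE.
  exact: (mqhat Gm Gmono adI adIy ade adm' adh').
have wq : whp P _ := qhat_consistent Gm Gmono I01 adI adIy adee ee0 ee1 adm' mM my core
  q23 Iyq Ey Ey2 s20 h0 adh' D0 Hagg Huse (Hlam del'0 del'd) e_0.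
apply: whpS (whpI wq whp_e1) _; apply: nearW => n x [/= h1 h2]; apply/negP.
by rewrite -leNgt QhatE qhat_ee.
Qed.

Lemma Qhat_clt r :
  P [set x | (Qhat Wt Y e mh w h n x - Q) / Num.sqrt (Vhat Wt Y e mh w h n x) <= r]
    @[n --> \oo] --> normal_prob 0 1 `]-oo, r].
Proof.
have Hz : {ae P, forall x, (1 - ee t x) * (Q - mh t x) ^+ 2 @[t --> \oo] --> kappa}.
  apply: filterS2 cond_prob_le1 cz => x ex.
  have -> // : (fun t => (1 - ee t x) * (Q - mh t x) ^+ 2) =
    (fun t => (1 - e t w x) * (Q - mh t x) ^+ 2).
  by apply/funext => t; rewrite eeE.
have cl := @studentized_clt _ _ _ _ _ _ _ _ _ _ _ _ _ Gm Gmono I01 adI adIy adee ee0 ee1 adm' mM my core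
  q23 Iyq Ey Ey2 s20 _ _ _ h0 adh' D0 kappa0 Hagg Huse (Hlam del'0 del'd) Hz r.
have -> : (fun n => P [set x | (Qhat Wt Y e mh w h n x - Q) /
    Num.sqrt (Vhat Wt Y e mh w h n x) <= r]) =
  (fun n => P [set x | (qhat I y ee mh h n x - Q) / Num.sqrt (vhat I y ee mh h n x) <= r]).
  (* The limit theorem concerns the truncated propensity [ee]; the two events differ only where some
     [e t w] exceeds 1, a null set. *)
  apply/funext => n; apply: (probability_eq_outside _ _ cond_prob_le1).
  - apply: measurable_le_set.
    rewrite (_ : (fun _ => _) = (fun x => (qhat I y e_ mh h n x - Q) / Num.sqrt (vhat I y e_ mh h n x))).
      exact: (mstudentized Q Gm Gmono adI adIy ade adm' adh').
    by apply/funext => x; rewrite QhatE VhatE.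
  - by apply: measurable_le_set; exact: (mstudentized Q Gm Gmono adI adIy adee adm' adh').
  by move=> x /= /contrapT ex; rewrite QhatE VhatE qhat_ee// vhat_ee.
exact: cl.
Qed.

End transfer.

Theorem theorem1 (R : realType) (d : measure_display) (T : measurableType d)
  (P : probability T R) (W : finType) (Wt : nat -> T -> W)
  (Y : nat -> W -> T -> R) (e : nat -> W -> T -> R) (w : W)
  (mh : nat -> T -> R) (h : nat -> nat -> T -> R) (Q : R) :
  (forall t (a : W), measurable (Wt t @^-1` [set a])) ->
  (forall t a, measurable_fun setT (Y t a)) ->
  iid_vectors P Y ->
  (forall t a, ('V_P[Y t a] != 0)%E) ->
  (exists2 delta : R, 0 < delta &
     forall t a, (\int[P]_x (`|Y t a x| `^ (2 + delta))%:E < +oo)%E) ->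
  (forall t a, is_cond_prob P (hist_sigma Wt Y t) (Wt t @^-1` [set a]) (e t a)) ->
  (forall t a, is_cond_prob P (<<s hist_gen Wt Y t `|` future_gen Y t >>)
                  (Wt t @^-1` [set a]) (e t a)) ->
  (forall t a x, 0 < e t a x) ->
  (forall t, 'E_P[Y t w] = Q%:E)%E ->
  (forall t, meas_wrt (hist_sigma Wt Y t) (mh t)) ->
  (exists M : R, forall t x, `|mh t x| <= M) ->
  (exists m_inf : R, {ae P, forall x, mh t x @[t --> \oo] --> m_inf}) ->
  (forall TT t x, 0 <= h TT t x) ->
  (forall TT t, meas_wrt (hist_sigma Wt Y t) (h TT t)) ->
  (* (i) *)
  (forall M : R,
     P [set x | M < (\sum_(t < TT) h TT t x) ^+ 2 / Dh P e w h TT]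
       @[TT --> \oo] --> 1%E) ->
  (* (ii) *)
  (exists2 p : R, 1 < p &
     (\int[P]_x (`|Sh2e e w h TT x / Dh P e w h TT - 1| `^ p)%:E)%E
       @[TT --> \oo] --> 0%E) ->
  (* (iii) *)
  (exists2 delta : R, 0 < delta &
     forall eps : R, 0 < eps ->
     P [set x | eps < `|(\sum_(t < TT) (h TT t x `^ (2 + delta))
                                   / (e t w x `^ (1 + delta)))
                       / (Dh P e w h TT `^ (1 + delta / 2))|]
       @[TT --> \oo] --> 0%E) ->
  ({ae P, forall x, mh t x @[t --> \oo] --> Q} \/
   exists2 e_inf : R, 0 <= e_inf <= 1 &
     {ae P, forall x, e t w x @[t --> \oo] --> e_inf}) ->
  (forall eps : R, 0 < eps ->
     P [set x | eps < `|Qhat Wt Y e mh w h TT x - Q|] @[TT --> \oo] --> 0%E) /\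
  (forall r : R,
     P [set x | (Qhat Wt Y e mh w h TT x - Q)
                  / Num.sqrt (Vhat Wt Y e mh w h TT x) <= r]
       @[TT --> \oo] --> normal_prob 0 1 `]-oo, r]).
Proof.
move=> mW mY iidY VY [del1 del10 mom] eH eF e0 EY adm [M mM] [m_inf cm] h0 adh c1.
move=> [p p1 c2] [del del0 c3] alt.
have sq (u : nat -> R) (l : R) : u t @[t --> \oo] --> l ->
    (Q - u t) ^+ 2 @[t --> \oo] --> (Q - l) ^+ 2.
  move=> cu; have cB : (fun t => Q - u t) @ \oo --> Q - l by apply: cvgB => //; exact: cvg_cst.
  by rewrite expr2; exact: (cvgM cB cB).
have [kappa kappa0 cz] : exists2 kappa : R, 0 <= kappa &
    {ae P, forall x, (1 - e t w x) * (Q - mh t x) ^+ 2 @[t --> \oo] --> kappa}.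
  case: alt => [cQ|[e_inf /andP[_ ei1] ce]].
    (* Almost surely [1 - e] lies in [0, 1] at all times, so the product is squeezed to 0 without
       any limit for [e]. *)
    have e1 := cond_prob_le1 w mW mY iidY eH eF e0.
    exists 0 => //; apply: filterS2 cQ e1 => x cQ ex.
    have sq0 : (Q - mh t x) ^+ 2 @[t --> \oo] --> (0 : R).
      rewrite (_ : 0 = (Q - Q) ^+ 2 :> R); last by rewrite subrr expr0n.
      exact: sq.
    apply: (squeeze_cvgr _ (cvg_cst 0) sq0); apply: nearW => t.
    have eg := e0 t w x; have el := ex t; have s := sqr_ge0 (Q - mh t x).
    by rewrite mulr_ge0 ?ler_piMl ?subr_ge0//; lra.
  exists ((1 - e_inf) * (Q - m_inf) ^+ 2); first by rewrite mulr_ge0 ?subr_ge0 ?sqr_ge0.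
  apply: filterS2 ce cm => x ce cm; apply: cvgM; last exact: sq.
  by apply: cvgB ce; exact: cvg_cst.
split.
- by apply: (Qhat_consistent mW mY iidY eH eF e0 adm h0 adh c1 p1 c2 del0 c3 del10 (mom 0%N w) (EY 0%N) (VY 0%N w) mM).
- by apply: (Qhat_clt mW mY iidY eH eF e0 adm h0 adh c1 p1 c2 del0 c3 del10 (mom 0%N w) (EY 0%N) (VY 0%N w) mM kappa0 cz).
Qed.
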